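(* Let $[a,b]\subset\mathbb{R}$ be a bounded interval and let $L=(L(t))_{t\in\mathbb{R}}$ be an $\mathbb{R}^m$-valued two-sided Lévy process with finite second moments. Assume that $F:[a,b]\times\mathbb{R}\to M_{d,m}(\mathbb{R})$ is a bounded measurable function such that the family $\{u\mapsto F(s,u)\}_{s\in[a,b]}$ is uniformly absolutely integrable and converges to zero uniformly (in $s\in[a,b]$) as $|u|\to\infty$. Then, almost surely, $$\int_a^b\int_{\mathbb{R}}F(s,u)\,dL(u)\,ds=\int_{\mathbb{R}}\int_a^bF(s,u)\,ds\,dL(u).$$
   Context: $M_{d,m}(\mathbb{R})$ is the space of real $d\times m$ matrices. A two-sided Lévy process is obtained from two independent copies $L_1,L_2$ of a one-sided càdlàg Lévy process by $L(t)=L_1(t)$ for $t\ge0$ and $L(t)=-L_2((-t)-)$ for $t<0$. Stochastic integrals of deterministic functions with respect to $L$ are defined as limits in $L^2(\Omega,\mathbb{P})$, and the process $s\mapsto\int_{\mathbb{R}}F(s,u)\,dL(u)$ is taken in a jointly measurable version. Uniform absolute integrability of the family means $\sup_{s\in[a,b]}\int_{\mathbb{R}}\|F(s,u)\|\,du<\infty$ and $\sup_{s\in[a,b]}\int_{|u|>N}\|F(s,u)\|\,du\to0$ as $N\to\infty$. *)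

(* Defs.v *)
From HB Require Import structures.
From mathcomp Require Import all_boot all_order all_algebra.
From mathcomp Require Import all_classical all_reals all_analysis.

Set Implicit Arguments.
Unset Strict Implicit.
Unset Printing Implicit Defensive.

Import Order.TTheory GRing.Theory Num.Theory.
Import numFieldNormedType.Exports.

Local Open Scope classical_set_scope.
Local Open Scope ring_scope.

Section matrix_valued_functions.
Context {R : realType}.

Definition mx_borel (m n : nat) : set (set 'M[R]_(m, n)) := <<s open >>.

(* Entrywise measurability, i.e. measurability for the product sigma-algebra
   on matrices, which is the Borel one. *)
Definition mx_measurable_fun (disp : measure_display)
    (T : measurableType disp) (m n : nat) (D : set T) (f : T -> 'M[R]_(m, n)) :=
  forall i j, measurable_fun D (fun x => f x i j).

Definition mx_Rintegral (disp : measure_display) (T : measurableType disp)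
    (mu : {measure set T -> \bar R}) (m n : nat) (D : set T)
    (f : T -> 'M[R]_(m, n)) : 'M[R]_(m, n) :=
  \matrix_(i, j) \int[mu]_(x in D) f x i j.

(* The norm on matrices is the library's, the maximum norm of the entries. *)
Definition cvg_Lp (disp : measure_display) (T : measurableType disp)
    (mu : {measure set T -> \bar R}) (p m n : nat)
    (f_ : nat -> T -> 'M[R]_(m, n)) (f : T -> 'M[R]_(m, n)) :=
  (\int[mu]_x (`|f_ k x - f x| ^+ p)%:E)%E @[k --> \oo] --> 0%E.

End matrix_valued_functions.

Section levy_processes.
Context {R : realType} (disp : measure_display) (T : measurableType disp).
Variables (P : probability T R) (m : nat).
Implicit Types L : R -> T -> 'cV[R]_m.

(* A one-sided process is a family indexed by R of which only the values at
   nonnegative times matter. *)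

Definition cadlag (x : R -> 'cV[R]_m) :=
  (forall t, 0 <= t -> x s @[s --> t^'+] --> x t) /\
  (forall t, 0 < t -> cvg (x s @[s --> t^'-])).

Record levy_process L : Prop := LevyProcess {
  levy_measurable : forall t, 0 <= t -> mx_measurable_fun setT (L t) ;
  levy_start : {ae P, forall w, L 0 w = 0} ;
  levy_independent_increments : forall (n : nat) (t : nat -> R)
      (B : nat -> set 'cV[R]_m),
    0 <= t 0%N -> (forall i, t i <= t i.+1) -> (forall i, mx_borel (B i)) ->
    P (\bigcap_(i < n) [set w | B i (L (t i.+1) w - L (t i) w)]) =
    (\prod_(i < n) P [set w | B i (L (t i.+1) w - L (t i) w)]%R)%E ;
  levy_stationary_increments : forall (s h : R) (B : set 'cV[R]_m),
    0 <= s -> 0 <= h -> mx_borel B ->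
    P [set w | B (L (s + h) w - L s w)] = P [set w | B (L h w - L 0 w)] ;
  levy_stochastically_continuous : forall t e : R, 0 <= t -> 0 < e ->
    P [set w | e < `|L s w - L t w|] @[s --> within [set s | 0 <= s] (nbhs t)]
      --> 0%E ;
  levy_cadlag : forall w, cadlag (L ^~ w) }.

Definition same_law L1 L2 := forall (n : nat) (t : nat -> R)
    (B : nat -> set 'cV[R]_m),
  (forall i, 0 <= t i) -> (forall i, mx_borel (B i)) ->
  P (\bigcap_(i < n) [set w | B i (L1 (t i) w)]) =
  P (\bigcap_(i < n) [set w | B i (L2 (t i) w)]).

Definition process_sigma L : set (set T) :=
  <<s [set A | exists t B, [/\ 0 <= t, mx_borel B & A = L t @^-1` B]] >>.

Definition independent_processes L1 L2 := forall A1 A2 : set T,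
  process_sigma L1 A1 -> process_sigma L2 A2 ->
  P (A1 `&` A2) = (P A1 * P A2)%E.

Definition two_sided L1 L2 : R -> T -> 'cV[R]_m := fun t w =>
  if 0 <= t then L1 t w else - lim (L2 s w @[s --> (- t)^'-]).

Definition two_sided_levy_process L := exists L1 L2,
  [/\ levy_process L1, levy_process L2, same_law L1 L2,
      independent_processes L1 L2 & L = two_sided L1 L2].

Definition finite_second_moments L :=
  forall t, (\int[P]_w (`|L t w| ^+ 2)%:E < +oo)%E.

End levy_processes.

Section stochastic_integral.
Context {R : realType} (disp : measure_display) (T : measurableType disp).
Variables (P : probability T R) (d m : nat).

(* The step function sum_(k < n) A_k 1_(t_k, t_(k+1)]. *)
Record step := Step {
  step_size : nat ;
  step_pt : nat -> R ;
  step_coef : nat -> 'M[R]_(d, m) ;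
  step_ptP : forall k, step_pt k <= step_pt k.+1 }.

Definition step_fun (g : step) (u : R) : 'M[R]_(d, m) :=
  \sum_(k < step_size g)
    \1_(`]step_pt g k, step_pt g k.+1]%classic) u *: step_coef g k.

Definition step_integral (L : R -> T -> 'cV[R]_m) (g : step) (w : T)
    : 'cV[R]_d :=
  \sum_(k < step_size g)
    step_coef g k *m (L (step_pt g k.+1) w - L (step_pt g k) w).

(* X is (a version of) the integral of f with respect to L, for f in L^1 and
   L^2. As the expectation of L need not vanish, the second moment of the
   integral of a step function g is controlled by |g|_1^2 + |g|_2^2, so the
   approximation of f is required in both norms; then X is unique up to
   almost sure equality and does not depend on the approximating sequence. *)
Definition is_stoch_integral (L : R -> T -> 'cV[R]_m)
    (f : R -> 'M[R]_(d, m)) (X : T -> 'cV[R]_d) :=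
  [/\ mx_measurable_fun setT f, mx_measurable_fun setT X &
      exists g : nat -> step,
        [/\ cvg_Lp lebesgue_measure 1 (fun n => step_fun (g n)) f,
            cvg_Lp lebesgue_measure 2 (fun n => step_fun (g n)) f &
            cvg_Lp P 2 (fun n => step_integral L (g n)) X]].

Definition measurable_integral_version (L : R -> T -> 'cV[R]_m) (a b : R)
    (F : R -> R -> 'M[R]_(d, m)) (Y : R -> T -> 'cV[R]_d) :=
  mx_measurable_fun (`[a, b]%classic `*` setT) (fun z : R * T => Y z.1 z.2) /\
  (forall s, s \in `[a, b] -> is_stoch_integral L (F s) (Y s)).

End stochastic_integral.

Section kernel_conditions.
Context {R : realType} (d m : nat).
Implicit Type F : R -> R -> 'M[R]_(d, m).

Definition uniformly_absolutely_integrable (a b : R) F :=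
  (ereal_sup [set \int[lebesgue_measure]_u `|F s u|%:E | s in `[a, b]]
    < +oo)%E /\
  (ereal_sup [set \int[lebesgue_measure]_(u in [set u : R | (N < `|u|)%R])
       `|F s u|%:E | s in `[a, b]])%E @[N --> +oo%R] --> 0%E.

Definition vanishes_uniformly_at_infinity (a b : R) F :=
  forall e : R, 0 < e -> exists N : R,
    forall s u, s \in `[a, b] -> N < `|u| -> `|F s u| < e.

End kernel_conditions.

(* Main.v *)
(* Additivity of the mean and of the covariance of an increment forces both to
   be linear in its length, so for a step function g the second moment of the
   integral of g is at most a constant times |g|_1^2 + |g|_2^2; for kernels
   bounded by C this is at most a constant times |g|_1. The averages of a
   bounded integrable kernel over a fine mesh converge to it almost everywhere
   by Lebesgue differentiation, hence in L^1 by Scheffe's lemma, and at a rate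
   which is measurable in the parameter s: choosing the mesh fast enough for
   each s yields a jointly measurable version of the integral. For a fixed mesh
   the two iterated integrals agree exactly, since averaging over the mesh
   commutes with integration in s, and both sides converge in L^1(P). *)
Require Import Defs.
From HB Require Import structures.
From mathcomp Require Import all_boot all_order all_algebra.
From mathcomp Require Import all_classical all_reals all_analysis.
From mathcomp Require Import measurable_realfun ring lra.

Set Implicit Arguments.
Unset Strict Implicit.
Unset Printing Implicit Defensive.

Import Order.TTheory GRing.Theory Num.Theory.
Import numFieldNormedType.Exports.

Local Open Scope classical_set_scope.
Local Open Scope ring_scope.

(** The integral of F(s, .) is an L^2 limit for each s separately: Y(s, .) is determined only up to
    a null set depending on s, and no mesh need be fine enough for all s at once. The proof
    therefore rests on an estimate whose constant depends only on the bounds of the kernel and which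
    is linear in the L^1 error of the mesh. Linearity lets it be integrated in s, where dominated
    convergence applies; the inequality |x| <= e + x^2 / e passes from second moments to L^1 without
    square roots. An additive function is linear only under some regularity. The variance has it
    because it is nonnegative, hence monotone; the mean gets a local bound from stochastic
    continuity. The moments E(l_s l_t) are then combinations of s t and min(s, t), which are
    products and intersections of lengths of ]0, s] and ]0, t]; bilinearity turns this into an
    isometry. At negative times the process is a left limit, which agrees almost surely with the
    value at each fixed time, so both half-lines are treated alike. The version Y being arbitrary,
    it is compared with the mesh integrals in L^1 of the product of ds and P; the same comparison
    shows that its paths are integrable in s. *)

Section square_integrable.
Context {R : realType} (disp : measure_display) (T : measurableType disp).
Variable mu : {measure set T -> \bar R}.
Implicit Types X Y : T -> R.

Definition square_integrable X :=
  measurable_fun setT X /\ (\int[mu]_w (X w ^+ 2)%:E < +oo)%E.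

Lemma square_integrable_sqr X : square_integrable X ->
  mu.-integrable setT (EFin \o (fun w => X w ^+ 2)).
Proof.
move=> [mX X2]; apply/integrableP; split.
  by apply/measurable_EFinP; apply: measurable_funX.
rewrite (_ : (fun x => _) = (fun w => (X w ^+ 2)%:E))//.
by apply/funext => w /=; rewrite ger0_norm// sqr_ge0.
Qed.

Lemma square_integrable_mul X Y : square_integrable X -> square_integrable Y ->
  mu.-integrable setT (EFin \o (fun w => X w * Y w)).
Proof.
move=> sX sY; have [mX _] := sX; have [mY _] := sY.
have : mu.-integrable setT ((EFin \o (fun w => X w ^+ 2)%R) \+
    (EFin \o (fun w => Y w ^+ 2)%R))%E.
  by apply: integrableD => //; exact: square_integrable_sqr.
apply: le_integrable => //.
  by apply/measurable_EFinP; apply: measurable_funM.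
move=> w _ /=; rewrite lee_fin normrM [leRHS]ger0_norm ?addr_ge0 ?sqr_ge0//.
rewrite -(real_normK (num_real (X w))) -(real_normK (num_real (Y w))).
have := normr_ge0 (X w); have := normr_ge0 (Y w).
by set x := `|X w|; set y := `|Y w| => *; nra.
Qed.

Lemma square_integrableD X Y : square_integrable X -> square_integrable Y ->
  square_integrable (fun w => X w + Y w).
Proof.
move=> sX sY; have [mX X2] := sX; have [mY Y2] := sY.
split; first exact: measurable_funD.
have /integrableP[_] : mu.-integrable setT ((fun w => 2%:E * (X w ^+ 2)%:E) \+
    (fun w => 2%:E * (Y w ^+ 2)%:E))%E.
  by apply: integrableD => //; apply: integrableZl => //;
    exact: square_integrable_sqr.
apply: le_lt_trans; apply: ge0_le_integral => //.
- by move=> w _; rewrite lee_fin sqr_ge0.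
- by apply/measurable_EFinP; apply: measurable_funX; apply: measurable_funD.
- apply: measurableT_comp => //; apply: emeasurable_funD;
    apply: emeasurable_funM => //; apply/measurable_EFinP; exact: measurable_funX.
- move=> w _; rewrite -!EFinM -EFinD lee_fin ger0_norm.
    by rewrite -subr_ge0 (_ : _ - _ = (X w - Y w) ^+ 2) ?sqr_ge0//; ring.
  by rewrite addr_ge0// mulr_ge0 ?sqr_ge0.
Qed.

Lemma square_integrableZ (k : R) X : square_integrable X ->
  square_integrable (fun w => k * X w).
Proof.
move=> sX; have [mX X2] := sX; split; first exact: measurable_funM.
under eq_integral do rewrite exprMn EFinM.
rewrite ge0_integralZl_EFin ?sqr_ge0//.
- by rewrite lte_mul_pinfty// lee_fin sqr_ge0.
- by move=> w _; rewrite lee_fin sqr_ge0.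
- by apply/measurable_EFinP; apply: measurable_funX.
Qed.

Lemma square_integrableN X : square_integrable X ->
  square_integrable (fun w => - X w).
Proof.
move=> /(square_integrableZ (-1)).
by rewrite (_ : (fun w => -1 * X w) = (fun w => - X w))//; apply/funext => w;
  rewrite mulN1r.
Qed.

Lemma square_integrableB X Y : square_integrable X -> square_integrable Y ->
  square_integrable (fun w => X w - Y w).
Proof. by move=> sX /square_integrableN; exact: square_integrableD. Qed.

Lemma square_integrable_sum I (s : seq I) (X : I -> T -> R) :
  (forall i, square_integrable (X i)) ->
  square_integrable (fun w => \sum_(i <- s) X i w).
Proof.
move=> sX; elim: s => [|i s ih].
  rewrite (_ : (fun _ => _) = cst 0); last first.
    by apply/funext => w; rewrite big_nil.
  split => //; under eq_integral do rewrite expr0n.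
  by rewrite integral0.
rewrite (_ : (fun _ => _) = fun w => X i w + \sum_(i <- s) X i w); last first.
  by apply/funext => w; rewrite big_cons.
exact: square_integrableD.
Qed.

End square_integrable.

(** * Expectations under equality in law and under independence *)

Section expectations.
Context {R : realType} (disp : measure_display) (T : measurableType disp).
Variable P : probability T R.
Implicit Types X Y : T -> R.

Lemma square_integrable_integrable X : square_integrable P X ->
  P.-integrable setT (EFin \o X).
Proof.
move=> sX; rewrite (_ : EFin \o X = EFin \o (fun w => X w * cst 1 w)).
  apply: square_integrable_mul => //; split => //.
  by under eq_integral do rewrite /= expr1n; rewrite integral_cst//= mul1e; rewrite (le_lt_trans (probability_le1 P measurableT)) // ltry.
by apply/funext => w /=; rewrite mulr1.
Qed.

Definition equal_law X Y :=
  forall A : set R, measurable A -> P (X @^-1` A) = P (Y @^-1` A).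

Definition independent_variables X Y := forall A B : set R,
  measurable A -> measurable B ->
  P (X @^-1` A `&` Y @^-1` B) = (P (X @^-1` A) * P (Y @^-1` B))%E.

Lemma equal_law_ge0_integral (f : R -> \bar R) X Y :
  measurable_fun setT X -> measurable_fun setT Y -> equal_law X Y ->
  measurable_fun setT f -> (forall x, 0 <= f x)%E ->
  (\int[P]_w f (X w) = \int[P]_w f (Y w))%E.
Proof.
move=> mX mY XY mf f0.
have <- := @ge0_integral_pushforward _ _ _ _ R X mX P setT f measurableT mf (fun y _ => f0 y).
have <- := @ge0_integral_pushforward _ _ _ _ R Y mY P setT f measurableT mf (fun y _ => f0 y).
apply: eq_measure_integral => A mA _; exact: XY.
Qed.

Lemma equal_law_Rintegral X Y :
  P.-integrable setT (EFin \o X) -> P.-integrable setT (EFin \o Y) ->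
  equal_law X Y -> \int[P]_w X w = \int[P]_w Y w.
Proof.
move=> iX iY XY; congr fine.
have mX : measurable_fun setT X by apply/measurable_EFinP; case/integrableP: iX.
have mY : measurable_fun setT Y by apply/measurable_EFinP; case/integrableP: iY.
have mE : measurable_fun setT (@EFin R) by exact/measurable_EFinP.
have <- := integral_pushforward mX mE iX measurableT.
have <- := integral_pushforward mY mE iY measurableT.
apply: eq_measure_integral => A mA _; exact: XY.
Qed.

(** Independence says that the joint law of (X, Y) is the product of the two laws; the expectation
    of the product is then an integral over the plane, which Fubini factors. *)
Lemma independent_Rintegral_mul X Y :
  square_integrable P X -> square_integrable P Y -> independent_variables X Y ->
  \int[P]_w (X w * Y w) = (\int[P]_w X w) * (\int[P]_w Y w).
Proof.
move=> sX sY XY; have [mX _] := sX; have [mY _] := sY.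
have iX := square_integrable_integrable sX.
have iY := square_integrable_integrable sY.
have iXY := square_integrable_mul sX sY.
have mE : measurable_fun setT (@EFin R) by exact/measurable_EFinP.
pose X' := mfun_Sub (mem_set mX : X \in mfun).
pose Y' := mfun_Sub (mem_set mY : Y \in mfun).
have mXY : measurable_fun setT (fun w => (X w, Y w)) by exact: measurable_fun_pair.
pose XY' := mfun_Sub (mem_set mXY : (fun w => (X w, Y w)) \in mfun).
pose f (z : R * R) := (z.1 * z.2)%:E : \bar R.
have mf : measurable_fun setT f.
  by apply/measurable_EFinP; apply: measurable_funM.
(* A product measure is determined by its values on rectangles, and on rectangles the equality is
   the hypothesis of independence. *)
have law A : measurable A -> (distribution P X' \x distribution P Y')%E A = distribution P XY' A.
  by apply: product_measure_unique.
rewrite /Rintegral.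
have -> : (\int[P]_w (X w * Y w)%:E = \int[distribution P X' \x distribution P Y']_z f z)%E.
  rewrite (@eq_measure_integral _ _ _ _ (distribution P XY'))//; last first.
    by move=> A mA _; exact: law.
  exact/esym/(integral_pushforward mXY mf iXY measurableT).
have ifxy : ((distribution P X' \x distribution P Y')%E).-integrable setT f.
  apply/integrableP; split => //.
  rewrite (@eq_measure_integral _ _ _ _ (distribution P XY'))//; last first.
    by move=> A mA _; exact: law.
  rewrite (@ge0_integral_pushforward _ _ _ _ R _ mXY P setT (abse \o f))//.
    by case/integrableP: iXY.
    exact: measurableT_comp.
  by move=> z _; exact: abse_ge0.
have iX' : (distribution P X').-integrable setT (EFin : R -> \bar R).
  exact: integrable_pushforward.
have iY' : (distribution P Y').-integrable setT (EFin : R -> \bar R).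
  exact: integrable_pushforward.
have EY : (\int[distribution P Y']_y y%:E = \int[P]_w (Y w)%:E)%E.
  exact: integral_pushforward.
have EX : (\int[distribution P X']_y y%:E = \int[P]_w (X w)%:E)%E.
  exact: integral_pushforward.
rewrite -integral12_prod_meas1// /fubini_F /f /=.
under eq_integral => x _.
  rewrite (_ : (fun y => (x * y)%:E) = (fun y => x%:E * y%:E)%E); last first.
    by apply/funext => y; rewrite EFinM.
  rewrite integralZl// EY.
  over.
have fY : (\int[P]_w (Y w)%:E)%E \is a fin_num by exact: integrable_fin_num.
rewrite -[in LHS](fineK fY) integralZr// EX fineM//.
exact: integrable_fin_num.
Qed.

End expectations.

(** * Linearity in time of the mean and of the variance *)

Section additive_functions.
Context {R : realType}.

(* Writing n t = k + r with k integer and r in [0, 1[, additivity gives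
   n f(t) = k f(1) + f(r), and one divides by n. *)
Lemma additive_bounded_linear (f : R -> R) (e B : R) :
  (forall s h, 0 <= s -> 0 <= h -> f (s + h) = f s + f h) ->
  0 < e -> (forall t, 0 <= t <= e -> `|f t| <= B) ->
  forall t, 0 <= t -> f t = f 1 * t.
Proof.
move=> fD e0 fB.
have f0 : f 0 = 0.
  by have := fD 0 0 (lexx 0) (lexx 0); rewrite addr0 => /eqP; rewrite -subr_eq0
    opprD addrA subrr sub0r oppr_eq0 => /eqP.
have fM n t : 0 <= t -> f (n%:R * t) = n%:R * f t.
  move=> t0; elim: n => [|n ih]; first by rewrite !mul0r.
  by rewrite -natr1 !mulrDl !mul1r fD// ?ih// mulr_ge0.
(* As N exceeds 1 / e, every r in [0, 1] is N times a point of [0, e], so the bound B on [0, e]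
   becomes N B on [0, 1]. *)
pose N := (Num.trunc e^-1).+1.
have N0 : 0 < N%:R :> R by rewrite ltr0n.
have NB r : 0 <= r <= 1 -> `|f r| <= N%:R * B.
  move=> /andP[r0 r1].
  have -> : r = N%:R * (r / N%:R) by rewrite mulrCA divff ?mulr1// gt_eqF.
  rewrite fM ?divr_ge0// normrM ger0_norm// ler_wpM2l// fB// divr_ge0//=.
  rewrite ler_pdivrMr// (le_trans r1)//.
  have : e^-1 < N%:R by rewrite /N; apply: truncnS_gt.
  by rewrite -(ltr_pM2l e0) divff ?gt_eqF// => /ltW.
move=> t t0; apply/eqP; rewrite -subr_eq0 -normr_le0; apply/ler_addgt0Pr => d d0.
rewrite add0r.
pose C := `|f 1| + N%:R * B.
have C0 : 0 <= C.
  by rewrite addr_ge0// (le_trans (normr_ge0 (f 0)))// NB// lexx ler01.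
pose n := (Num.trunc (C / d)).+1.
have n0 : 0 < n%:R :> R by rewrite ltr0n.
have nt0 : 0 <= n%:R * t by rewrite mulr_ge0.
pose k := Num.trunc (n%:R * t).
have /andP[kt tk] := truncn_itv nt0.
rewrite -/k in kt tk.
have key : n%:R * (f t - f 1 * t) = f (n%:R * t - k%:R) - (n%:R * t - k%:R) * f 1.
  have : f (n%:R * t) = k%:R * f 1 + f (n%:R * t - k%:R).
    by rewrite -{1}(subrKC k%:R (n%:R * t)) fD ?subr_ge0// -(mulr1 k%:R) fM ?mulr1.
  rewrite fM// => h; rewrite mulrBr h; ring.
have : `|n%:R * (f t - f 1 * t)| <= C.
  have r01 : 0 <= n%:R * t - k%:R <= 1.
    by rewrite subr_ge0 kt/= lerBlDl natr1 ltW.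
  rewrite key (le_trans (ler_normB _ _))// addrC lerD// ?NB//.
  rewrite normrM ger0_norm; last by case/andP: r01.
  by rewrite ler_piMl//; case/andP: r01.
rewrite normrM ger0_norm// => h.
rewrite -(ler_pM2l n0) (le_trans h)//.
have : C / d < n%:R by apply: truncnS_gt.
by rewrite ltr_pdivrMr// => /ltW.
Qed.

End additive_functions.

Section centered_moments.
Context {R : realType} (disp : measure_display) (T : measurableType disp).
Variable P : probability T R.
Implicit Types X Y : T -> R.

Lemma square_integrable_RintegralB X Y :
  square_integrable P X -> square_integrable P Y ->
  \int[P]_w (X w - Y w) = \int[P]_w X w - \int[P]_w Y w.
Proof. by move=> sX sY; rewrite RintegralB//; exact: square_integrable_integrable. Qed.

Lemma square_integrable_cst (c : R) : square_integrable P (cst c).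
Proof.
split => //.
have -> : (\int[P]_w (cst c w ^+ 2)%:E = (c ^+ 2)%:E * P setT)%E.
  by rewrite -integral_cst.
by rewrite probability_setT mule1 ltry.
Qed.

Lemma Rintegral_cst1 (c : R) : \int[P]_w c = c.
Proof.
rewrite Rintegral_cst//; transitivity (c * fine (P setT)) => //.
by rewrite probability_setT mulr1.
Qed.

Lemma square_integrable_Rintegral_sqrD X Y :
  square_integrable P X -> square_integrable P Y ->
  \int[P]_w (X w + Y w) ^+ 2 =
  \int[P]_w X w ^+ 2 + 2 * \int[P]_w (X w * Y w) + \int[P]_w Y w ^+ 2.
Proof.
move=> sX sY.
have iX := square_integrable_sqr sX; have iY := square_integrable_sqr sY.
have iXY := square_integrable_mul sX sY.
have i2 : P.-integrable setT (EFin \o (fun w => 2 * (X w * Y w))).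
  rewrite (_ : _ \o _ = fun w => 2%:E * (X w * Y w)%:E)%E; first exact: integrableZl.
  by apply/funext => w /=; rewrite EFinM.
rewrite -RintegralZl//.
have -> : \int[P]_w (X w + Y w) ^+ 2 =
    \int[P]_w (X w ^+ 2 + 2 * (X w * Y w) + Y w ^+ 2).
  by apply: eq_Rintegral => w _; ring.
rewrite RintegralD//; last first.
  have := integrableD measurableT iX i2.
  by apply: eq_integrable => // w _ /=.
by rewrite RintegralD.
Qed.

End centered_moments.

Section second_moments.
Context {R : realType} (disp : measure_display) (T : measurableType disp).
Variable P : probability T R.

(** What the moment computation asks of one coordinate of a Lévy process. The last field is a
    quantitative trace of stochastic continuity at 0, with thresholds 1 and 1/2; it keeps the mean
    bounded near 0. *)
Record scalar_levy (l : R -> T -> R) : Prop := ScalarLevy {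
  scalar_levy_sqr : forall t, 0 <= t -> square_integrable P (l t) ;
  scalar_levy0 : {ae P, forall w, l 0 w = 0} ;
  scalar_levy_independent : forall s t, 0 <= s -> s <= t ->
    independent_variables P (fun w => l s w - l 0 w) (fun w => l t w - l s w) ;
  scalar_levy_stationary : forall s h, 0 <= s -> 0 <= h ->
    equal_law P (fun w => l (s + h) w - l s w) (fun w => l h w - l 0 w) ;
  scalar_levy_small : exists2 e : R, 0 < e & forall t, 0 <= t <= e ->
    (P [set w | (1 < `|l t w - l 0 w|)%R] <= (2^-1)%:E)%E }.

Variable l : R -> T -> R.
Hypothesis hl : scalar_levy l.

Let m t := \int[P]_w l t w.
Let q t := \int[P]_w l t w ^+ 2.
Let v t := q t - m t ^+ 2.

(** The process starts at 0 only almost surely, whereas the laws in the record are those of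
    increments from time 0; values and increments are exchanged inside integrals through this null
    set. *)
Let ae0B (f : R -> T -> R) t : {ae P, forall w, f t w - l 0 w = f t w}.
Proof. by have := scalar_levy0 hl; apply: filterS => w ->; rewrite subr0. Qed.

Let sl := scalar_levy_sqr hl.

Let slB s t : 0 <= s -> 0 <= t -> square_integrable P (fun w => l t w - l s w).
Proof. by move=> s0 t0; apply: square_integrableB; exact: sl. Qed.

Let mB s t : 0 <= s -> 0 <= t -> \int[P]_w (l t w - l s w) = m t - m s.
Proof. by move=> s0 t0; rewrite square_integrable_RintegralB//; exact: sl. Qed.

Let aeRint X Y : square_integrable P X -> square_integrable P Y ->
  {ae P, forall w, X w = Y w} -> \int[P]_w X w = \int[P]_w Y w.
Proof.
move=> sX sY XY; congr fine; apply: ae_eq_integral => //.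
- by case/integrableP : (square_integrable_integrable sX).
- by case/integrableP : (square_integrable_integrable sY).
- by apply: filterS XY => w XY _; rewrite /= XY.
Qed.

Let aeRint2 X Y : square_integrable P X -> square_integrable P Y ->
  {ae P, forall w, X w = Y w} -> \int[P]_w X w ^+ 2 = \int[P]_w Y w ^+ 2.
Proof.
move=> sX sY XY; congr fine; apply: ae_eq_integral => //.
- by case/integrableP : (square_integrable_sqr sX).
- by case/integrableP : (square_integrable_sqr sY).
- by apply: filterS XY => w XY _; rewrite /= XY.
Qed.

Let m0 : m 0 = 0.
Proof.
rewrite /m (@aeRint _ (cst 0)) ?Rintegral_cst1//.
- exact: sl.
- exact: square_integrable_cst.
- exact: (scalar_levy0 hl).
Qed.

Let mD s h : 0 <= s -> 0 <= h -> m (s + h) = m s + m h.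
Proof.
move=> s0 h0; apply/eqP; rewrite (addrC (m s)) -subr_eq -mB ?addr_ge0//; apply/eqP.
rewrite (@equal_law_Rintegral _ _ _ _ _ (fun w => l h w - l 0 w))//.
- by rewrite mB// m0 subr0.
- by apply: square_integrable_integrable; apply: slB; rewrite // addr_ge0.
- by apply: square_integrable_integrable; apply: slB.
- exact: scalar_levy_stationary.
Qed.

Let qB s t : 0 <= s -> s <= t -> \int[P]_w (l t w - l s w) ^+ 2 = q (t - s).
Proof.
move=> s0 st; have ts0 : 0 <= t - s by rewrite subr_ge0.
have t0 : 0 <= t by rewrite (le_trans s0).
transitivity (\int[P]_w (l (t - s) w - l 0 w) ^+ 2).
  congr fine.
  apply: (@equal_law_ge0_integral _ _ _ P (fun x => (x ^+ 2)%:E)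
    (fun w => l t w - l s w) (fun w => l (t - s) w - l 0 w)).
  - exact: (slB _ _).1.
  - exact: (slB _ _).1.
  - by have := scalar_levy_stationary hl s0 ts0; rewrite subrKC.
  - by apply/measurable_EFinP; exact: measurable_funX.
  - by move=> x; rewrite lee_fin sqr_ge0.
apply: aeRint2; [exact: slB|exact: sl|exact: ae0B].
Qed.

Let cross s t : 0 <= s -> s <= t ->
  \int[P]_w (l s w * (l t w - l s w)) = m s * (m t - m s).
Proof.
move=> s0 st; have t0 : 0 <= t by rewrite (le_trans s0).
have := independent_Rintegral_mul (slB (lexx 0) s0) (slB s0 t0)
  (scalar_levy_independent hl s0 st).
rewrite !mB// m0 subr0 => <-.
congr fine; apply: ae_eq_integral => //.
- by case/integrableP : (square_integrable_mul (sl s0) (slB s0 t0)).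
- by case/integrableP : (square_integrable_mul (slB (lexx 0) s0) (slB s0 t0)).
- by have := ae0B l s; apply: filterS => w /= -> _.
Qed.

Let qD s h : 0 <= s -> 0 <= h -> q (s + h) = q s + 2 * (m s * m h) + q h.
Proof.
move=> s0 h0; have sh0 : 0 <= s + h by rewrite addr_ge0.
have ssh : s <= s + h by rewrite lerDl.
have := square_integrable_Rintegral_sqrD (sl s0) (slB s0 sh0).
under eq_Rintegral do rewrite subrKC.
move=> e; apply: (etrans e); rewrite (cross s0 ssh) (qB s0 ssh) (mD s0 h0).
by rewrite [s + h]addrC addrK [m s + m h]addrC addrK.
Qed.

Let vD s h : 0 <= s -> 0 <= h -> v (s + h) = v s + v h.
Proof. by move=> s0 h0; rewrite /v qD// mD//; ring. Qed.

Let vE t : 0 <= t -> \int[P]_w (l t w - m t) ^+ 2 = v t.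
Proof.
move=> t0; have := square_integrable_Rintegral_sqrD (sl t0) (square_integrable_cst P (- m t)).
rewrite /cst => ->; rewrite RintegralZr//; last exact/square_integrable_integrable/sl.
by rewrite Rintegral_cst1 -/(m t) /v /q; ring.
Qed.

Let v_ge0 t : 0 <= t -> 0 <= v t.
Proof. by move=> t0; rewrite -vE//; apply: Rintegral_ge0 => w _; rewrite sqr_ge0. Qed.

(** Additive and nonnegative, the variance is nondecreasing, so [v 1] bounds it on [0, 1]: this is
    the local bound that forces linearity. *)
Let vlin t : 0 <= t -> v t = v 1 * t.
Proof.
apply: (@additive_bounded_linear _ v 1 (v 1)) => //.
move=> s /andP[s0 s1]; rewrite ger0_norm ?v_ge0//.
by rewrite -[in leRHS](subrKC s 1) vD ?subr_ge0// lerDl v_ge0// subr_ge0.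
Qed.

(* On the event |l t| <= 1, of probability at least 1/2, the centered variable
   is at least |m t| - 1 in absolute value, while its second moment is v t. *)
Let mlin t : 0 <= t -> m t = m 1 * t.
Proof.
have [e e0 he] := scalar_levy_small hl.
(* Up to time e the tail bound holds, up to time 1 the variance is at most [v 1]. With x = |m t| > 1
   the argument gives (x - 1)^2 <= 2 [v 1], whence x <= 2 + 2 [v 1]. *)
apply: (@additive_bounded_linear _ m (Num.min e 1) (2 + 2 * v 1)) => //.
  by rewrite lt_min e0/=.
move=> {}t /andP[t0]; rewrite le_min => /andP[te t1].
have [m1|m1] := leP `|m t| 1.
  by rewrite (le_trans m1)// -subr_ge0; have := v_ge0 ler01; lra.
pose A := [set w | (1 < `|l t w - l 0 w|)%R].
have mA : measurable A.
  rewrite (_ : A = (fun w => `|l t w - l 0 w|) @^-1` `]1, +oo[); last first.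
    by apply/seteqP; split => w /=; rewrite in_itv/= andbT.
  rewrite -[X in measurable X]setTI; apply: (measurableT_comp _ (slB (lexx 0) t0).1) => //.
have PA : ((2^-1)%:E <= P (~` A))%E.
  rewrite probability_setC//.
  have := he t; rewrite t0 te => /(_ isT) h.
  rewrite (le_trans _ (leeB (lexx 1%E) h))// -EFinB lee_fin; lra.
have sc : square_integrable P (fun w => l t w - m t).
  by apply: square_integrableB; [exact: sl|exact: square_integrable_cst].
have : (((`|m t| - 1) ^+ 2)%:E * P (~` A) <= \int[P]_w ((l t w - m t) ^+ 2)%:E)%E.
  have mCA : measurable (~` A) by exact: measurableC.
  rewrite -[~` A]setIT -integral_indic//.
  rewrite -ge0_integralZl_EFin ?sqr_ge0//; last first.
    by apply/measurable_EFinP; exact: measurable_indic.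
  apply: ae_ge0_le_integral => //.
  - by move=> w _; rewrite -EFinM lee_fin mulr_ge0 ?sqr_ge0.
  - by apply: emeasurable_funM => //; apply/measurable_EFinP;
      exact: measurable_indic.
  - by move=> w _; rewrite lee_fin sqr_ge0.
  - by case/integrableP: (square_integrable_sqr sc).
  - have := scalar_levy0 hl; apply: filterS => w l0 _.
    rewrite -EFinM lee_fin indicE.
    have [|] := boolP (w \in ~` A); last by rewrite mulr0 sqr_ge0.
    rewrite inE /A/= l0 subr0 mulr1 => /negP; rewrite -leNgt => lt1.
    have h : `|m t| - `|l t w| <= `|l t w - m t| by rewrite distrC lerB_dist.
    rewrite -[leRHS]real_normK ?num_real// lerXn2r// ?nnegrE//; lra.
have -> : (\int[P]_w ((l t w - m t) ^+ 2)%:E = (v t)%:E)%E.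
  rewrite -vE// /Rintegral fineK//; apply: integrable_fin_num => //.
  exact: square_integrable_sqr.
move=> h.
have : ((`|m t| - 1) ^+ 2 / 2 <= v 1).
  rewrite (@le_trans _ _ (v t))//; last first.
    by rewrite vlin// ler_piMr// v_ge0.
  rewrite -lee_fin (le_trans _ h)// EFinM lee_wpmul2l// lee_fin sqr_ge0//.
by have := v_ge0 ler01; move: m1; set x := `|m t|; set y := v 1; nra.
Qed.

(** For s <= t, write l_t as l_s plus an independent increment. The result is put in the form s t
    and min(s, t) because these are the product of the lengths of ]0, s] and ]0, t] and the length
    of their intersection. *)
Lemma scalar_levy_moments : exists mu sg : R, 0 <= sg /\
  forall s t, 0 <= s -> 0 <= t ->
  \int[P]_w (l s w * l t w) = mu ^+ 2 * (s * t) + sg * Num.min s t.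
Proof.
exists (m 1), (v 1); split; first exact: v_ge0.
have sym s t : 0 <= s -> s <= t ->
    \int[P]_w (l s w * l t w) = m 1 ^+ 2 * (s * t) + v 1 * s.
  move=> s0 st; have t0 : 0 <= t by rewrite (le_trans s0).
  have : \int[P]_w (l s w * l t w) = \int[P]_w (l s w ^+ 2 + l s w * (l t w - l s w)).
    by apply: eq_Rintegral => w _; rewrite mulrBr expr2 subrKC.
  rewrite RintegralD//; last 2 first.
    exact/square_integrable_sqr/sl.
    by apply: square_integrable_mul; [exact: sl|exact: slB].
  rewrite cross// -/(q s) => ->.
  have -> : q s = v 1 * s + m s ^+ 2 by rewrite -vlin// /v subrK.
  by rewrite (mlin s0) (mlin t0); ring.
move=> s t s0 t0; have [st|/ltW ts] := leP s t; first exact: sym.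
by under eq_Rintegral do rewrite mulrC; rewrite sym// (mulrC t).
Qed.

End second_moments.

(** * Second moments of finite combinations of values of the process *)

Section Rintegral_sums.
Context {R : realType} (disp : measure_display) (T : measurableType disp).
Variable mu : {measure set T -> \bar R}.
Variable I : Type.
Implicit Types (s : seq I) (f : I -> T -> R).

Lemma integrable_EFin_sum s f : (forall i, mu.-integrable setT (EFin \o f i)) ->
  mu.-integrable setT (EFin \o (fun x => \sum_(i <- s) f i x)).
Proof.
move=> fi; rewrite (_ : _ \o _ = (fun x => \sum_(i <- s) (EFin \o f i) x))%E.
  exact: integrable_sum.
by apply/funext => x /=; rewrite sumEFin.
Qed.

Lemma Rintegral_sum s f : (forall i, mu.-integrable setT (EFin \o f i)) ->
  \int[mu]_x (\sum_(i <- s) f i x) = \sum_(i <- s) \int[mu]_x f i x.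
Proof.
move=> fi; elim: s => [|i s ih].
  rewrite big_nil; under eq_Rintegral do rewrite big_nil.
  by rewrite /Rintegral integral0.
rewrite big_cons -ih -RintegralD//; last exact: integrable_EFin_sum.
by apply: eq_Rintegral => x _; rewrite big_cons.
Qed.

Lemma Rintegral_sqr_sum s f :
  (forall i j, mu.-integrable setT (EFin \o (fun x => f i x * f j x))) ->
  \int[mu]_x (\sum_(i <- s) f i x) ^+ 2 =
  \sum_(i <- s) \sum_(j <- s) \int[mu]_x (f i x * f j x).
Proof.
move=> fi; under eq_Rintegral do rewrite expr2 big_distrlr/=.
rewrite Rintegral_sum; last by move=> i; exact: integrable_EFin_sum.
by apply: eq_bigr => i _; rewrite Rintegral_sum.
Qed.

End Rintegral_sums.

Lemma integrable_indic_lty {R : realType} (disp : measure_display)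
    (T : measurableType disp) (mu : {measure set T -> \bar R}) (A : set T) :
  measurable A -> (mu A < +oo)%E ->
  mu.-integrable setT (EFin \o \1_A).
Proof.
move=> mA Aoo; apply/integrableP; split.
  by apply/measurable_EFinP; exact: measurable_indic.
rewrite (eq_integral (fun x => (\1_A x)%:E)); last first.
  by move=> t _; rewrite /= ger0_norm.
by rewrite integral_indic// setIT.
Qed.

Lemma Rintegral_indic {R : realType} (disp : measure_display)
    (T : measurableType disp) (mu : {measure set T -> \bar R}) (A : set T) :
  measurable A -> \int[mu]_x \1_A x = fine (mu A).
Proof. by move=> mA; rewrite /Rintegral integral_indic// setIT. Qed.

Section one_sided_isometry.
Context {R : realType} (disp : measure_display) (T : measurableType disp).
Variable P : probability T R.
Variables (l : R -> T -> R) (A : R -> set R).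
Hypothesis hl : scalar_levy P l.
Hypothesis mA : forall t, measurable (A t).
Hypothesis AI : forall s t, 0 <= s -> 0 <= t ->
  lebesgue_measure (A s `&` A t) = (Num.min s t)%:E.
Local Notation mu := (@lebesgue_measure R).

Let AA t : 0 <= t -> mu (A t) = t%:E.
Proof. by move=> t0; rewrite -[A t]setIid AI// minxx. Qed.

Let iA1 t : 0 <= t -> mu.-integrable setT (EFin \o \1_(A t)).
Proof.
move=> t0; apply: integrable_indic_lty; first exact: (mA t).
by rewrite /= AA// ltry.
Qed.

Let iAI1 s t : 0 <= s -> 0 <= t ->
  mu.-integrable setT (EFin \o \1_(A s `&` A t)).
Proof.
move=> s0 t0; apply: integrable_indic_lty.
  by apply: measurableI; [exact: (mA s)|exact: (mA t)].
by rewrite /= AI// ltry.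
Qed.

Let iAI (c c' s t : R) : 0 <= s -> 0 <= t ->
  mu.-integrable setT (EFin \o (fun u => (c * \1_(A s) u) * (c' * \1_(A t) u))).
Proof.
move=> s0 t0.
rewrite (_ : _ \o _ = fun u => ((c * c')%:E * (\1_(A s `&` A t) u)%:E)%E).
  by apply: integrableZl => //; exact: iAI1.
by apply/funext => u /=; rewrite indicI/= -EFinM mulrACA.
Qed.

Let iA (c t : R) : 0 <= t -> mu.-integrable setT (EFin \o (fun u => c * \1_(A t) u)).
Proof.
move=> t0; rewrite (_ : _ \o _ = fun u => (c%:E * (\1_(A t) u)%:E)%E).
  by apply: integrableZl => //; exact: iA1.
by apply/funext => u /=; rewrite EFinM.
Qed.

(** Both sides are quadratic in the coefficients, so it is enough to compare them on pairs of times,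
    where [scalar_levy_moments] applies. The family [A] stays abstract in order to serve both ]0, t]
    and ]-t, 0]. *)
Lemma scalar_levy_isometry : exists m sg : R, 0 <= sg /\
  forall (I : Type) (r : seq I) (c t : I -> R), (forall i, 0 <= t i) ->
  \int[P]_w (\sum_(i <- r) c i * l (t i) w) ^+ 2 =
  m ^+ 2 * (\int[mu]_u (\sum_(i <- r) c i * \1_(A (t i)) u)) ^+ 2 +
  sg * \int[mu]_u (\sum_(i <- r) c i * \1_(A (t i)) u) ^+ 2.
Proof.
have [m [sg [sg0 Ell]]] := scalar_levy_moments hl.
exists m, sg; split => // I r c t t0.
have sl := scalar_levy_sqr hl.
rewrite Rintegral_sum; last by move=> i; exact: iA.
rewrite !Rintegral_sqr_sum; last first.
- move=> i j; have := square_integrable_mul (square_integrableZ (c i) (sl _ (t0 i)))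
    (square_integrableZ (c j) (sl _ (t0 j))).
  exact.
- by move=> i j; exact: iAI.
rewrite (expr2 (\sum_(i <- r) _)) big_distrlr/= mulr_sumr mulr_sumr -big_split/=.
apply: eq_bigr => i _; rewrite mulr_sumr mulr_sumr -big_split/=.
apply: eq_bigr => j _.
have -> : \int[P]_w (c i * l (t i) w * (c j * l (t j) w)) =
    c i * c j * (m ^+ 2 * (t i * t j) + sg * Num.min (t i) (t j)).
  rewrite -Ell// -RintegralZl//; last by apply: square_integrable_mul; exact: sl.
  by apply: eq_Rintegral => w _; ring.
have E1 k : \int[mu]_u (c k * \1_(A (t k)) u) = c k * t k.
  rewrite RintegralZl//; last exact: iA1.
  by rewrite Rintegral_indic; [rewrite /= AA|exact: (mA (t k))].
have -> : \int[mu]_u (c i * \1_(A (t i)) u * (c j * \1_(A (t j)) u)) =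
    c i * c j * Num.min (t i) (t j).
  transitivity (\int[mu]_u (c i * c j * \1_(A (t i) `&` A (t j)) u)).
    by apply: eq_Rintegral => u _; rewrite indicI/= mulrACA.
  rewrite RintegralZl//; last exact: iAI1.
  rewrite Rintegral_indic; first by rewrite /= AI.
  by apply: measurableI; [exact: (mA (t i))|exact: (mA (t j))].
by rewrite !E1; ring.
Qed.

End one_sided_isometry.

Section two_sided_bound.
Context {R : realType} (disp : measure_display) (T : measurableType disp).
Variable P : probability T R.
Local Notation mu := (@lebesgue_measure R).

Definition pos_itv (t : R) : set R := `]0, t].
Definition neg_itv (t : R) : set R := `]- t, 0].
Definition pos_time (t : R) := Num.max t 0.
Definition neg_time (t : R) := Num.max (- t) 0.

(* The function of which integration against a two-sided process l with
   l 0 = 0 gives l t. *)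
Definition time_kernel (t u : R) : R :=
  \1_(pos_itv (pos_time t)) u - \1_(neg_itv (neg_time t)) u.

Lemma time_kernelE (t u : R) :
  time_kernel t u = (0 < u <= t)%R%:R - (t < u <= 0)%R%:R.
Proof.
rewrite /time_kernel /pos_itv /neg_itv /pos_time /neg_time.
rewrite !indicE !mem_setE !in_itv/= le_max ltrNl lt_max ltrN2 oppr_lt0.
by rewrite !(leNgt u); case: (t < u); case: (0 < u).
Qed.

(** Valid for all signs of s and t, so an interval of a step function that straddles 0 does not have
    to be cut. *)
Lemma time_kernelB (s t u : R) : s <= t ->
  \1_(`]s, t]%classic) u = time_kernel t u - time_kernel s u.
Proof.
move=> st; rewrite !time_kernelE indicE mem_setE in_itv/= !(leNgt u).
have : (t < u) ==> (s < u) by apply/implyP; exact: le_lt_trans.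
by case: (t < u); case: (s < u); case: (0 < u) => //= _;
  rewrite ?subr0 ?sub0r ?subrr ?opprK ?addr0 ?add0r.
Qed.

Lemma pos_itvI (s t : R) : 0 <= s -> 0 <= t ->
  mu (pos_itv s `&` pos_itv t) = (Num.min s t)%:E.
Proof.
move=> s0 t0; rewrite (_ : _ `&` _ = `]0, Num.min s t]%classic).
  rewrite lebesgue_measure_itv/= lte_fin; case: ltP => [_|].
    by rewrite -EFinB subr0.
  by move=> h; congr EFin; apply/eqP; rewrite eq_le h le_min s0 t0.
apply/seteqP; split => u; rewrite /pos_itv /= !in_itv/= le_min.
  by move=> [/andP[-> ->] /andP[_ ->]].
by move=> /and3P[-> -> ->].
Qed.

Lemma neg_itvI (s t : R) : 0 <= s -> 0 <= t ->
  mu (neg_itv s `&` neg_itv t) = (Num.min s t)%:E.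
Proof.
move=> s0 t0; rewrite (_ : _ `&` _ = `]- Num.min s t, 0]%classic).
  rewrite lebesgue_measure_itv/= lte_fin oppr_lt0; case: ltP => [_|].
    by rewrite -EFinB sub0r opprK.
  by move=> h; congr EFin; apply/eqP; rewrite eq_le h le_min s0 t0.
apply/seteqP; split => u; rewrite /neg_itv /= !in_itv/= (ltrNl s) (ltrNl t)
  (ltrNl (Num.min s t)) lt_min.
  by move=> [/andP[-> ->] /andP[-> _]].
by move=> /andP[/andP[-> ->] ->].
Qed.
End two_sided_bound.

Section two_sided_moment_bound.
Context {R : realType} (disp : measure_display) (T : measurableType disp).
Variable P : probability T R.
Variables l1 l2 l : R -> T -> R.
Hypothesis hl1 : scalar_levy P l1.
Hypothesis hl2 : scalar_levy P l2.
Hypothesis hl : forall t,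
  {ae P, forall w, l t w = l1 (pos_time t) w - l2 (neg_time t) w}.
Hypothesis ml : forall t, measurable_fun setT (l t).
Local Notation mu := (@lebesgue_measure R).

Let pos_time_ge0 (t : R) : 0 <= pos_time t.
Proof. by rewrite /pos_time le_max lexx orbT. Qed.

Let neg_time_ge0 (t : R) : 0 <= neg_time t.
Proof. by rewrite /neg_time le_max lexx orbT. Qed.

Let pos_kernel (t u : R) : \1_(pos_itv (pos_time t)) u = (0 < u)%R%:R * time_kernel t u.
Proof.
rewrite time_kernelE /pos_itv /pos_time indicE mem_setE in_itv/= le_max !(leNgt u).
by case: (t < u); case: (0 < u); rewrite /= ?subrr ?subr0 ?sub0r ?mul0r ?mul1r.
Qed.

Let neg_kernel (t u : R) : \1_(neg_itv (neg_time t)) u = - (u <= 0)%R%:R * time_kernel t u.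
Proof.
rewrite time_kernelE /neg_itv /neg_time indicE mem_setE in_itv/= ltrNl lt_max ltrN2
  oppr_lt0 !(leNgt u).
by case: (t < u); case: (0 < u); rewrite /= ?subrr ?subr0 ?sub0r ?mulNr ?mul0r ?mul1r ?mulr0 ?oppr0 ?opprK.
Qed.

Lemma integrable_time_kernel (t : R) : mu.-integrable setT (EFin \o time_kernel t).
Proof.
have := @integrable_indic_itv R 0 (pos_time t) false false.
have := @integrable_indic_itv R (- neg_time t) 0 false false.
move=> h1 h2; have := integrableB measurableT h2 h1.
by apply: eq_integrable.
Qed.

Lemma bounded_time_kernel (t u : R) : `|time_kernel t u| <= 1.
Proof.
rewrite time_kernelE; case: (_ < _ <= _); case: (_ < _ <= _) => /=;
  by rewrite ?subrr ?subr0 ?sub0r ?normrN ?normr0 ?normr1.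
Qed.

Lemma integrable_sum_time_kernel (I : Type) (r : seq I) (c t : I -> R) :
  mu.-integrable setT (EFin \o (fun u => \sum_(i <- r) c i * time_kernel (t i) u)).
Proof.
apply: integrable_EFin_sum => i; rewrite (_ : _ \o _ = fun u => (c i)%:E * (time_kernel (t i) u)%:E)%E.
  by apply: integrableZl => //; exact: integrable_time_kernel.
by apply/funext => u /=; rewrite EFinM.
Qed.

(** The sum h is integrable and bounded by the sum C of the |c_i|, hence h^2 <= C |h|. *)
Lemma integrable_sqr_sum_time_kernel (I : Type) (r : seq I) (c t : I -> R) :
  mu.-integrable setT (EFin \o (fun u => (\sum_(i <- r) c i * time_kernel (t i) u) ^+ 2)).
Proof.
set h := fun u => \sum_(i <- r) c i * time_kernel (t i) u.
have ih : mu.-integrable setT (EFin \o h).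
  exact: integrable_sum_time_kernel.
pose C := \sum_(i <- r) `|c i|.
have hC u : `|h u| <= C.
  rewrite (le_trans (ler_norm_sum _ _ _))//; apply: ler_sum => i _.
  by rewrite normrM ler_piMr// bounded_time_kernel.
have : mu.-integrable setT (fun u => (C%:E * (h u)%:E)%E).
  by apply: integrableZl.
apply: le_integrable => //.
  apply/measurable_EFinP; apply: measurable_funX.
  by apply/measurable_EFinP; case/integrableP: ih.
move=> u _ /=; rewrite lee_fin normrX normrM expr2 ler_wpM2r//.
by rewrite (le_trans (hC u)) ?ler_norm.
Qed.

(** The combination is X1 - X2, with X1 built on [l1] and X2 on [l2]. The isometry turns X1 into the
    restriction of h to ]0, +oo[ and X2 into minus its restriction to ]-oo, 0]; the halves are
    joined by (x - y)^2 <= 2 x^2 + 2 y^2, the source of the factor 2 in K. The bound speaks of h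
    alone, whatever list of times represents it. *)
Lemma two_sided_moment_bound : exists2 K : R, 0 <= K &
  forall (I : Type) (r : seq I) (c t : I -> R) (h : R -> R),
  (forall u, h u = \sum_(i <- r) c i * time_kernel (t i) u) ->
  (\int[P]_w ((\sum_(i <- r) c i * l (t i) w) ^+ 2)%:E <=
   K%:E * ((\int[mu]_u `|h u|%:E) * (\int[mu]_u `|h u|%:E) +
           \int[mu]_u (h u ^+ 2)%:E))%E.
Proof.
have [m1 [s1 [s10 E1]]] := scalar_levy_isometry hl1
  (fun t => measurable_itv `]0, t] : measurable (pos_itv t)) (@pos_itvI R).
have [m2 [s2 [s20 E2]]] := scalar_levy_isometry hl2
  (fun t => measurable_itv `]- t, 0] : measurable (neg_itv t)) (@neg_itvI R).
exists (2 * (m1 ^+ 2 + s1 + m2 ^+ 2 + s2)).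
  by rewrite mulr_ge0// !addr_ge0// sqr_ge0.
move=> I r c t h hE.
pose X1 w := \sum_(i <- r) c i * l1 (pos_time (t i)) w.
pose X2 w := \sum_(i <- r) c i * l2 (neg_time (t i)) w.
have sX1 : square_integrable P X1.
  by apply: square_integrable_sum => i; apply: square_integrableZ;
    exact: (scalar_levy_sqr hl1).
have sX2 : square_integrable P X2.
  by apply: square_integrable_sum => i; apply: square_integrableZ;
    exact: (scalar_levy_sqr hl2).
(* The null set of [hl] depends on the time; only finitely many times occur here. *)
have aeX : {ae P, forall w, \sum_(i <- r) c i * l (t i) w = X1 w - X2 w}.
  rewrite /X1 /X2; elim: r {h hE X1 X2 sX1 sX2} => [|i r ih].
    by apply: aeW => w; rewrite !big_nil subr0.
  apply: filterS2 ih (hl (t i)) => w ih lw.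
  by rewrite !big_cons ih lw; ring.
have ih : mu.-integrable setT (EFin \o h).
  by rewrite (funext hE); exact: integrable_sum_time_kernel.
have ih2 : mu.-integrable setT (EFin \o (fun u => h u ^+ 2)).
  by rewrite (funext hE); exact: integrable_sqr_sum_time_kernel.
have mh : measurable_fun setT h by apply/measurable_EFinP; case/integrableP: ih.
have ihn : mu.-integrable setT (EFin \o (fun u => `|h u|)) by exact: integrable_norm.
have -> : (\int[mu]_u `|h u|%:E)%E = (\int[mu]_u `|h u|)%:E.
  by rewrite /Rintegral fineK//; exact: integrable_fin_num.
have -> : (\int[mu]_u (h u ^+ 2)%:E)%E = (\int[mu]_u (h u ^+ 2))%:E.
  by rewrite /Rintegral fineK//; exact: integrable_fin_num.
pose h1 u := \sum_(i <- r) c i * \1_(pos_itv (pos_time (t i))) u.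
pose h2 u := \sum_(i <- r) c i * \1_(neg_itv (neg_time (t i))) u.
have h1E u : h1 u = (0 < u)%R%:R * h u.
  by rewrite hE /h1 mulr_sumr; apply: eq_bigr => i _; rewrite pos_kernel mulrCA.
have h2E u : h2 u = - (u <= 0)%R%:R * h u.
  by rewrite hE /h2 mulr_sumr; apply: eq_bigr => i _; rewrite neg_kernel mulrCA.
(* To be applied to the two halves of h, which |h| dominates. *)
have key (g : R -> R) : measurable_fun setT g -> (forall u, `|g u| <= `|h u|) ->
    (\int[mu]_u g u) ^+ 2 <= (\int[mu]_u `|h u|) ^+ 2 /\
    \int[mu]_u (g u ^+ 2) <= \int[mu]_u (h u ^+ 2).
  move=> mg gh.
  have ig : mu.-integrable setT (EFin \o g).
    by apply: le_integrable ih => //; [exact/measurable_EFinP|move=> u _; rewrite lee_fin].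
  have gh2 u : g u ^+ 2 <= h u ^+ 2.
    by rewrite -(real_normK (num_real (g u))) -(real_normK (num_real (h u))) lerXn2r.
  have ig2 : mu.-integrable setT (EFin \o (fun u => g u ^+ 2)).
    apply: le_integrable ih2 => //.
      by apply/measurable_EFinP; exact: measurable_funX.
    by move=> u _; rewrite lee_fin !ger0_norm ?sqr_ge0.
  split; last by apply: le_Rintegral => // u _; exact: gh2.
  rewrite -(real_normK (num_real (\int[mu]_u g u))) lerXn2r ?nnegrE//.
    by apply: Rintegral_ge0.
  rewrite (le_trans (le_normr_Rintegral _ _))//; apply: le_Rintegral => //.
    exact: integrable_norm.
have [] := key h1.
- by apply: measurable_sum => i; apply: measurable_funM => //;
    apply: measurable_indic; exact: measurable_itv.
- by move=> u; rewrite h1E normrM ler_piMl//; case: (0 < u); rewrite ?normr0 ?normr1.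
move=> h1a h1b.
have [] := key h2.
- by apply: measurable_sum => i; apply: measurable_funM => //;
    apply: measurable_indic; exact: measurable_itv.
- by move=> u; rewrite h2E normrM normrN ler_piMl//; case: (u <= 0); rewrite ?normr0 ?normr1.
move=> h2a h2b.
have i1 := square_integrable_sqr sX1.
have i2 := square_integrable_sqr sX2.
have i12 : P.-integrable setT (EFin \o (fun w => 2 * X1 w ^+ 2 + 2 * X2 w ^+ 2)).
  have := integrableD measurableT (integrableZl measurableT 2 i1) (integrableZl measurableT 2 i2).
  by apply: eq_integrable.
apply: (@le_trans _ _ (\int[P]_w (2 * X1 w ^+ 2 + 2 * X2 w ^+ 2)%:E)%E).
  apply: ae_ge0_le_integral => //.
  - by move=> w _; rewrite lee_fin sqr_ge0.
  - apply/measurable_EFinP; apply: measurable_funX; apply: measurable_sum => i.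
    exact: measurable_funM.
  - by move=> w _; rewrite lee_fin addr_ge0// mulr_ge0// sqr_ge0.
  - by case/integrableP: i12.
  - apply: filterS aeX => w -> _; rewrite lee_fin.
    by rewrite -subr_ge0 (_ : _ - _ = (X1 w + X2 w) ^+ 2) ?sqr_ge0//; ring.
rewrite [leLHS](_ : _ = (\int[P]_w (2 * X1 w ^+ 2 + 2 * X2 w ^+ 2))%:E); last first.
  by rewrite /Rintegral fineK//; exact: integrable_fin_num.
rewrite [leRHS](_ : _ = (2 * (m1 ^+ 2 + s1 + m2 ^+ 2 + s2) *
  ((\int[mu]_u `|h u|) * (\int[mu]_u `|h u|) + \int[mu]_u (h u ^+ 2)))%:E)//.
rewrite lee_fin RintegralD//; last 2 first.
- by have := integrableZl measurableT 2 i1; apply: eq_integrable.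
- by have := integrableZl measurableT 2 i2; apply: eq_integrable.
rewrite !RintegralZl// E1// E2// -/h1 -/h2 -expr2.
have Ih : 0 <= \int[mu]_u (h u ^+ 2) by apply: Rintegral_ge0 => u _; rewrite sqr_ge0.
have Ih' : 0 <= (\int[mu]_u `|h u|) ^+ 2 by rewrite sqr_ge0.
rewrite -mulrDr -mulrA ler_pM2l//.
set A := (\int[mu]_u `|h u|) ^+ 2 in h1a h2a Ih' *.
set B := \int[mu]_u h u ^+ 2 in h1b h2b Ih *.
have p1 := ler_wpM2l (sqr_ge0 m1) h1a.
have p2 := ler_wpM2l (sqr_ge0 m2) h2a.
have p3 := ler_wpM2l s10 h1b.
have p4 := ler_wpM2l s20 h2b.
rewrite (le_trans (lerD (lerD p1 p3) (lerD p2 p4)))//.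
have : 0 <= m1 ^+ 2 * B by rewrite mulr_ge0// sqr_ge0.
have : 0 <= m2 ^+ 2 * B by rewrite mulr_ge0// sqr_ge0.
have : 0 <= s1 * A by rewrite mulr_ge0.
have : 0 <= s2 * A by rewrite mulr_ge0.
lra.
Qed.

End two_sided_moment_bound.

(** * Coordinates of a vector-valued Lévy process and their left limits *)

Section matrix_norm.
Context {R : realType}.

Lemma ler_entry_norm (m n : nat) (M : 'M[R]_(m, n)) i j : `|M i j| <= `|M|.
Proof.
by rewrite [leRHS]/Num.norm /= mx_normrE; apply/bigmax_geP; right => /=; exists (i, j).
Qed.

Lemma ler_norm_sum_entries (m n : nat) (M : 'M[R]_(m, n)) :
  `|M| <= \sum_i \sum_j `|M i j|.
Proof.
rewrite [leLHS]/Num.norm /= mx_normrE; apply: bigmax_le.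
  by apply: sumr_ge0 => i _; apply: sumr_ge0.
move=> [i j] _ /=; rewrite (bigD1 i)//= (bigD1 j)//= -addrA lerDl addr_ge0//.
  by apply: sumr_ge0.
by apply: sumr_ge0 => k _; apply: sumr_ge0.
Qed.

Lemma measurable_mx_norm (disp : measure_display) (T : measurableType disp)
    (m n : nat) (D : set T) (f : T -> 'M[R]_(m, n)) :
  mx_measurable_fun D f -> measurable_fun D (fun x => `|f x|).
Proof.
move=> mf; rewrite (_ : (fun x => _) =
    fun x => \big[Num.max/0]_(ij : 'I_m * 'I_n) `|f x ij.1 ij.2|); last first.
  by apply/funext => x; rewrite [LHS]/Num.norm /= mx_normrE.
elim: (index_enum _) => [|ij s ih].
  under eq_fun do rewrite big_nil.
  exact: measurable_cst.
under eq_fun do rewrite big_cons.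
by apply: measurable_maxr => //; apply: measurableT_comp => //; exact: mf.
Qed.

Lemma mx_measurable_funB (disp : measure_display) (T : measurableType disp)
    (m n : nat) (D : set T) (f g : T -> 'M[R]_(m, n)) :
  mx_measurable_fun D f -> mx_measurable_fun D g ->
  mx_measurable_fun D (fun x => f x - g x).
Proof.
move=> mf mg i j; under eq_fun do rewrite !mxE.
by apply: measurable_funB; [exact: mf|exact: mg].
Qed.

(** Independence and stationarity are stated for Borel sets of vectors; pulling real sets back along
    a coordinate, which is continuous, hands them down to the coordinates. *)
Lemma mx_borel_coord (m n : nat) (i : 'I_m) (j : 'I_n) (A : set R) :
  measurable A -> mx_borel [set M : 'M[R]_(m, n) | A (M i j)].
Proof.
pose f (M : g_sigma_algebraType (@open 'M[R]_(m, n))) : R := M i j.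
suff mf : measurable_fun setT f by move=> mA; have := mf measurableT A mA; rewrite setTI.
apply: (measurability (@RGenOpens.G R)); first exact: RGenOpens.measurableE.
move=> _ [_ [x [y ->]] <-]; rewrite setTI; apply: sub_sigma_algebra.
have : open (`]x, y[%classic : set R) by exact: interval_open.
by move/open_comp; apply => M _; exact: coord_continuous.
Qed.

End matrix_norm.

Section cvg_in_probability.
Context {R : realType} (disp : measure_display) (T : measurableType disp).
Variable P : probability T R.

(** If |Y - Z| > 1 / (k + 1) at w, then |X_n - Z| exceeds the same number at w for all n from some N
    on. For fixed k and N this event has probability at most that of |X_n - Z| > 1 / (k + 1) for
    each n >= N, hence 0; there are countably many pairs (k, N). *)
Lemma ae_eq_cvg_probability (X : nat -> T -> R) (Y Z : T -> R) :
  (forall n, measurable_fun setT (X n)) -> measurable_fun setT Z ->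
  (forall w, X n w @[n --> \oo] --> Y w) ->
  (forall e, 0 < e -> P [set w | (e < `|X n w - Z w|)%R] @[n --> \oo] --> 0%E) ->
  {ae P, forall w, Y w = Z w}.
Proof.
move=> mX mZ XY XZ.
pose A (e : R) n := [set w | (e < `|X n w - Z w|)%R].
have mA e n : measurable (A e n).
  rewrite (_ : A e n = (fun w => `|X n w - Z w|) @^-1` `]e, +oo[); last first.
    by apply/seteqP; split => w /=; rewrite in_itv/= andbT.
  rewrite -[X in measurable X]setTI.
  by apply: (measurableT_comp _ (measurable_funB (mX n) mZ)).
have negI (e : R) N : 0 < e -> P.-negligible (\bigcap_(n in [set n | (N <= n)%N]) A e n).
  move=> e0; exists (\bigcap_(n in [set n | (N <= n)%N]) A e n); split => //.
    exact: bigcap_measurableType.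
  apply/eqP; rewrite eq_le measure_ge0 andbT.
  apply: (cvge_to_ge (XZ e e0)); near=> n.
  apply: le_measure; rewrite ?inE; [exact: bigcap_measurableType|exact: mA|].
  by move=> w; apply; rewrite /=; near: n; exact: nbhs_infty_ge.
have : P.-negligible (\bigcup_k \bigcup_N
    \bigcap_(n in [set n | (N <= n)%N]) A k.+1%:R^-1 n).
  apply: negligible_bigcup => k; apply: negligible_bigcup => N.
  by apply: negI.
apply: negligibleS => w /= YZ.
have d0 : 0 < `|Y w - Z w| by rewrite normr_gt0 subr_eq0; exact/eqP.
have [k _ hk] : exists2 k : nat, True & k.+1%:R^-1 < `|Y w - Z w|.
  exists (Num.trunc `|Y w - Z w|^-1) => //.
  rewrite invf_plt ?posrE//; exact: truncnS_gt.
exists k => //.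
have : \forall n \near \oo, k.+1%:R^-1 < `|X n w - Z w|.
  have : `|X n w - Z w| @[n --> \oo] --> `|Y w - Z w|.
    by apply: cvg_norm; apply: cvgB; [exact: XY|exact: cvg_cst].
  by move/cvgr_gt; exact.
by move=> [N _ hN]; exists N => // n /= Nn; exact: hN.
Unshelve. all: by end_near.
Qed.

End cvg_in_probability.

Section levy_coordinates.
Context {R : realType} (disp : measure_display) (T : measurableType disp).
Variables (P : probability T R) (m : nat) (L : R -> T -> 'cV[R]_m).
Hypothesis hL : levy_process P L.

Let coord_increment (j : 'I_m) (s t : R) (A : set R) :
  [set w | [set M : 'cV[R]_m | A (M j ord0)] (L t w - L s w)] =
  (fun w => L t w j ord0 - L s w j ord0) @^-1` A.
Proof. by apply/seteqP; split => w /=; rewrite !mxE. Qed.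

Lemma levy_increment_tail_measurable (s t e : R) : 0 <= s -> 0 <= t ->
  measurable [set w | e < `|L s w - L t w|].
Proof.
move=> s0 t0.
rewrite (_ : [set w | _] = (fun w => `|L s w - L t w|) @^-1` `]e, +oo[); last first.
  by apply/seteqP; split => w /=; rewrite in_itv/= andbT.
rewrite -[X in measurable X]setTI.
apply: (measurable_mx_norm (mx_measurable_funB _ _)) => //.
  exact: (levy_measurable hL).
exact: (levy_measurable hL).
Qed.

Lemma levy_coord_increment_tail (j : 'I_m) (s t e : R) : 0 <= s -> 0 <= t ->
  (P [set w | (e < `|L s w j ord0 - L t w j ord0|)%R] <=
   P [set w | (e < `|L s w - L t w|)%R])%E.
Proof.
move=> s0 t0; apply: le_measure; rewrite ?inE.
- rewrite (_ : [set w | _] = (fun w => `|L s w j ord0 - L t w j ord0|) @^-1` `]e, +oo[); last first.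
    by apply/seteqP; split => w /=; rewrite in_itv/= andbT.
  rewrite -[X in measurable X]setTI.
  apply: (measurableT_comp _ (measurable_funB _ _)) => //;
    exact: (levy_measurable hL).
- exact: levy_increment_tail_measurable.
- move=> w /= /lt_le_trans; apply.
  by have := ler_entry_norm (L s w - L t w) j ord0; rewrite !mxE.
Qed.

Lemma levy_coord_scalar_levy (j : 'I_m) :
  (forall t, 0 <= t -> square_integrable P (fun w => L t w j ord0)) ->
  scalar_levy P (fun t w => L t w j ord0).
Proof.
move=> sL; split => //.
- by have := levy_start hL; apply: filterS => w ->; rewrite mxE.
- move=> s t s0 st A B mA mB.
  (* The times 0, s, t, t, ...: two increments are used, and the sequence has to be nondecreasing at
     every index. *)
  pose tt (i : nat) : R := if i is i'.+1 then if i' is _.+1 then t else s else 0.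
  pose BB (i : nat) : set 'cV[R]_m :=
    if i is 0%N then [set M | A (M j ord0)] else [set M | B (M j ord0)].
  have := @levy_independent_increments _ _ _ _ _ _ hL 2 tt BB (lexx 0).
  rewrite bigcap_mkord !big_ord_recl !big_ord0 setIT mule1 /= !coord_increment.
  apply.
  + by move=> [|[|i]].
  + by move=> [|i]; exact: mx_borel_coord.
- move=> s h s0 h0 A mA.
  have := levy_stationary_increments hL s0 h0 (mx_borel_coord j ord0 mA).
  by rewrite !coord_increment.
- have := levy_stochastically_continuous hL (lexx 0) ltr01.
  move=> /fine_cvgP[+ /cvgr_lt/(_ 2^-1)].
  rewrite invr_gt0 ltr0n => + /(_ isT) => h1 h2.
  have h3 : \forall s \near within [set s : R | 0 <= s] (nbhs 0),
      (P [set w | (1 < `|L s w - L 0 w|)%R] <= (2^-1)%:E)%E.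
    by apply: filterS2 h1 h2 => s f l; rewrite -(fineK f) lee_fin ltW.
  have /nbhs_ballP[e /= e0 he] : nbhs 0 [set s : R | 0 <= s ->
      (P [set w | (1 < `|L s w - L 0 w|)%R] <= (2^-1)%:E)%E] by exact: h3.
  (* The closed range t <= e / 2 fits into the open ball of radius e. *)
  exists (e / 2); first by rewrite divr_gt0.
  move=> t /andP[t0 te].
  rewrite (le_trans (levy_coord_increment_tail _ _ _ _))//; apply: he => //.
  by rewrite /ball/= sub0r normrN ger0_norm// (le_lt_trans te)// ltr_pdivrMr// ltr_pMr// ltr1n.
Qed.

Section left_limits.
Variables (t : R).
Hypothesis t_gt0 : 0 < t.

Let u (n : nat) := t - t / n.+2%:R.

Let u_lt n : u n < t.
Proof. by rewrite /u ltrBlDr ltrDl divr_gt0. Qed.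

Let u_ge0 n : 0 <= u n.
Proof. by rewrite /u subr_ge0 ler_pdivrMr// ler_peMr ?ler1n// ltW. Qed.

Let u_cvg : u n @[n --> \oo] --> t.
Proof.
rewrite -[X in _ --> X]subr0; apply: cvgB; first exact: cvg_cst.
rewrite -(mulr0 t); apply: cvgM; first exact: cvg_cst.
have := @cvg_harmonic R.
by rewrite -(cvg_shiftS (@harmonic R)).
Qed.

Let u_cvg_left : u n @[n --> \oo] --> t^'-.
Proof.
move=> A hA; have : \forall n \near \oo, u n < t -> A (u n).
  exact: (u_cvg hA).
by apply: filterS => n; apply.
Qed.

Definition left_limit (w : T) : 'cV[R]_m := lim (L s w @[s --> t^'-]).

Let cvg_left_coord (j : 'I_m) w :
  L (u n) w j ord0 @[n --> \oo] --> left_limit w j ord0.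
Proof.
have [_ /(_ t t_gt0) cvgl] := levy_cadlag hL w.
have h : L (u n) w @[n --> \oo] --> left_limit w.
  by apply: cvg_comp cvgl; exact: u_cvg_left.
exact: (cvg_comp _ (fun M : 'cV[R]_m => M j ord0) h (@coord_continuous _ _ _ j ord0 _)).
Qed.

Lemma measurable_left_limit (j : 'I_m) :
  measurable_fun setT (fun w => left_limit w j ord0).
Proof.
apply: (@measurable_fun_cvg _ _ _ _ (fun n w => L (u n) w j ord0)).
  by move=> n; exact: (levy_measurable hL).
by move=> w _; exact: cvg_left_coord.
Qed.

(** There is no jump at a fixed time: along points [u n] below t that tend to t, the path converges
    to its left limit because it is càdlàg, and to its value at t in probability by stochastic
    continuity. *)
Lemma ae_left_limit (j : 'I_m) :
  {ae P, forall w, left_limit w j ord0 = L t w j ord0}.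
Proof.
apply: (@ae_eq_cvg_probability _ _ _ _ (fun n w => L (u n) w j ord0)).
- by move=> n; exact: (levy_measurable hL).
- by apply: (levy_measurable hL); rewrite ltW.
- by move=> w; exact: cvg_left_coord.
move=> e e0.
have h : P [set w | (e < `|L (u n) w - L t w|)%R] @[n --> \oo] --> 0%E.
  have := levy_stochastically_continuous hL (ltW t_gt0) e0.
  apply: cvg_comp => A hA.
  have : \forall n \near \oo, 0 <= u n -> A (u n) by exact: (u_cvg hA).
  by apply: filterS => n; apply.
apply: (squeeze_cvge _ (cvg_cst 0%E) h); near=> n.
by rewrite measure_ge0/= levy_coord_increment_tail// ltW.
Unshelve. all: by end_near.
Qed.

End left_limits.
End levy_coordinates.

(** * The second moment bound for integrals of step functions *)

Section sums_of_squares.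
Context {R : realType}.

(** The constant comes from iterating (x + y)^2 <= 2 x^2 + 2 y^2; only its independence of x
    matters. *)
Lemma sqr_sum_le (I : Type) (s : seq I) (x : I -> R) :
  (\sum_(i <- s) x i) ^+ 2 <= 2 ^+ size s * \sum_(i <- s) x i ^+ 2.
Proof.
elim: s => [|i s ih]; first by rewrite !big_nil expr0n mulr0.
rewrite !big_cons/= (exprS 2).
have h : (x i + \sum_(j <- s) x j) ^+ 2 <= 2 * x i ^+ 2 + 2 * (\sum_(j <- s) x j) ^+ 2.
  by rewrite -subr_ge0 (_ : _ - _ = (x i - \sum_(j <- s) x j) ^+ 2) ?sqr_ge0//; ring.
rewrite (le_trans h)// -mulrA -mulrDr ler_pM2l// mulrDr lerD//.
by rewrite ler_peMl ?sqr_ge0// exprn_ege1// ler1n.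
Qed.

Lemma sqr_mx_norm_le (m n : nat) (M : 'M[R]_(m, n)) :
  `|M| ^+ 2 <= \sum_i \sum_j M i j ^+ 2.
Proof.
have s0 i : 0 <= \sum_j M i j ^+ 2 by apply: sumr_ge0 => j _; exact: sqr_ge0.
have [M0|/mx_norm_neq0[[i j] /= Mij]] := eqVneq (mx_norm M) 0.
  rewrite [X in X ^+ 2](_ : _ = mx_norm M)// M0 expr0n/=.
  by apply: sumr_ge0 => i _; exact: s0.
rewrite [X in X ^+ 2](_ : _ = mx_norm M)// Mij real_normK ?num_real//.
rewrite (bigD1 i)//= (bigD1 j)//= -addrA lerDl addr_ge0//.
  by apply: sumr_ge0 => k _; exact: sqr_ge0.
by apply: sumr_ge0 => k _; exact: s0.
Qed.

End sums_of_squares.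

Section two_sided_levy.
Context {R : realType} (disp : measure_display) (T : measurableType disp).
Variables (P : probability T R) (m : nat) (L : R -> T -> 'cV[R]_m).
Hypothesis hL : two_sided_levy_process P L.

Lemma two_sided_levy_measurable (t : R) : mx_measurable_fun setT (L t).
Proof.
have [L1 [L2 [hL1 hL2 _ _ ->]]] := hL; rewrite /two_sided => j k.
have [t0|t0] := leP 0 t; first exact: (levy_measurable hL1).
rewrite (_ : (fun w => _) = fun w => - left_limit L2 (- t) w j ord0); last first.
  by apply/funext => w; rewrite ord1 mxE.
by apply: measurableT_comp => //; apply: (measurable_left_limit hL2); rewrite oppr_gt0.
Qed.

Hypothesis L2 : finite_second_moments P L.

Let sqL (t : R) (j : 'I_m) : square_integrable P (fun w => L t w j ord0).
Proof.
split; first exact: two_sided_levy_measurable.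
apply: le_lt_trans (L2 t); apply: ge0_le_integral => //.
- by move=> w _; rewrite lee_fin sqr_ge0.
- by apply/measurable_EFinP; apply: measurable_funX; exact: two_sided_levy_measurable.
- apply/measurable_EFinP; apply: measurable_funX; apply: measurable_mx_norm.
  exact: two_sided_levy_measurable.
- move=> w _; rewrite lee_fin -(real_normK (num_real (L t w j ord0))).
  by rewrite lerXn2r// ?nnegrE//; exact: ler_entry_norm.
Qed.

Let square_integrable_ae (X Y : T -> R) : square_integrable P X ->
  measurable_fun setT Y -> {ae P, forall w, X w = Y w} -> square_integrable P Y.
Proof.
move=> [mX X2] mY XY; split => //.
rewrite (_ : integral _ _ _ = \int[P]_w (X w ^+ 2)%:E)%E//.
apply: ge0_ae_eq_integral => //.
- by apply/measurable_EFinP; exact: measurable_funX.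
- by apply/measurable_EFinP; exact: measurable_funX.
- by move=> w _; rewrite lee_fin sqr_ge0.
- by move=> w _; rewrite lee_fin sqr_ge0.
- by apply: filterS XY => w -> _.
Qed.

(** Finite second moments are assumed for L, and have to be carried to the two one-sided processes.
    The first is L at nonnegative times. The second is, at each time t > 0, almost surely its own
    left limit, which is -L(-t); at time 0 it vanishes almost surely. *)
Lemma two_sided_coord_bound (j : 'I_m) : exists2 K : R, 0 <= K &
  forall (I : Type) (r : seq I) (c t : I -> R) (h : R -> R),
  (forall u, h u = \sum_(i <- r) c i * time_kernel (t i) u) ->
  (\int[P]_w ((\sum_(i <- r) c i * L (t i) w j ord0) ^+ 2)%:E <=
   K%:E * ((\int[lebesgue_measure]_u `|h u|%:E) * (\int[lebesgue_measure]_u `|h u|%:E) +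
           \int[lebesgue_measure]_u (h u ^+ 2)%:E))%E.
Proof.
have [L1 [L2' [hL1 hL2 _ _ LE]]] := hL.
have posE (t : R) : 0 <= t -> L t = L1 t.
  by move=> t0; rewrite LE /two_sided t0.
have negE (t : R) (w : T) (j0 : 'I_m) : t < 0 ->
    L t w j0 ord0 = - left_limit L2' (- t) w j0 ord0.
  by move=> t0; rewrite LE /two_sided leNgt t0/= mxE.
have start1 : {ae P, forall w, L1 0 w j ord0 = 0}.
  by have := levy_start hL1; apply: filterS => w ->; rewrite mxE.
have start2 : {ae P, forall w, L2' 0 w j ord0 = 0}.
  by have := levy_start hL2; apply: filterS => w ->; rewrite mxE.
have sl1 : scalar_levy P (fun t w => L1 t w j ord0).
  by apply: levy_coord_scalar_levy => // t t0; rewrite -posE//; exact: sqL.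
have sl2 : scalar_levy P (fun t w => L2' t w j ord0).
  apply: levy_coord_scalar_levy => // t; rewrite le_eqVlt => /predU1P[<-|t0].
    apply: (square_integrable_ae (square_integrable_cst P 0)).
      exact: (levy_measurable hL2).
    by apply: filterS start2 => w ->.
  apply: (square_integrable_ae (square_integrableN (sqL (- t) j))).
    by apply: (levy_measurable hL2); exact: ltW.
  have := ae_left_limit hL2 t0 j; apply: filterS => w <-.
  by rewrite negE ?oppr_lt0// !opprK.
apply: (@two_sided_moment_bound _ _ _ _ _ _ (fun t w => L t w j ord0) sl1 sl2) => [t|t].
  have [t0|t0] := leP 0 t.
    apply: filterS start2 => w z; rewrite posE// /pos_time /neg_time max_l//.
    by rewrite max_r ?oppr_le0// z subr0.
  have t0' : 0 < - t by rewrite oppr_gt0.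
  apply: filterS2 start1 (ae_left_limit hL2 t0' j) => w z lw.
  rewrite negE// lw /pos_time /neg_time max_r ?ltW//.
  by rewrite max_l ?ltW// z sub0r.
exact: two_sided_levy_measurable.
Qed.

Variable d : nat.
Implicit Types g h : @step R d m.

(** An entry of a step function as a list of pairs (coefficient, time), each interval contributing
    both endpoints. Evaluated on [time_kernel] the list gives the entry, evaluated on a coordinate
    of L it gives the matching part of the integral. *)
Let terms g (i : 'I_d) (j : 'I_m) : seq (R * R) :=
  [seq (step_coef g k i j, step_pt g k.+1) | k <- index_iota 0 (step_size g)] ++
  [seq (- step_coef g k i j, step_pt g k) | k <- index_iota 0 (step_size g)].

Let sum_terms g i j (f : R -> R) : \sum_(p <- terms g i j) p.1 * f p.2 =
  \sum_(k < step_size g) step_coef g k i j * (f (step_pt g k.+1) - f (step_pt g k)).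
Proof.
rewrite big_cat !big_map/= -big_split/= big_mkord.
by apply: eq_bigr => k _; rewrite mulrBr mulNr.
Qed.

Let step_funE g u i j :
  step_fun g u i j = \sum_(p <- terms g i j) p.1 * time_kernel p.2 u.
Proof.
rewrite (sum_terms g i j (time_kernel^~ u)) /step_fun summxE.
by apply: eq_bigr => k _; rewrite mxE mulrC time_kernelB//; exact: step_ptP.
Qed.

Let step_integralE g w i : step_integral L g w i ord0 =
  \sum_j \sum_(p <- terms g i j) p.1 * L p.2 w j ord0.
Proof.
rewrite /step_integral summxE.
under [RHS]eq_bigr => j _ do rewrite (sum_terms g i j (fun t => L t w j ord0)).
rewrite exchange_big/=; apply: eq_bigr => k _.
by rewrite mxE; apply: eq_bigr => j _; rewrite !mxE.
Qed.

Lemma measurable_step_fun g : mx_measurable_fun setT (step_fun g).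
Proof.
move=> i j; rewrite /step_fun; under eq_fun do rewrite summxE.
apply: measurable_sum => k; under eq_fun do rewrite mxE.
apply: measurable_funM => //; apply: measurable_indic; exact: measurable_itv.
Qed.

Lemma measurable_step_integral g : mx_measurable_fun setT (step_integral L g).
Proof.
move=> i j; rewrite ord1; under eq_fun do rewrite step_integralE.
apply: measurable_sum => k; apply: measurable_sum => p.
by apply: measurable_funM => //; exact: two_sided_levy_measurable.
Qed.

(** Stated for a difference, this is the Lipschitz property through which the integral extends to
    limits of step functions. It reduces to [two_sided_coord_bound] for each pair of entries, a row
    of the integral being a sum over the coordinates of L. *)
Lemma step_integral_bound : exists2 K : R, 0 <= K & forall g h,
  (\int[P]_w (`|step_integral L g w - step_integral L h w| ^+ 2)%:E <=
   K%:E * ((\int[lebesgue_measure]_u `|step_fun g u - step_fun h u|%:E) *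
           (\int[lebesgue_measure]_u `|step_fun g u - step_fun h u|%:E) +
           \int[lebesgue_measure]_u (`|step_fun g u - step_fun h u| ^+ 2)%:E))%E.
Proof.
have : forall j, exists K : R, 0 <= K /\
    forall (I : Type) (r : seq I) (c t : I -> R) (h : R -> R),
  (forall u, h u = \sum_(i <- r) c i * time_kernel (t i) u) ->
  (\int[P]_w ((\sum_(i <- r) c i * L (t i) w j ord0) ^+ 2)%:E <=
   K%:E * ((\int[lebesgue_measure]_u `|h u|%:E) * (\int[lebesgue_measure]_u `|h u|%:E) +
           \int[lebesgue_measure]_u (h u ^+ 2)%:E))%E.
  by move=> j; have [K K0 hK] := two_sided_coord_bound j; exists K.
move=> /choice[K hK].
pose C := 2 ^+ size (index_enum 'I_m) : R.
have C0 : 0 <= C by rewrite exprn_ge0.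
exists (\sum_(i < d) \sum_j C * K j).
  by apply: sumr_ge0 => i _; apply: sumr_ge0 => j _; rewrite mulr_ge0//; exact: (hK j).1.
move=> g h.
(* The partitions of g and h differ; concatenating the lists, the second one negated, represents g -
   h without a common refinement. *)
pose S i j w := \sum_(p <- terms g i j ++ [seq (- p.1, p.2) | p <- terms h i j])
  p.1 * L p.2 w j ord0.
have mS i j : measurable_fun setT (S i j).
  by apply: measurable_sum => p; apply: measurable_funM => //; exact: two_sided_levy_measurable.
have SE w i : (step_integral L g w - step_integral L h w) i ord0 = \sum_j S i j w.
  rewrite !mxE !step_integralE -sumrB; apply: eq_bigr => j _.
  rewrite /S [RHS]big_cat [X in _ = _ + X]big_map/= -sumrN; congr (_ + _).
  by apply: eq_bigr => p _; rewrite mulNr.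
set N1 := (\int[_]_u `|_|%:E)%E.
set N2 := (\int[lebesgue_measure]_u (`|step_fun g u - step_fun h u| ^+ 2)%:E)%E.
have N10 : (0 <= N1)%E by apply: integral_ge0 => u _; rewrite lee_fin.
have N20 : (0 <= N2)%E by apply: integral_ge0 => u _; rewrite lee_fin sqr_ge0.
have mgh := mx_measurable_funB (measurable_step_fun g) (measurable_step_fun h).
apply: (@le_trans _ _ (\int[P]_w (\sum_(i < d) \sum_j (C * (S i j w) ^+ 2)%:E))%E).
  apply: ge0_le_integral => //.
  - apply/measurable_EFinP; apply: measurable_funX; apply: measurable_mx_norm.
    by apply: mx_measurable_funB; exact: measurable_step_integral.
  - apply: emeasurable_sum => i; apply: emeasurable_sum => j.
    by apply/measurable_EFinP; apply: measurable_funM => //; exact: measurable_funX.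
  - move=> w _; under eq_bigr do rewrite sumEFin.
    rewrite sumEFin lee_fin (le_trans (sqr_mx_norm_le _))//.
    apply: ler_sum => i _; rewrite big_ord1 SE.
    by rewrite (le_trans (sqr_sum_le _ _))// mulr_sumr.
rewrite ge0_integral_sum//; last 2 first.
- move=> i; apply: emeasurable_sum => j.
  by apply/measurable_EFinP; apply: measurable_funM => //; exact: measurable_funX.
- by move=> i w _; apply: sume_ge0 => j _; rewrite lee_fin mulr_ge0// sqr_ge0.
have X0 : (0 <= N1 * N1 + N2)%E by rewrite adde_ge0// mule_ge0.
rewrite -sumEFin ge0_sume_distrl; last first.
  by move=> i _; rewrite lee_fin; apply: sumr_ge0 => j _; rewrite mulr_ge0//; exact: (hK j).1.
apply: lee_sum => i _.
rewrite ge0_integral_sum//; last 2 first.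
- by move=> j; apply/measurable_EFinP; apply: measurable_funM => //; exact: measurable_funX.
- by move=> j w _; rewrite lee_fin mulr_ge0// sqr_ge0.
rewrite -sumEFin ge0_sume_distrl; last first.
  by move=> j _; rewrite lee_fin mulr_ge0//; exact: (hK j).1.
apply: lee_sum => j _.
under eq_integral do rewrite EFinM.
rewrite ge0_integralZl_EFin//; last 2 first.
- by move=> w _; rewrite lee_fin sqr_ge0.
- by apply/measurable_EFinP; exact: measurable_funX.
rewrite EFinM -muleA; apply: lee_wpmul2l; first by rewrite lee_fin.
pose f u := step_fun g u i j - step_fun h u i j.
have fE u : f u = \sum_(p <- terms g i j ++ [seq (- p.1, p.2) | p <- terms h i j])
    p.1 * time_kernel p.2 u.
  rewrite /f !step_funE [RHS]big_cat [X in _ = _ + X]big_map/= -sumrN; congr (_ + _).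
  by apply: eq_bigr => p _; rewrite mulNr.
apply: (le_trans ((hK j).2 _ _ _ _ f fE)).
apply: lee_wpmul2l; first by rewrite lee_fin; exact: (hK j).1.
have fle u : `|f u| <= `|step_fun g u - step_fun h u|.
  by have := ler_entry_norm (step_fun g u - step_fun h u) i j; rewrite !mxE.
have mf : measurable_fun setT f by have := mgh i j; under eq_fun do rewrite !mxE.
have f1 : (\int[lebesgue_measure]_u `|f u|%:E <= N1)%E.
  apply: ge0_le_integral => //.
  - by apply/measurable_EFinP; exact: measurableT_comp.
  - by apply/measurable_EFinP; exact: measurable_mx_norm.
  - by move=> u _; rewrite lee_fin.
apply: leeD.
  by apply: lee_pmul => //; apply: integral_ge0 => u _; rewrite lee_fin.
apply: ge0_le_integral => //.
- by move=> u _; rewrite lee_fin sqr_ge0.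
- by apply/measurable_EFinP; exact: measurable_funX.
- by apply/measurable_EFinP; apply: measurable_funX; exact: measurable_mx_norm.
- by move=> u _; rewrite lee_fin -(real_normK (num_real (f u))) lerXn2r// ?nnegrE//.
Qed.

End two_sided_levy.

(** * Averages over a mesh and their convergence in L^1 *)

Section scheffe.
Context {R : realType} (disp : measure_display) (T : measurableType disp).
Variable mu : {measure set T -> \bar R}.

Lemma le_limn_einf (u v : (\bar R)^nat) :
  (forall n, u n <= v n)%E -> (limn_einf u <= limn_einf v)%E.
Proof.
move=> uv; rewrite !limn_einf_lim; apply: lee_lim; [exact: is_cvg_einfs|exact: is_cvg_einfs|].
apply: nearW => n; apply: le_ereal_inf_tmp => _ [k nk <-].
by rewrite (le_trans _ (uv k))//; apply: ereal_inf_lbound; exists k.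
Qed.

(** Fatou applied to |f_n| + |f| - |f_n - f| >= 0, whose limit is 2 |f|: as the integral of |f_n| is
    at most that of |f|, the upper limit of the integrals of |f_n - f| is at most 0. The norms are
    compared by an inequality because averaging supplies one for every n. *)
Lemma scheffe (f_ : nat -> T -> R) (f : T -> R) :
  (forall n, measurable_fun setT (f_ n)) -> mu.-integrable setT (EFin \o f) ->
  {ae mu, forall x, f_ n x @[n --> \oo] --> f x} ->
  (forall n, \int[mu]_x `|f_ n x|%:E <= \int[mu]_x `|f x|%:E)%E ->
  (\int[mu]_x `|f_ n x - f x|%:E)%E @[n --> \oo] --> 0%E.
Proof.
move=> mf_ intf cvgf lef.
have mf : measurable_fun setT f by apply/measurable_EFinP; case/integrableP: intf.
have iabs := integrable_norm intf.
set I := (\int[mu]_x `|f x|%:E)%E in lef *.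
have Ifin : I \is a fin_num by exact: (integrable_fin_num measurableT iabs).
have I0 : (0 <= I)%E by apply: integral_ge0 => x _; rewrite lee_fin.
have intf_ n : mu.-integrable setT (EFin \o f_ n).
  apply/integrableP; split; first exact/measurable_EFinP.
  by rewrite (le_lt_trans (lef n))// ltey_eq Ifin.
have iabs_ n := integrable_norm (intf_ n).
have iD n : mu.-integrable setT (EFin \o (fun x => `|f_ n x - f x|)).
  apply: integrable_norm => /=.
  by have := integrableB measurableT (intf_ n) intf; apply: eq_integrable.
pose phi n x := (`|f_ n x| + `|f x| - `|f_ n x - f x|)%:E.
have mphi n : measurable_fun setT (phi n).
  apply/measurable_EFinP; apply: measurable_funB.
    by apply: measurable_funD; exact: measurableT_comp.
  by apply: measurableT_comp => //; exact: measurable_funB.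
have phi0 n x : setT x -> (0 <= phi n x)%E.
  by move=> _; rewrite lee_fin subr_ge0 ler_normB.
have := fatou mu measurableT mphi phi0.
have -> : (\int[mu]_x limn_einf (phi^~ x) = I + I)%E.
  rewrite -ge0_integralD//; last 2 first.
    by case/integrableP: iabs.
    by case/integrableP: iabs.
  apply: ae_eq_integral => //.
  - rewrite (_ : (fun x => _) = (fun x => - limn_esup (-%E \o (phi^~ x)))%E); last first.
      by apply/funext => x; rewrite limn_esupN oppeK.
    apply: measurableT_comp => //; apply: measurable_fun_limn_esup => n.
    exact: measurableT_comp.
  - by apply: emeasurable_funD; case/integrableP: iabs.
  - apply: filterS cvgf => x cf _.
    suff : phi n x @[n --> \oo] --> (`|f x|%:E + `|f x|%:E)%E.
      by move/cvg_limn_einf_sup => [].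
    rewrite -EFinD; apply: cvg_EFin; first exact: nearW.
    rewrite -[X in _ --> X]subr0; apply: cvgB.
      by apply: cvgD; [exact: cvg_norm|exact: cvg_cst].
    rewrite -(normr0 R) -(subrr (f x)).
    by apply: cvg_norm; apply: cvgB => //; exact: cvg_cst.
set d := (fun n => \int[mu]_x `|f_ n x - f x|%:E)%E.
move=> fatouI.
have d0 n : (0 <= d n)%E by apply: integral_ge0 => x _; rewrite lee_fin.
have : (I + I <= limn_einf (fun n => (I + I) + - d n))%E.
  apply: (le_trans fatouI); apply: le_limn_einf => n.
  rewrite /phi.
  have -> : (\int[mu]_x (`|f_ n x| + `|f x| - `|f_ n x - f x|)%:E =
      \int[mu]_x `|f_ n x|%:E + I - d n)%E.
    have ia := integrableD measurableT (iabs_ n) iabs.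
    rewrite /I /d -(integralD measurableT (iabs_ n) iabs).
    exact: (integralB measurableT ia (iD n)).
  by apply: leeB => //; exact: leeD.
have II : (I + I)%E \is a fin_num.
  by rewrite fin_numD; apply/andP; split; exact: Ifin.
rewrite limn_einf_shift//.
rewrite (limn_einfN d) => h.
apply: limn_esup_le_cvg => //.
move: h; rewrite -[X in (X <= _)%E]adde0 leeD2lE//.
by rewrite leeNr oppe0.
Qed.

End scheffe.

Lemma bounded_integrable {R : realType} (disp : measure_display)
    (T : measurableType disp) (mu : {measure set T -> \bar R}) (A : set T)
    (f : T -> R) (C : R) : measurable A -> (mu A < +oo)%E ->
  measurable_fun A f -> (forall x, A x -> `|f x| <= C) ->
  mu.-integrable A (EFin \o f).
Proof.
move=> mA Aoo mf fC; apply: measurable_bounded_integrable => //.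
exists C; split; first exact: num_real.
by move=> M CM x Ax /=; rewrite (le_trans (fC x Ax))// ltW.
Qed.

Section mesh.
Context {R : realType}.
Local Notation mu := (@lebesgue_measure R).
Implicit Types (f : R -> R) (u : R) (n k : nat).

(* The window ]-n, n] is cut into intervals of length 1 / (n + 1). *)
Definition mesh_pt n k : R := (k%:R - (n * n.+1)%:R) / n.+1%:R.
Definition mesh_size n : nat := (2 * (n * n.+1))%N.
Definition mesh_itv n k : set R := `]mesh_pt n k, mesh_pt n k.+1].

Definition mesh_avg f n k : R := n.+1%:R * \int[mu]_(v in mesh_itv n k) f v.

Definition mesh_approx f n u : R :=
  \sum_(k < mesh_size n) \1_(mesh_itv n k) u * mesh_avg f n k.

Lemma mesh_ptP n k : mesh_pt n k <= mesh_pt n k.+1.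
Proof.
by rewrite /mesh_pt ler_wpM2r ?invr_ge0//= lerB// ler_nat leqnSn.
Qed.

Lemma mesh_ptS n k : mesh_pt n k.+1 = mesh_pt n k + n.+1%:R^-1.
Proof. by rewrite /mesh_pt -natr1 addrAC mulrDl mul1r. Qed.

Lemma mesh_pt_homo n k k' : (k <= k')%N -> mesh_pt n k <= mesh_pt n k'.
Proof. by move=> kk'; rewrite /mesh_pt ler_wpM2r ?invr_ge0//= lerB// ler_nat. Qed.

Lemma mesh_itv_inj n k k' u : mesh_itv n k u -> mesh_itv n k' u -> k = k'.
Proof.
rewrite /mesh_itv/= !in_itv/= => /andP[h1 h2] /andP[h3 h4].
case: (ltngtP k k') => // /(mesh_pt_homo n) h.
  by have := lt_le_trans h3 (le_trans h2 h); rewrite ltxx.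
by have := lt_le_trans h1 (le_trans h4 h); rewrite ltxx.
Qed.

Lemma measurable_mesh_itv n k : measurable (mesh_itv n k).
Proof. exact: measurable_itv. Qed.

Lemma lebesgue_measure_mesh_itv n k : mu (mesh_itv n k) = (n.+1%:R^-1)%:E.
Proof.
rewrite lebesgue_measure_itv/= lte_fin mesh_ptS ltrDl invr_gt0 ltr0n/=.
by rewrite -EFinB addrAC subrr add0r.
Qed.

Lemma mesh_cover n u : - n%:R < u <= n%:R ->
  exists2 k, (k < mesh_size n)%N & mesh_itv n k u.
Proof.
move=> /andP[un nu].
have n0 : 0 < n.+1%:R :> R by rewrite ltr0n.
(* The distance from -n to u in units of the cell length. The cell is the least k with y <= k + 1;
   minimality gives k < y. *)
pose y := u * n.+1%:R + (n * n.+1)%:R.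
have y0 : 0 < y by rewrite /y natrM -mulrDl pmulr_lgt0// -ltrBlDr sub0r.
have yn : y <= (mesh_size n)%:R.
  rewrite /y /mesh_size mul2n -addnn natrD lerD2r natrM.
  by rewrite ler_wpM2r.
have ex : exists k, y <= k.+1%:R by exists (mesh_size n); rewrite (le_trans yn)// ler_nat.
have [k yk kmin] := ex_minnP ex.
have ky : k%:R < y.
  case: k yk kmin => [|k] yk kmin; first by [].
  by rewrite ltNge; apply/negP => /kmin; rewrite ltnn.
exists k.
  by rewrite -(ltr_nat R) (lt_le_trans ky).
rewrite /mesh_itv/= in_itv/= /mesh_pt ltr_pdivrMr// ler_pdivlMr//.
by rewrite ltrBlDr lerBrDr ky yk.
Qed.

Lemma mesh_approxE f n k u : (k < mesh_size n)%N -> mesh_itv n k u ->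
  mesh_approx f n u = mesh_avg f n k.
Proof.
move=> kn ku; rewrite /mesh_approx (bigD1 (Ordinal kn))//= big1 ?addr0.
  by rewrite indicE mem_set// mul1r.
move=> i ik; rewrite indicE memNset ?mul0r// => iu.
by move/negP : ik; apply; apply/eqP/val_inj => /=; exact: mesh_itv_inj iu ku.
Qed.

Lemma mesh_approx0 f n u : (forall k, (k < mesh_size n)%N -> ~ mesh_itv n k u) ->
  mesh_approx f n u = 0.
Proof.
move=> h; rewrite /mesh_approx big1// => i _.
by rewrite indicE memNset ?mul0r//; exact: h.
Qed.

Lemma mesh_approxP f n u :
  (exists k, [/\ (k < mesh_size n)%N, mesh_itv n k u & mesh_approx f n u = mesh_avg f n k])
  \/ mesh_approx f n u = 0.
Proof.
have [[k kn ku]|h] := pselect (exists2 k, (k < mesh_size n)%N & mesh_itv n k u).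
  by left; exists k; split => //; exact: mesh_approxE.
by right; apply: mesh_approx0 => k kn ku; apply: h; exists k.
Qed.

Lemma measurable_mesh_approx f n : measurable_fun setT (mesh_approx f n).
Proof.
apply: measurable_sum => k; apply: measurable_funM => //.
by apply: measurable_indic; exact: measurable_itv.
Qed.

Lemma mesh_avg_bound f n k (C : R) : measurable_fun setT f ->
  (forall u, `|f u| <= C) -> `|mesh_avg f n k| <= C.
Proof.
move=> mf fC.
have C0 : 0 <= C by rewrite (le_trans (normr_ge0 (f 0))).
rewrite /mesh_avg normrM ger0_norm// -ler_pdivlMl ?ltr0n//.
have If : mu.-integrable (mesh_itv n k) (EFin \o f).
  apply: (@bounded_integrable _ _ _ _ _ _ C) => //.
  - exact: measurable_mesh_itv.
  - by rewrite /= lebesgue_measure_mesh_itv ltry.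
  - exact: measurable_funTS.
rewrite (le_trans (le_normr_Rintegral _ If))//; first exact: measurable_mesh_itv.
apply: (@le_trans _ _ (\int[mu]_(v in mesh_itv n k) C)).
  apply: le_Rintegral => //.
  - exact: measurable_mesh_itv.
  - exact: integrable_norm.
  - apply: measurable_bounded_integrable => //.
    + exact: measurable_mesh_itv.
    + by rewrite /= lebesgue_measure_mesh_itv ltry.
    + exact: bounded_cst.
rewrite Rintegral_cst; last exact: measurable_mesh_itv.
by rewrite /= lebesgue_measure_mesh_itv/= mulrC.
Qed.

Lemma mesh_approx_bound f n (C : R) u : measurable_fun setT f ->
  (forall u, `|f u| <= C) -> `|mesh_approx f n u| <= C.
Proof.
move=> mf fC; have [[k [_ _ ->]]|->] := mesh_approxP f n u.
  exact: mesh_avg_bound.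
by rewrite normr0 (le_trans (normr_ge0 (f 0))).
Qed.

(** Averaging contracts the L^1 norm on each cell, and the cells are disjoint. This is the norm
    inequality that [scheffe] requires. *)
Lemma mesh_approx_L1 f n : mu.-integrable setT (EFin \o f) ->
  (\int[mu]_u `|mesh_approx f n u|%:E <= \int[mu]_u `|f u|%:E)%E.
Proof.
move=> intf.
have mf : measurable_fun setT f by apply/measurable_EFinP; case/integrableP: intf.
have mnf : measurable_fun setT (fun u => `|f u|) by exact: measurableT_comp.
have mfk k : measurable_fun setT (fun u => (`|f u| * \1_(mesh_itv n k) u)%:E).
  apply/measurable_EFinP; apply: measurable_funM => //.
  by apply: measurable_indic; exact: measurable_mesh_itv.
have intfk k : mu.-integrable (mesh_itv n k) (EFin \o f).
  by apply: integrableS intf => //; exact: measurable_mesh_itv.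
have m1 k : measurable_fun setT (\1_(mesh_itv n k) : R -> R).
  by apply: measurable_indic; exact: measurable_mesh_itv.
apply: (@le_trans _ _ (\int[mu]_u (\sum_(k < mesh_size n)
    (`|mesh_avg f n k|%:E * (\1_(mesh_itv n k) u)%:E)))%E).
  apply: ge0_le_integral => //.
  - by apply/measurable_EFinP; apply: measurableT_comp => //; exact: measurable_mesh_approx.
  - apply: emeasurable_sum => k; apply: emeasurable_funM => //.
    by apply/measurable_EFinP; exact: (m1 k).
  - move=> u _; under eq_bigr do rewrite -EFinM.
    rewrite sumEFin lee_fin (le_trans (ler_norm_sum _ _ _))//.
    by apply: ler_sum => k _; rewrite normrM mulrC ler_wpM2l// ger0_norm.
rewrite ge0_integral_sum//; last first.
  by move=> k; apply: emeasurable_funM => //; apply/measurable_EFinP; exact: (m1 k).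
apply: (@le_trans _ _ (\sum_(k < mesh_size n)
    \int[mu]_u (`|f u| * \1_(mesh_itv n k) u)%:E)%E).
  apply: lee_sum => k _.
  rewrite ge0_integralZl_EFin//; last by apply/measurable_EFinP; exact: (m1 k).
  rewrite integral_indic//; last exact: measurable_mesh_itv.
  rewrite setIT /= lebesgue_measure_mesh_itv -EFinM.
  rewrite /mesh_avg normrM ger0_norm// mulrAC divff ?mul1r//.
  rewrite (@le_trans _ _ (\int[mu]_(v in mesh_itv n k) `|f v|)%:E)//.
    by rewrite lee_fin le_normr_Rintegral//; exact: measurable_mesh_itv.
  rewrite /Rintegral fineK; last first.
    apply: integrable_fin_num; first exact: measurable_mesh_itv.
    exact: (integrable_norm (intfk k)).
  rewrite integral_mkcond; under eq_integral do rewrite restrict_EFin.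
  rewrite (_ : (fun x => _) = (fun u => (`|f u| * \1_(mesh_itv n k) u)%:E))//.
  apply/funext => u; congr EFin; rewrite patchE indicE; case: (u \in _).
    by rewrite mulr1.
  by rewrite mulr0.
rewrite -ge0_integral_sum//; last by move=> k; exact: mfk.
apply: ge0_le_integral => //.
- by move=> u _; apply: sume_ge0 => k _; rewrite lee_fin mulr_ge0.
- by apply: emeasurable_sum => k; exact: mfk.
- by apply/measurable_EFinP; exact: mnf.
move=> u _; rewrite sumEFin lee_fin -mulr_sumr ler_piMr//.
have [[k kn ku]|h] := pselect (exists2 k, (k < mesh_size n)%N & mesh_itv n k u).
  rewrite (bigD1 (Ordinal kn))//= big1 ?addr0.
    by rewrite indicE; case: (_ \in _).
  move=> i ik; rewrite indicE memNset// => iu.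
  by move/negP : ik; apply; apply/eqP/val_inj => /=; exact: mesh_itv_inj iu ku.
rewrite big1// => i _; rewrite indicE memNset// => iu.
by apply: h; exists i.
Qed.

End mesh.

Section mesh_convergence.
Context {R : realType}.
Local Notation mu := (@lebesgue_measure R).

(** Lebesgue differentiation along nicely shrinking sets wants a set for every n. A small ball
    stands in as long as the window does not contain x, which for a given x happens for finitely
    many n only. *)
Let mesh_set (x : R) (n : nat) : set R :=
  if [pick k : 'I_(mesh_size n) | `[< mesh_itv n k x >]] is Some k
  then mesh_itv n k else ball x n.+1%:R^-1.

Let mesh_set_shrinking (x : R) : nicely_shrinking x (mesh_set x).
Proof.
have n0 n : 0 < n.+1%:R^-1 :> R by rewrite invr_gt0 ltr0n.
have n20 n : 0 < 2 / n.+1%:R :> R by rewrite divr_gt0.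
split=> [n|].
  rewrite /mesh_set; case: pickP => [k _|_]; first exact: measurable_mesh_itv.
  exact: measurable_ball.
(* A cell of length 1 / (n + 1) containing x lies in the ball of radius 2 / (n + 1) about x, whose
   measure is 4 / (n + 1); for the substitute ball the ratio is 2. *)
exists (4%:R, fun n => PosNum (n20 n)); split => /=.
- by [].
- rewrite -(mulr0 2); apply: cvgM; first exact: cvg_cst.
  exact: cvg_harmonic.
- move=> n; rewrite /mesh_set; case: pickP => [k /asboolP kx|_] y.
    move: kx; rewrite /mesh_itv/= !in_itv/= mesh_ptS => /andP[x1 x2] /andP[y1 y2].
    have := n0 n; rewrite /ball/= ltr_norml; move: x1 x2 y1 y2.
    set p := mesh_pt n k; set e := n.+1%:R^-1 => x1 x2 y1 y2 e0.
    by apply/andP; split; lra.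
  rewrite /ball/= => /lt_le_trans; apply.
  by rewrite ler_peMl ?ler1n// ltW.
- move=> n; rewrite lebesgue_measure_ball; last exact: ltW (n20 n).
  rewrite /mesh_set; case: pickP => [k _|_].
    rewrite /= lebesgue_measure_mesh_itv -EFinM lee_fin mulr2n.
    by set e := n.+1%:R^-1; lra.
  rewrite lebesgue_measure_ball; last exact: ltW (n0 n).
  rewrite -EFinM lee_fin !mulr2n.
  by have := n0 n; set e := n.+1%:R^-1; lra.
Qed.

Lemma mesh_approx_ae_cvg (f : R -> R) : mu.-integrable setT (EFin \o f) ->
  {ae mu, forall u, mesh_approx f n u @[n --> \oo] --> f u}.
Proof.
move=> intf.
have locf : locally_integrable setT f by apply: open_integrable_locally => //; exact: openT.
have := lebesgue_differentiation locf.
apply: (@filterS _ _ (ae_filter_ringOfSetsType mu)) => u Lu.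
have := nice_lebesgue_differentiation mesh_set_shrinking locf Lu.
move=> /fine_cvgP[_]; apply: cvg_trans; apply: near_eq_cvg.
have : \forall n \near \oo, `|u| < n%:R by exact: nbhs_infty_gtr.
apply: filterS => n; rewrite ltr_norml => /andP[un nu].
have [k kn ku] : exists2 k, (k < mesh_size n)%N & mesh_itv n k u.
  by apply: mesh_cover; rewrite un ltW.
rewrite /=; have -> : mesh_set u n = mesh_itv n k.
  rewrite /mesh_set; case: pickP => [k' /asboolP k'u|/(_ (Ordinal kn))].
    by congr (mesh_itv n _); exact: mesh_itv_inj k'u ku.
  by move/asboolP.
rewrite (mesh_approxE f kn ku) /mesh_avg /= lebesgue_measure_mesh_itv.
rewrite inver gt_eqF ?invr_gt0// invrK fineM//.
apply: integrable_fin_num; first exact: measurable_mesh_itv.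
by apply: integrableS intf => //; exact: measurable_mesh_itv.
Qed.

Lemma mesh_approx_cvg_L1 (f : R -> R) : mu.-integrable setT (EFin \o f) ->
  (\int[mu]_u `|mesh_approx f n u - f u|%:E)%E @[n --> \oo] --> 0%E.
Proof.
move=> intf; apply: scheffe => //.
- by move=> n; exact: measurable_mesh_approx.
- exact: mesh_approx_ae_cvg.
- by move=> n; exact: mesh_approx_L1.
Qed.

End mesh_convergence.

(** * Mesh approximation of matrix-valued kernels *)

Section matrix_norm_integrals.
Context {R : realType} (disp : measure_display) (T : measurableType disp).
Variables (mu : {measure set T -> \bar R}) (m n : nat).
Implicit Types f g h : T -> 'M[R]_(m, n).

Lemma measurable_norm_mx f : mx_measurable_fun setT f ->
  measurable_fun setT (fun x => `|f x|%:E).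
Proof. by move=> mf; apply/measurable_EFinP; exact: measurable_mx_norm. Qed.

Lemma measurable_sqr_norm_mx f : mx_measurable_fun setT f ->
  measurable_fun setT (fun x => (`|f x| ^+ 2)%:E).
Proof.
by move=> mf; apply/measurable_EFinP; apply: measurable_funX; exact: measurable_mx_norm.
Qed.

Lemma integral_norm_mx_triangle f g h :
  mx_measurable_fun setT f -> mx_measurable_fun setT g -> mx_measurable_fun setT h ->
  (\int[mu]_x `|f x - g x|%:E <=
   \int[mu]_x `|f x - h x|%:E + \int[mu]_x `|g x - h x|%:E)%E.
Proof.
move=> mf mg mh.
have mfh := measurable_norm_mx (mx_measurable_funB mf mh).
have mgh := measurable_norm_mx (mx_measurable_funB mg mh).
rewrite -ge0_integralD//; apply: ge0_le_integral => //.
- exact: measurable_norm_mx (mx_measurable_funB mf mg).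
- exact: emeasurable_funD.
- move=> x _; rewrite -EFinD lee_fin (distrC (g x)).
  by rewrite (le_trans _ (ler_normD _ _))// addrA subrK.
Qed.

Lemma integral_sqr_norm_mx_triangle f g h :
  mx_measurable_fun setT f -> mx_measurable_fun setT g -> mx_measurable_fun setT h ->
  (\int[mu]_x (`|f x - g x| ^+ 2)%:E <=
   2%:E * \int[mu]_x (`|f x - h x| ^+ 2)%:E +
   2%:E * \int[mu]_x (`|g x - h x| ^+ 2)%:E)%E.
Proof.
move=> mf mg mh.
have mfh := measurable_sqr_norm_mx (mx_measurable_funB mf mh).
have mgh := measurable_sqr_norm_mx (mx_measurable_funB mg mh).
rewrite -!ge0_integralZl_EFin// -ge0_integralD//; last 2 first.
- by apply: emeasurable_funM.
- by apply: emeasurable_funM.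
apply: ge0_le_integral => //.
- exact: measurable_sqr_norm_mx (mx_measurable_funB mf mg).
- by apply: emeasurable_funD; apply: emeasurable_funM.
- move=> x _; rewrite -!EFinM -EFinD lee_fin (distrC (g x)).
  have h1 : `|f x - g x| <= `|f x - h x| + `|h x - g x|.
    by rewrite (le_trans _ (ler_normD _ _))// addrA subrK.
  have h0 := normr_ge0 (f x - g x).
  move: h0 h1; move: `|f x - g x| `|f x - h x| `|h x - g x| => p q r p0 pqr.
  have : p ^+ 2 <= (q + r) ^+ 2 by rewrite lerXn2r// nnegrE// (le_trans p0).
  have := sqr_ge0 (q - r); rewrite sqrrB sqrrD; lra.
Qed.

Lemma integral_norm_mx_le_entries f : mx_measurable_fun setT f ->
  (\int[mu]_x `|f x|%:E <= \sum_i \sum_j \int[mu]_x `|f x i j|%:E)%E.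
Proof.
move=> mf.
have mfij i j : measurable_fun setT (fun x => `|f x i j|%:E).
  by apply/measurable_EFinP; apply: measurableT_comp => //; exact: mf.
under eq_bigr do rewrite -ge0_integral_sum//.
rewrite -ge0_integral_sum//; last 2 first.
- by move=> i; apply: emeasurable_sum => j.
- by move=> i x _; apply: sume_ge0.
apply: ge0_le_integral => //.
- exact: measurable_norm_mx.
- by apply: emeasurable_sum => i; apply: emeasurable_sum => j.
- move=> x _; under eq_bigr do rewrite sumEFin.
  by rewrite sumEFin lee_fin ler_norm_sum_entries.
Qed.

Lemma integral_entry_le_norm_mx f i j : mx_measurable_fun setT f ->
  (\int[mu]_x `|f x i j|%:E <= \int[mu]_x `|f x|%:E)%E.
Proof.
move=> mf; apply: ge0_le_integral => //.
- by apply/measurable_EFinP; apply: measurableT_comp => //; exact: mf.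
- exact: measurable_norm_mx.
- by move=> x _; rewrite lee_fin ler_entry_norm.
Qed.

End matrix_norm_integrals.

Lemma mx_norm_le {R : realType} (m n : nat) (M : 'M[R]_(m, n)) (C : R) :
  0 <= C -> (forall i j, `|M i j| <= C) -> `|M| <= C.
Proof.
by move=> C0 h; rewrite [leLHS]/Num.norm /= mx_normrE; apply: bigmax_le.
Qed.

Section mesh_step.
Context {R : realType} (d m : nat).
Local Notation mu := (@lebesgue_measure R).
Implicit Types f : R -> 'M[R]_(d, m).

Definition mesh_step f (n : nat) : step d m :=
  Step (mesh_size n) (fun k => \matrix_(i, j) mesh_avg (fun u => f u i j) n k)
    (mesh_ptP n).

Lemma mesh_step_funE f n u i j :
  step_fun (mesh_step f n) u i j = mesh_approx (fun u => f u i j) n u.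
Proof.
rewrite /step_fun summxE; apply: eq_bigr => k _.
by rewrite mxE /= mxE.
Qed.

Variables (f : R -> 'M[R]_(d, m)) (C M : R).
Hypothesis mf : mx_measurable_fun setT f.
Hypothesis fC : forall u, `|f u| <= C.
Hypothesis fM : (\int[mu]_u `|f u|%:E <= M%:E)%E.

Let C0 : 0 <= C.
Proof. by rewrite (le_trans (normr_ge0 (f 0))). Qed.

Lemma integrable_mx_entry i j : mu.-integrable setT (EFin \o (fun u => f u i j)).
Proof.
apply/integrableP; split; first by apply/measurable_EFinP; exact: mf.
apply: le_lt_trans (ltry M); apply: le_trans fM.
exact: integral_entry_le_norm_mx.
Qed.

Lemma mesh_step_bound n u : `|step_fun (mesh_step f n) u| <= C.
Proof.
apply: mx_norm_le => // i j; rewrite mesh_step_funE.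
apply: mesh_approx_bound; first exact: mf.
by move=> v; rewrite (le_trans (ler_entry_norm _ _ _)).
Qed.

Lemma mesh_step_cvg_L1 :
  (\int[mu]_u `|step_fun (mesh_step f n) u - f u|%:E)%E @[n --> \oo] --> 0%E.
Proof.
have h : (\sum_i \sum_j \int[mu]_u `|mesh_approx (fun u => f u i j) n u - f u i j|%:E)%E
    @[n --> \oo] --> 0%E.
  rewrite [X in _ --> X](_ : _ = \sum_(i < d) \sum_(j < m) (0 : \bar R))%E; last first.
    by rewrite big1// => i _; rewrite big1.
  apply: cvg_nnesum => i _.
    by apply: nearW => n; apply: sume_ge0 => j _; apply: integral_ge0 => u _; rewrite lee_fin.
  apply: cvg_nnesum => j _.
    by apply: nearW => n; apply: integral_ge0 => u _; rewrite lee_fin.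
  by apply: mesh_approx_cvg_L1; exact: integrable_mx_entry.
apply: (squeeze_cvge _ (cvg_cst 0%E) h); apply: nearW => n.
rewrite integral_ge0/=; last by move=> u _; rewrite lee_fin.
have mD : mx_measurable_fun setT (fun u => step_fun (mesh_step f n) u - f u).
  by apply: mx_measurable_funB => //; exact: measurable_step_fun.
apply: (le_trans (@integral_norm_mx_le_entries _ _ _ mu _ _ _ mD)).
apply: lee_sum => i _; apply: lee_sum => j _.
by under eq_integral do rewrite !mxE mesh_step_funE.
Qed.

(** The kernel and its averages are both bounded by C, so their difference is at most 2 C. The L^1
    error thus controls the L^2 error, and is the only one to follow. *)
Lemma mesh_step_L2_le n :
  (\int[mu]_u (`|step_fun (mesh_step f n) u - f u| ^+ 2)%:E <=
   (2 * C)%:E * \int[mu]_u `|step_fun (mesh_step f n) u - f u|%:E)%E.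
Proof.
have mD : mx_measurable_fun setT (fun u => step_fun (mesh_step f n) u - f u).
  by apply: mx_measurable_funB => //; exact: measurable_step_fun.
have m1 := measurable_norm_mx mD; have m2 := measurable_sqr_norm_mx mD.
have C20 : 0 <= 2 * C by rewrite mulr_ge0.
rewrite -ge0_integralZl_EFin; [|by []|by []|exact: m1|exact: C20].
apply: ge0_le_integral; [by []|by []|exact: m2| |].
  by apply: emeasurable_funM => //; exact: m1.
move=> u _; rewrite -EFinM lee_fin expr2 ler_wpM2r//.
by rewrite (le_trans (ler_normB _ _))// mulr_natl mulr2n lerD// mesh_step_bound.
Qed.

(** Each of the d m entries contributes at most M for the kernel and M for its averages. Uniformity
    in n serves twice: the square of the error is at most a constant times the error, and the error
    has an integrable majorant in s. *)
Lemma mesh_step_L1_le n :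
  (\int[mu]_u `|step_fun (mesh_step f n) u - f u|%:E <= ((d * m)%:R * (2 * M))%:E)%E.
Proof.
have mD : mx_measurable_fun setT (fun u => step_fun (mesh_step f n) u - f u).
  by apply: mx_measurable_funB => //; exact: measurable_step_fun.
apply: (le_trans (@integral_norm_mx_le_entries _ _ _ mu _ _ _ mD)).
apply: (@le_trans _ _ (\sum_(i < d) \sum_(j < m) (2 * M)%:E)%E).
  apply: lee_sum => i _; apply: lee_sum => j _.
  have intf := integrable_mx_entry i j.
  have mfij : measurable_fun setT (fun u => `|f u i j|).
    by apply: measurableT_comp => //; exact: mf.
  have fijM : (\int[mu]_u `|f u i j|%:E <= M%:E)%E.
    by apply: le_trans fM; exact: integral_entry_le_norm_mx.
  have map : measurable_fun setT (mesh_approx (fun u => f u i j) n).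
    exact: measurable_mesh_approx.
  have map' : measurable_fun setT (fun u => `|mesh_approx (fun u => f u i j) n u|).
    exact: measurableT_comp.
  apply: (@le_trans _ _ (\int[mu]_u `|mesh_approx (fun u => f u i j) n u|%:E +
      \int[mu]_u `|f u i j|%:E)%E).
    rewrite -ge0_integralD//; last 2 first.
    - by apply/measurable_EFinP; exact: map'.
    - by apply/measurable_EFinP; exact: mfij.
    apply: ge0_le_integral => //.
    - by apply/measurable_EFinP; apply: measurableT_comp => //; exact: mD.
    - by apply: emeasurable_funD; apply/measurable_EFinP; [exact: map'|exact: mfij].
    - by move=> u _; rewrite -EFinD lee_fin !mxE mesh_step_funE ler_normB.
  rewrite mulr_natl mulr2n EFinD leeD//.
  by rewrite (le_trans (mesh_approx_L1 _ intf)).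
under eq_bigr do rewrite sumEFin.
by rewrite sumEFin lee_fin !sumr_const !card_ord -mulrnA [leRHS]mulr_natl mulnC.
Qed.

End mesh_step.

Lemma cvge0_near_le {R : realType} (u : (\bar R)^nat) (e : R) :
  u n @[n --> \oo] --> 0%E -> 0 < e -> \forall n \near \oo, (u n <= e%:E)%E.
Proof.
move=> /fine_cvgP[fu /cvgr_lt/(_ e) h] e0.
by apply: filterS2 fu (h e0) => n fn; rewrite -(fineK fn) lee_fin; exact: ltW.
Qed.

(** * Second moment bounds in terms of the mesh error *)

Section stoch_integral_bounds.
Context {R : realType} (disp : measure_display) (T : measurableType disp).
Variables (P : probability T R) (d m : nat) (L : R -> T -> 'cV[R]_m).
Hypothesis hL : two_sided_levy_process P L.
Hypothesis L2 : finite_second_moments P L.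
Local Notation mu := (@lebesgue_measure R).

Let N1 (f g : R -> 'M[R]_(d, m)) := (\int[mu]_u `|f u - g u|%:E)%E.
Let N2 (f g : R -> 'M[R]_(d, m)) := (\int[mu]_u (`|f u - g u| ^+ 2)%:E)%E.

Let N1_triangle f g h : mx_measurable_fun setT f -> mx_measurable_fun setT g ->
  mx_measurable_fun setT h -> (N1 f g <= N1 f h + N1 g h)%E.
Proof.
by move=> mf mg mh; exact: (@integral_norm_mx_triangle _ _ _ mu _ _ _ _ _ mf mg mh).
Qed.

Let N2_triangle f g h : mx_measurable_fun setT f -> mx_measurable_fun setT g ->
  mx_measurable_fun setT h -> (N2 f g <= 2%:E * N2 f h + 2%:E * N2 g h)%E.
Proof.
by move=> mf mg mh; exact: (@integral_sqr_norm_mx_triangle _ _ _ mu _ _ _ _ _ mf mg mh).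
Qed.

Let N1_ge0 f g : (0 <= N1 f g)%E.
Proof. by apply: integral_ge0 => u _; rewrite lee_fin. Qed.

Let step_bound : exists2 K : R, 0 <= K & forall (g h : @step R d m) (a b : R),
  (N1 (step_fun g) (step_fun h) <= a%:E)%E ->
  (N2 (step_fun g) (step_fun h) <= b%:E)%E ->
  (\int[P]_w (`|step_integral L g w - step_integral L h w| ^+ 2)%:E <=
   (K * (a ^+ 2 + b))%:E)%E.
Proof.
have [K K0 hK] := step_integral_bound hL L2 d.
exists K => // g h a b N1a N2b.
rewrite (le_trans (hK g h))// EFinM lee_wpmul2l// EFinD leeD//.
by rewrite expr2 EFinM lee_pmul// N1_ge0.
Qed.

(** The integral X comes with an approximating sequence g of its own, unrelated to h. The integral
    of h is compared with that of g_k for k large; the factor 4 is made of one 2 for splitting the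
    square under P and one 2 for splitting the L^2 norm of kernels. *)
Lemma stoch_integral_step_bound : exists2 K : R, 0 <= K &
  forall f X (h : @step R d m) (a b : R), is_stoch_integral P L f X ->
  (\int[mu]_u `|step_fun h u - f u|%:E <= a%:E)%E ->
  (\int[mu]_u (`|step_fun h u - f u| ^+ 2)%:E <= b%:E)%E ->
  (\int[P]_w (`|step_integral L h w - X w| ^+ 2)%:E <= (K * (a ^+ 2 + b))%:E)%E.
Proof.
have [K K0 hK] := step_bound; exists (4 * K); first by rewrite mulr_ge0.
move=> f X h a b [mf mX [g [g1 g2 gX]]] ha hb.
have a0 : 0 <= a by rewrite -lee_fin (le_trans _ ha)// N1_ge0.
have b0 : 0 <= b.
  by rewrite -lee_fin (le_trans _ hb)//; apply: integral_ge0 => u _; rewrite lee_fin sqr_ge0.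
apply/lee_addgt0Pr => e e0.
(* An error dl in the choice of g_k costs at most c dl in the final bound, once dl <= 1 gives dl^2
   <= dl; hence dl <= e / c. *)
pose c := 2 * (K * (2 * a + 3)) + 2.
have c0 : 0 < c by rewrite ltr_wpDl// !mulr_ge0// addr_ge0// mulr_ge0.
pose dl := Num.min 1 (e / c).
have dl0 : 0 < dl by rewrite lt_min ltr01 divr_gt0.
have [k [k1 k2 kX]] : exists k, [/\ (N1 (step_fun (g k)) f <= dl%:E)%E,
    (N2 (step_fun (g k)) f <= dl%:E)%E &
    (\int[P]_w (`|step_integral L (g k) w - X w| ^+ 2)%:E <= dl%:E)%E].
  near \oo => k; exists k; split; near: k.
  - exact: cvge0_near_le g1 dl0.
  - exact: cvge0_near_le g2 dl0.
  - exact: cvge0_near_le gX dl0.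
have mh := measurable_step_fun h; have mg := measurable_step_fun (g k).
have n1 : (N1 (step_fun h) (step_fun (g k)) <= (a + dl)%:E)%E.
  by rewrite (le_trans (N1_triangle mh mg mf))// EFinD leeD.
have n2 : (N2 (step_fun h) (step_fun (g k)) <= (2 * b + 2 * dl)%:E)%E.
  apply: (le_trans (N2_triangle mh mg mf)).
  rewrite [leRHS](_ : _ = 2%:E * b%:E + 2%:E * dl%:E)%E//.
  by apply: leeD; apply: lee_wpmul2l.
have mSh := measurable_step_integral hL h.
have mSg := measurable_step_integral hL (g k).
apply: (le_trans (integral_sqr_norm_mx_triangle P mSh mX mSg)).
under [X in (_ + 2%:E * X <= _)%E]eq_integral do rewrite distrC.
apply: (@le_trans _ _ (2%:E * (K * ((a + dl) ^+ 2 + (2 * b + 2 * dl)))%:E + 2%:E * dl%:E)%E).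
  by apply: leeD; apply: lee_wpmul2l => //; exact: hK.
rewrite -!EFinM -EFinD -EFinD lee_fin.
have dl1 : dl <= 1 by rewrite ge_min lexx.
have dlc : c * dl <= e by rewrite mulrC -ler_pdivlMr// ge_min lexx orbT.
have h1 : (a + dl) ^+ 2 + (2 * b + 2 * dl) <= a ^+ 2 + 2 * b + (2 * a + 3) * dl.
  have dl2 : dl ^+ 2 <= dl by rewrite expr2 ler_piMl// ltW.
  by rewrite sqrrD mulr2n; lra.
have := ler_wpM2l K0 h1; move: dlc; rewrite /c.
have : 0 <= K * a ^+ 2 by rewrite mulr_ge0// sqr_ge0.
lra.
Unshelve. all: by end_near.
Qed.

(** K is chosen before f: one constant serves all the kernels F(s, .), and the estimates, being
    linear in the L^1 error, can be integrated in s. The first compares with a given integral, the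
    second makes the mesh integrals a Cauchy sequence. *)
Lemma mesh_step_integral_bound (C M : R) : exists2 K : R, 0 <= K &
  forall (f : R -> 'M[R]_(d, m)), mx_measurable_fun setT f ->
  (forall u, `|f u| <= C) -> (\int[mu]_u `|f u|%:E <= M%:E)%E ->
  (forall X n, is_stoch_integral P L f X ->
    \int[P]_w (`|step_integral L (mesh_step f n) w - X w| ^+ 2)%:E <=
    K%:E * \int[mu]_u `|step_fun (mesh_step f n) u - f u|%:E)%E /\
  (forall n n',
    \int[P]_w (`|step_integral L (mesh_step f n) w -
                 step_integral L (mesh_step f n') w| ^+ 2)%:E <=
    K%:E * (\int[mu]_u `|step_fun (mesh_step f n) u - f u|%:E +
            \int[mu]_u `|step_fun (mesh_step f n') u - f u|%:E))%E.
Proof.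
have [K1 K10 h1] := step_bound.
have [K2 K20 h2] := stoch_integral_step_bound.
pose D := (d * m)%:R * (2 * `|M|).
have D0 : 0 <= D by rewrite !mulr_ge0.
(* With errors e, e' <= D, the first term covers (e + e')^2 <= 2 D (e + e') and the L^2 part 4 C (e
   + e'), the second covers e^2 + 2 C e <= (D + 2 C) e. Absolute values are taken because C and M
   are known to be nonnegative only once f is given. *)
pose K := K1 * (2 * D + 4 * `|C|) + K2 * (D + 2 * `|C|).
have K10' : 0 <= K1 * (2 * D + 4 * `|C|) by rewrite mulr_ge0// addr_ge0// mulr_ge0.
have K20' : 0 <= K2 * (D + 2 * `|C|) by rewrite mulr_ge0// addr_ge0// mulr_ge0.
exists K; first by rewrite addr_ge0.
move=> f mf fC fM.
have C0 : 0 <= C by rewrite (le_trans (normr_ge0 (f 0))).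
have M0 : 0 <= M.
  by rewrite -lee_fin (le_trans _ fM)//; apply: integral_ge0 => u _; rewrite lee_fin.
pose e n := fine (N1 (step_fun (mesh_step f n)) f).
have N1E n : N1 (step_fun (mesh_step f n)) f = (e n)%:E.
  rewrite fineK// ge0_fin_numE ?N1_ge0// (le_lt_trans (mesh_step_L1_le mf fM n))//.
  exact: ltry.
have e0 n : 0 <= e n by rewrite fine_ge0.
have eD n : e n <= D.
  by rewrite -lee_fin -N1E /D (ger0_norm M0); exact: mesh_step_L1_le.
have N2E n : (N2 (step_fun (mesh_step f n)) f <= (2 * C * e n)%:E)%E.
  by rewrite EFinM -N1E; exact: mesh_step_L2_le.
rewrite /K (ger0_norm C0) in K10' K20' *.
split=> [X n fX|n n'].
  rewrite -/(N1 _ _) N1E.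
  apply: (@le_trans _ _ (K2 * (e n ^+ 2 + 2 * C * e n))%:E).
    by apply: (h2 _ _ _ _ _ fX); [rewrite -/(N1 _ _) N1E|exact: N2E].
  rewrite -EFinM lee_fin.
  have h : e n ^+ 2 + 2 * C * e n <= (D + 2 * C) * e n.
    by have := ler_wpM2r (e0 n) (eD n); rewrite expr2; lra.
  by have := ler_wpM2l K20 h; have := mulr_ge0 K10' (e0 n); lra.
rewrite -!/(N1 _ _) !N1E.
have mg k := measurable_step_fun (mesh_step f k).
have n1 : (N1 (step_fun (mesh_step f n)) (step_fun (mesh_step f n')) <= (e n + e n')%:E)%E.
  by rewrite (le_trans (N1_triangle (mg n) (mg n') mf))// !N1E.
have n2 : (N2 (step_fun (mesh_step f n)) (step_fun (mesh_step f n')) <=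
    (2 * (2 * C * e n) + 2 * (2 * C * e n'))%:E)%E.
  apply: (le_trans (N2_triangle (mg n) (mg n') mf)).
  rewrite [leRHS](_ : _ = 2%:E * (2 * C * e n)%:E + 2%:E * (2 * C * e n')%:E)%E//.
  by apply: leeD; apply: lee_wpmul2l.
apply: (le_trans (h1 _ _ _ _ n1 n2)).
rewrite [leRHS](_ : _ = ((K1 * (2 * D + 4 * C) + K2 * (D + 2 * C)) *
  (e n + e n'))%:E)// lee_fin.
have h : (e n + e n') ^+ 2 <= 2 * D * (e n + e n').
  have s0 := addr_ge0 (e0 n) (e0 n').
  by have := ler_wpM2r s0 (lerD (eD n) (eD n')); rewrite expr2; lra.
have := ler_wpM2l K10 h; have := mulr_ge0 K20' (addr_ge0 (e0 n) (e0 n')); lra.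
Qed.

End stoch_integral_bounds.

(** * Almost sure limits of fast Cauchy sequences *)

Section fast_cauchy.
Context {R : realType} (disp : measure_display) (T : measurableType disp).
Variables (P : probability T R) (y : nat -> T -> R) (B : R).
Hypothesis my : forall n, measurable_fun setT (y n).
Hypothesis yB : forall n n',
  (\int[P]_w ((y n w - y n' w) ^+ 2)%:E <= (B * (4^-1 ^+ n + 4^-1 ^+ n'))%:E)%E.

Let B0 : 0 <= B.
Proof.
have : (0 <= (B * (4^-1 ^+ 0 + 4^-1 ^+ 0))%:E)%E.
  by rewrite (le_trans _ (yB 0 0))//; apply: integral_ge0 => w _; rewrite lee_fin sqr_ge0.
by rewrite lee_fin pmulr_lge0// expr0.
Qed.

Let a n w := `|y n.+1 w - y n w|.

Let a_ge0 n w : (0 <= (a n w)%:E)%E.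
Proof. by rewrite lee_fin /a. Qed.

Let ma n : measurable_fun setT (fun w => (a n w)%:E).
Proof.
by apply/measurable_EFinP; apply: measurableT_comp => //; exact: measurable_funB.
Qed.

(* 2^-n + 2^n x^2 dominates |x|. *)
Let a_int n : (\int[P]_w (a n w)%:E <= ((1 + 2 * B) * 2^-1 ^+ n)%:E)%E.
Proof.
have m2 : measurable_fun setT (fun w => ((y n.+1 w - y n w) ^+ 2)%:E).
  by apply/measurable_EFinP; apply: measurable_funX; exact: measurable_funB.
apply: (@le_trans _ _ (\int[P]_w ((2^-1 ^+ n)%:E + (2 ^+ n)%:E * ((y n.+1 w - y n w) ^+ 2)%:E))%E).
  apply: ge0_le_integral => //.
  - by apply: emeasurable_funD => //; apply: emeasurable_funM.
  - move=> w _; rewrite -EFinM -EFinD lee_fin /a.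
    set x := y n.+1 w - y n w.
    rewrite -(real_normK (num_real x)) exprVn.
    have p0 : 0 < 2 ^+ n :> R by rewrite exprn_gt0.
    move: (normr_ge0 x); move: `|x| => z z0.
    rewrite -(ler_pM2l p0) mulrDr divff ?gt_eqF// mulrA.
    set p := 2 ^+ n in p0 *.
    have -> : p * p * z ^+ 2 = (p * z) ^+ 2 by ring.
    by set q := p * z; have := sqr_ge0 (q - 1); nra.
rewrite ge0_integralD//; last 2 first.
- by move=> w _; rewrite -EFinM lee_fin; apply: mulr_ge0; [exact: exprn_ge0|exact: sqr_ge0].
- by apply: emeasurable_funM.
rewrite [X in (X + _ <= _)%E](_ : _ = (2^-1 ^+ n)%:E); last first.
  transitivity ((2^-1 ^+ n)%:E * P setT)%E; first exact: integral_cst.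
  by rewrite probability_setT mule1.
rewrite ge0_integralZl_EFin; [|by []|by move=> w _; rewrite lee_fin sqr_ge0|exact: m2|exact: exprn_ge0].
apply: (@le_trans _ _ ((2^-1 ^+ n)%:E + (2 ^+ n)%:E * (B * (4^-1 ^+ n.+1 + 4^-1 ^+ n))%:E)%E).
  by apply: leeD => //; apply: lee_wpmul2l; [rewrite lee_fin exprn_ge0|exact: yB].
rewrite -EFinM -EFinD lee_fin.
have -> : 2 ^+ n * (B * (4^-1 ^+ n.+1 + 4^-1 ^+ n)) = B * (4^-1 + 1) * (2^-1 ^+ n) :> R.
  have -> : 4^-1 = 2^-1 * 2^-1 :> R by lra.
  rewrite exprS exprMn.
  have : 2 ^+ n * 2^-1 ^+ n = 1 :> R by rewrite -exprMn divff// expr1n.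
  set p := 2 ^+ n; set q := 2^-1 ^+ n => pq.
  have -> : p * (B * (2^-1 * 2^-1 * (q * q) + q * q)) = B * (2^-1 * 2^-1 + 1) * q * (p * q) by ring.
  by rewrite pq mulr1.
have q0 : 0 <= 2^-1 ^+ n :> R by rewrite exprn_ge0.
have := mulr_ge0 B0 q0; lra.
Qed.

Let sum_a : (\sum_(0 <= n <oo) \int[P]_w (a n w)%:E < +oo)%E.
Proof.
apply: (@le_lt_trans _ _ ((1 + 2 * B) * 2)%:E); last exact: ltry.
apply: lime_le.
  by apply: is_cvg_nneseries => n _ _; apply: integral_ge0 => w _; exact: a_ge0.
apply: nearW => n; apply: (@le_trans _ _ (\sum_(0 <= k < n) ((1 + 2 * B) * 2^-1 ^+ k)%:E)%E).
  by apply: lee_sum => k _; exact: a_int.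
rewrite sumEFin lee_fin -mulr_sumr ler_wpM2l//; first by have := B0; lra.
suff -> : \sum_(0 <= k < n) 2^-1 ^+ k = 2 - 2 * 2^-1 ^+ n :> R.
  by rewrite gerBl mulr_ge0.
elim: n => [|n ih]; first by rewrite big_nil expr0; lra.
by rewrite big_nat_recr//= ih exprS; lra.
Qed.

(** An upper limit, which makes sense at every w and is measurable; where the sequence diverges its
    value is immaterial, this being a null set. *)
Definition fast_limit (w : T) : R := fine (limn_esup (fun n => (y n w)%:E)).

Lemma measurable_fast_limit : measurable_fun setT fast_limit.
Proof.
apply: measurableT_comp => //.
by apply: measurable_fun_limn_esup => n; apply/measurable_EFinP.
Qed.

Let cvg_fast w : (\sum_(0 <= n <oo) (a n w)%:E < +oo)%E ->
  y n w @[n --> \oo] --> fast_limit w.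
Proof.
move=> sa.
have cs : cvgn (series (fun n => y n.+1 w - y n w)).
  apply: normed_cvg; apply: nondecreasing_is_cvgn.
    apply/nondecreasing_seqP => n; rewrite /normed_series_of /series/= big_nat_recr//= lerDl//.
  exists (fine (\sum_(0 <= n <oo) (a n w)%:E)) => _ [n _ <-].
  rewrite -lee_fin fineK; last first.
    by rewrite ge0_fin_numE//; apply: nneseries_ge0 => k _ _; exact: a_ge0.
  rewrite /normed_series_of /series/= -sumEFin.
  by apply: nneseries_lim_ge => k _ _; exact: a_ge0.
have cy : cvgn (y^~ w).
  have -> : y^~ w = fun n => series (fun n => y n.+1 w - y n w) n + y 0 w.
    by apply/funext => n; rewrite /series/= telescope_sumr// subrK.
  by apply: is_cvgD => //; exact: is_cvg_cst.
suff -> : fast_limit w = limn (y^~ w) by [].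
rewrite /fast_limit.
have h : (y n w)%:E @[n --> \oo] --> (limn (y^~ w))%:E by apply: cvg_EFin => //; exact: nearW.
by rewrite (cvg_limn_einf_sup h).2.
Qed.

(** The series of the |y_(n+1) - y_n| has finite expectation, so it converges almost surely, and y
    with it. *)
Lemma ae_cvg_fast_limit : {ae P, forall w, y n w @[n --> \oo] --> fast_limit w}.
Proof.
have h : (\int[P]_w (\sum_(0 <= n <oo) (a n w)%:E) < +oo)%E.
  by rewrite integral_nneseries.
have m : measurable_fun setT (fun w => \sum_(0 <= n <oo) (a n w)%:E)%E.
  by apply: ge0_emeasurable_sum => // k w _ _; exact: a_ge0.
have s0 w : (0 <= \sum_(0 <= n <oo) (a n w)%:E)%E.
  by apply: nneseries_ge0 => k _ _; exact: a_ge0.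
have : P.-integrable setT (fun w => \sum_(0 <= n <oo) (a n w)%:E)%E.
  apply/integrableP; split => //.
  by under eq_integral do rewrite gee0_abs//.
move/(integrable_ae measurableT); apply: filterS => w /(_ I).
by rewrite ge0_fin_numE// => /cvg_fast.
Qed.

(** Fatou for (y_n - y_(k+n))^2 as k tends to infinity. *)
Lemma fast_limit_L2 n :
  (\int[P]_w ((y n w - fast_limit w) ^+ 2)%:E <= (B * (2 * 4^-1 ^+ n))%:E)%E.
Proof.
pose phi k w := ((y n w - y (k + n)%N w) ^+ 2)%:E.
have mphi k : measurable_fun setT (phi k).
  by apply/measurable_EFinP; apply: measurable_funX; exact: measurable_funB.
have phi0 k w : setT w -> (0 <= phi k w)%E by move=> _; rewrite lee_fin sqr_ge0.
have := fatou P measurableT mphi phi0.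
rewrite [X in (X <= _)%E -> _](_ : _ = \int[P]_w ((y n w - fast_limit w) ^+ 2)%:E)%E; last first.
  apply: ae_eq_integral => //.
  - rewrite (_ : (fun x => _) = (fun x => - limn_esup (-%E \o (phi^~ x)))%E); last first.
      by apply/funext => x; rewrite limn_esupN oppeK.
    apply: measurableT_comp => //; apply: measurable_fun_limn_esup => k.
    exact: measurableT_comp.
  - apply/measurable_EFinP; apply: measurable_funX; apply: measurable_funB => //.
    exact: measurable_fast_limit.
  - apply: filterS ae_cvg_fast_limit => w yw _.
    suff h : phi k w @[k --> \oo] --> ((y n w - fast_limit w) ^+ 2)%:E.
      by rewrite (cvg_limn_einf_sup h).1.
    apply: cvg_EFin; first exact: nearW.
    rewrite expr2; apply: cvgM; (apply: cvgB; [exact: cvg_cst|]);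
      by rewrite (cvg_shiftn n (y^~ w)).
move/le_trans; apply.
apply: (@le_trans _ _ (limn_einf (fun _ : nat => (B * (2 * 4^-1 ^+ n))%:E))).
  apply: le_limn_einf => k; rewrite (le_trans (yB _ _))// lee_fin ler_wpM2l//.
  rewrite [leRHS]mulr_natl mulr2n lerD// exprD ler_piMl// ?exprn_ge0//.
  by apply: exprn_ile1; lra.
have h : (B * (2 * 4^-1 ^+ n))%:E @[_ --> \oo] --> (B * (2 * 4^-1 ^+ n))%:E by exact: cvg_cst.
by rewrite (cvg_limn_einf_sup h).1.
Qed.

End fast_cauchy.

(** * A jointly measurable version of the integral *)

Section sections_of_kernels.
Context {R : realType} (disp : measure_display) (S : measurableType disp).
Local Notation mu := (@lebesgue_measure R).

(** No integrability is involved: Tonelli gives the measurability for the positive and the negative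
    part, after [A] has been absorbed into f as an indicator. *)
Lemma measurable_section_integral (f : S * R -> \bar R) (A : set R) :
  measurable_fun setT f -> measurable A ->
  measurable_fun setT (fun s => \int[mu]_(v in A) f (s, v))%E.
Proof.
move=> mf mA.
pose g (z : S * R) := (f z * (\1_A z.2)%:E)%E.
have mg : measurable_fun setT g.
  apply: emeasurable_funM => //; apply/measurable_EFinP.
  by apply: measurableT_comp => //; exact: measurable_indic.
have -> : (fun s => \int[mu]_(v in A) f (s, v))%E = (fun s =>
    \int[mu]_v (g^\+ (s, v)) - \int[mu]_v (g^\- (s, v)))%E.
  apply/funext => s; rewrite integral_mkcond integralE; congr (_ - _)%E;
    apply: eq_integral => v _; rewrite ?funeposE ?funenegE /g /=;
    by rewrite patchE indicE; case: (v \in A); rewrite ?mule1 ?mule0.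
apply: emeasurable_funB.
  exact: (@measurable_fun_fubini_tonelli_F _ _ S _ R mu _
    (measurable_funepos mg) (funepos_ge0 g)).
exact: (@measurable_fun_fubini_tonelli_F _ _ S _ R mu _
  (measurable_funeneg mg) (funeneg_ge0 g)).
Qed.

Lemma measurable_mesh_avg (f : S -> R -> R) n k :
  measurable_fun setT (fun z : S * R => f z.1 z.2) ->
  measurable_fun setT (fun s => mesh_avg (f s) n k).
Proof.
move=> mf; apply: measurable_funM => //; apply: measurableT_comp => //.
apply: (@measurable_section_integral (fun z => (f z.1 z.2)%:E)).
  exact/measurable_EFinP.
exact: measurable_mesh_itv.
Qed.

End sections_of_kernels.

Lemma mesh_step_integralE {R : realType} (disp : measure_display)
    (T : measurableType disp) (d m : nat) (L : R -> T -> 'cV[R]_m)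
    (f : R -> 'M[R]_(d, m)) n w i :
  step_integral L (mesh_step f n) w i ord0 =
  \sum_(k < mesh_size n) \sum_j mesh_avg (fun u => f u i j) n k *
    (L (mesh_pt n k.+1) w j ord0 - L (mesh_pt n k) w j ord0).
Proof.
rewrite /step_integral summxE; apply: eq_bigr => k _.
by rewrite mxE; apply: eq_bigr => j _; rewrite !mxE.
Qed.

Lemma mxBE {V : zmodType} (m n : nat) (A B : 'M[V]_(m, n)) i j :
  (A - B) i j = A i j - B i j.
Proof. by rewrite !mxE. Qed.

Section joint_version.
Context {R : realType} (disp : measure_display) (T : measurableType disp).
Variables (P : probability T R) (d m : nat) (L : R -> T -> 'cV[R]_m).
Hypothesis hL : two_sided_levy_process P L.
Hypothesis L2 : finite_second_moments P L.
Local Notation mu := (@lebesgue_measure R).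
Variables (F : R -> R -> 'M[R]_(d, m)) (C M : R).
Hypothesis mF : mx_measurable_fun setT (fun z : R * R => F z.1 z.2).
Hypothesis FC : forall s u, `|F s u| <= C.
Hypothesis FM : forall s, (\int[mu]_u `|F s u|%:E <= M%:E)%E.

Lemma mx_measurable_section s : mx_measurable_fun setT (F s).
Proof.
by move=> i j; exact: (measurableT_comp (mF i j) (pair1_measurable s)).
Qed.

(** With the mesh fixed, s enters through the averages only and w through the increments of L only;
    sums of products of such functions are jointly measurable. *)
Lemma measurable_mesh_step_integral n i : measurable_fun setT
  (fun z : R * T => step_integral L (mesh_step (F z.1) n) z.2 i ord0).
Proof.
under eq_fun do rewrite mesh_step_integralE.
apply: measurable_sum => k; apply: measurable_sum => j.
apply: measurable_funM.
  exact: (measurableT_comp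
    (@measurable_mesh_avg _ _ _ (fun s u => F s u i j) n k (mF i j)) measurable_fst).
apply: measurable_funB.
  exact: (measurableT_comp (two_sided_levy_measurable hL _ j ord0) measurable_snd).
exact: (measurableT_comp (two_sided_levy_measurable hL _ j ord0) measurable_snd).
Qed.

Let e n s := (\int[mu]_u `|step_fun (mesh_step (F s) n) u - F s u|%:E)%E.

Lemma measurable_mesh_step_error n : measurable_fun setT (fun s =>
  \int[mu]_u `|step_fun (mesh_step (F s) n) u - F s u|%:E)%E.
Proof.
apply: (@measurable_section_integral _ _ _ (fun z : R * R =>
  `|step_fun (mesh_step (F z.1) n) z.2 - F z.1 z.2|%:E) setT) => //.
apply/measurable_EFinP; apply: measurable_mx_norm; apply: mx_measurable_funB => // i j.
under eq_fun do rewrite mesh_step_funE.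
apply: measurable_sum => k; apply: measurable_funM.
  exact: (measurableT_comp (measurable_indic (measurable_mesh_itv n k)) measurable_snd).
exact: (measurableT_comp
  (@measurable_mesh_avg _ _ _ (fun s u => F s u i j) n k (mF i j)) measurable_fst).
Qed.

Let fast_mesh_ex j s : exists n, (e n s <= (4^-1 ^+ j)%:E)%E.
Proof.
have c := mesh_step_cvg_L1 (mx_measurable_section s) (FM s).
have p : 0 < 4^-1 ^+ j :> R by rewrite exprn_gt0.
by have [N _ h] := cvge0_near_le c p; exists N; apply: h => /=.
Qed.

(** The least admissible index: its level sets are then Boolean combinations of sublevel sets of the
    errors [e k], which are measurable in s. *)
Let fast_mesh j s := ex_minn (fast_mesh_ex j s).

Let fast_meshP j s : (e (fast_mesh j s) s <= (4^-1 ^+ j)%:E)%E.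
Proof. by rewrite /fast_mesh; case: ex_minnP. Qed.

Let measurable_fast_mesh j n : measurable [set s | fast_mesh j s = n].
Proof.
have mle k : measurable [set s | (e k s <= (4^-1 ^+ j)%:E)%E].
  rewrite -[X in measurable X]setTI.
  exact: (emeasurable_fun_infty_c measurableT (measurable_mesh_step_error k)).
rewrite (_ : [set s | _] = [set s | (e n s <= (4^-1 ^+ j)%:E)%E] `&`
    \bigcap_(k in [set k | (k < n)%N]) ~` [set s | (e k s <= (4^-1 ^+ j)%:E)%E]).
  apply: measurableI => //; apply: bigcap_measurableType => k _.
  exact: measurableC.
apply/seteqP; split => s /=; rewrite /fast_mesh; case: ex_minnP => k ek kmin.
  by move=> <-; split => // l /= lk /kmin; rewrite leqNgt lk.
move=> [en nk]; apply/eqP; rewrite eqn_leq kmin//= leqNgt; apply/negP => kn.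
exact: (nk k kn).
Qed.

Let y (i : 'I_d) j (z : R * T) :=
  step_integral L (mesh_step (F z.1) (fast_mesh j z.1)) z.2 i ord0.

Let measurable_y i j : measurable_fun setT (y i j).
Proof.
(* On each of these countably many measurable pieces the mesh is constant. *)
have -> : [set: R * T] = \bigcup_n [set z | fast_mesh j z.1 = n].
  by apply/seteqP; split => // z _; exists (fast_mesh j z.1).
have mE n : measurable [set z : R * T | fast_mesh j z.1 = n].
  rewrite -[X in measurable X]setTI.
  exact: (@measurable_fst _ _ R T measurableT [set s | fast_mesh j s = n]).
apply/measurable_fun_bigcup => // n.
apply: (@eq_measurable_fun _ _ _ _ _
  (fun z => step_integral L (mesh_step (F z.1) n) z.2 i ord0)).
  by move=> z; rewrite inE /= => zn; rewrite /y zn.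
apply: measurable_funTS; exact: measurable_mesh_step_integral.
Qed.

Lemma exists_joint_version : exists Y : R -> T -> 'cV[R]_d,
  mx_measurable_fun setT (fun z : R * T => Y z.1 z.2) /\
  forall s, is_stoch_integral P L (F s) (Y s).
Proof.
(* The upper limit is taken pointwise in (s, w). The same expression is thus jointly measurable and,
   for s fixed, the fast limit of the sections of [y i], to which the estimates under P apply. *)
pose Y s w : 'cV[R]_d := \col_i fast_limit (y i) (s, w).
have mY : mx_measurable_fun setT (fun z : R * T => Y z.1 z.2).
  move=> i k; under eq_fun do rewrite mxE.
  have := measurable_fast_limit (measurable_y i).
  by congr measurable_fun; apply/funext => -[].
exists Y; split; first exact: mY.
move=> s.
have mFs := mx_measurable_section s.
have [K K0 hK] := mesh_step_integral_bound d hL L2 C M.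
have [_ hK2] := hK (F s) mFs (FC s) (FM s).
have mSI n : mx_measurable_fun setT (step_integral L (mesh_step (F s) (fast_mesh n s))).
  exact: (measurable_step_integral hL (mesh_step (F s) (fast_mesh n s))).
have mys i n : measurable_fun setT (fun w => y i n (s, w)) by exact: (mSI n i ord0).
have ys i n n' : (\int[P]_w ((y i n (s, w) - y i n' (s, w)) ^+ 2)%:E <=
    (K * (4^-1 ^+ n + 4^-1 ^+ n'))%:E)%E.
  apply: (@le_trans _ _ (\int[P]_w (`|step_integral L (mesh_step (F s) (fast_mesh n s)) w -
      step_integral L (mesh_step (F s) (fast_mesh n' s)) w| ^+ 2)%:E)%E).
    apply: ge0_le_integral => //.
    - by move=> w _; rewrite lee_fin sqr_ge0.
    - by apply/measurable_EFinP; apply: measurable_funX; apply: measurable_funB; exact: mys.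
    - by apply: measurable_sqr_norm_mx; apply: mx_measurable_funB; exact: mSI.
    - move=> w _; rewrite lee_fin /y/= -[leLHS]real_normK ?num_real//.
      rewrite lerXn2r// ?nnegrE//.
      have := ler_entry_norm (step_integral L (mesh_step (F s) (fast_mesh n s)) w -
        step_integral L (mesh_step (F s) (fast_mesh n' s)) w) i ord0.
      by rewrite !mxE.
  apply: (le_trans (hK2 _ _)); rewrite EFinM; apply: lee_wpmul2l; first by rewrite lee_fin.
  by rewrite EFinD; apply: leeD; exact: fast_meshP.
have cvgc (c : R) : (c * 4^-1 ^+ n)%:E @[n --> \oo] --> 0%E.
  apply: cvg_EFin; first exact: nearW.
  have : `|4^-1 : R| < 1 by rewrite ger0_norm//; lra.
  exact: (@cvg_geometric R c).
split; [exact: mFs| |].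
  by move=> i k; exact: (measurableT_comp (mY i k) (pair1_measurable s)).
exists (fun j => mesh_step (F s) (fast_mesh j s)); split.
- apply: (squeeze_cvge _ (cvg_cst 0%E) (cvgc 1)); apply: nearW => n.
  rewrite integral_ge0/=; last by move=> u _; rewrite lee_fin.
  by rewrite mul1r; exact: fast_meshP.
- apply: (squeeze_cvge _ (cvg_cst 0%E) (cvgc (2 * C))); apply: nearW => n.
  rewrite integral_ge0/=; last by move=> u _; rewrite lee_fin.
  rewrite (le_trans (mesh_step_L2_le mFs (FC s) _))// [leRHS]EFinM.
  apply: lee_wpmul2l; last exact: fast_meshP.
  by rewrite lee_fin mulr_ge0// (le_trans (normr_ge0 (F s 0))).
- apply: (squeeze_cvge _ (cvg_cst 0%E) (cvgc (d%:R * (K * 2)))); apply: nearW => n.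
  rewrite integral_ge0/=; last by move=> u _; rewrite lee_fin.
  have mYs : mx_measurable_fun setT (Y s).
    by move=> i k; exact: (measurableT_comp (mY i k) (pair1_measurable s)).
  have mD i : measurable_fun setT (fun w => ((y i n (s, w) - Y s w i ord0) ^+ 2)%:E).
    apply/measurable_EFinP; apply: measurable_funX; apply: measurable_funB.
      exact: mys.
    exact: mYs.
  apply: (@le_trans _ _ (\int[P]_w (\sum_(i < d) ((y i n (s, w) - Y s w i ord0) ^+ 2)%:E))%E).
    apply: ge0_le_integral => //.
    - by apply: measurable_sqr_norm_mx; apply: mx_measurable_funB; [exact: mSI|exact: mYs].
    - by apply: emeasurable_sum => i; exact: mD.
    - move=> w _; rewrite sumEFin lee_fin (le_trans (sqr_mx_norm_le _))//.
      apply: ler_sum => i _; rewrite big_ord1.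
      by rewrite mxBE; exact: lexx.
  rewrite ge0_integral_sum//; last first.
    by move=> i w _; rewrite lee_fin sqr_ge0.
  apply: (@le_trans _ _ (\sum_(i < d) (K * (2 * 4^-1 ^+ n))%:E)%E).
    apply: lee_sum => i _; rewrite /Y; under eq_integral do rewrite mxE.
    exact: (fast_limit_L2 (mys i) (ys i) n).
  by rewrite sumEFin lee_fin sumr_const card_ord -[leLHS]mulr_natl !mulrA.
Qed.

End joint_version.

(** * Exchange of the two integrals *)

Lemma ler_norm_eps_sqr {R : realFieldType} (e x : R) : 0 < e ->
  `|x| <= e + e^-1 * x ^+ 2.
Proof.
move=> e0; rewrite -(ler_pM2l e0) mulrDr mulrA divff ?gt_eqF// mul1r.
rewrite -(real_normK (num_real x)).
by have := sqr_ge0 (e - `|x|); have := normr_ge0 x; nra.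
Qed.

Section mesh_avg_fubini.
Context {R : realType}.
Local Notation mu := (@lebesgue_measure R).

(** Fubini on the product of the line and one cell, the last hypothesis giving integrability there
    by Tonelli. Integrability of every section, and not of almost every one, keeps all the inner
    integrals finite, so that real and extended integrals agree pointwise. *)
Lemma Rintegral_mesh_avg (f : R -> R -> R) n k :
  measurable_fun setT (fun z : R * R => f z.1 z.2) ->
  (forall s, mu.-integrable setT (EFin \o f s)) ->
  (forall v, mu.-integrable setT (EFin \o (f^~ v))) ->
  (\int[mu]_s \int[mu]_v `|f s v|%:E < +oo)%E ->
  mu.-integrable setT (EFin \o (fun s => mesh_avg (f s) n k)) /\
  \int[mu]_s mesh_avg (f s) n k = mesh_avg (fun v => \int[mu]_s f s v) n k.
Proof.
move=> mf fs fv foo.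
pose I := mesh_itv n k : set R.
have mI : measurable I by exact: measurable_mesh_itv.
pose g (z : R * R) := (f z.1 z.2 * \1_I z.2)%:E.
have mg : measurable_fun setT g.
  apply/measurable_EFinP; apply: measurable_funM => //.
  exact: (measurableT_comp (measurable_indic mI) measurable_snd).
have ig : (mu \x mu)%E.-integrable setT g.
  apply/(@integrable12ltyP _ _ _ _ _ mu mu g mg).
  apply: le_lt_trans foo; apply: ge0_le_integral => //.
  - by move=> s _; apply: integral_ge0.
  - apply: (@measurable_section_integral _ _ _ (fun z => `|g z|)%E setT) => //.
    exact: measurableT_comp.
  - apply: (@measurable_section_integral _ _ _ (fun z => `|f z.1 z.2|%:E) setT) => //.
    by apply/measurable_EFinP; exact: measurableT_comp.
  - move=> s _; apply: ge0_le_integral => //.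
    + exact: (measurableT_comp (measurableT_comp (@abse_measurable R setT) mg) (pair1_measurable s)).
    + apply/measurable_EFinP; apply: measurableT_comp => //.
      exact: (measurableT_comp mf (pair1_measurable s)).
    + move=> v _; rewrite /g/= lee_fin normrM ler_piMr// indicE.
      by case: (v \in I); rewrite ?normr1 ?normr0.
have gs s : (\int[mu]_v g (s, v) = \int[mu]_(v in I) (f s v)%:E)%E.
  rewrite [RHS]integral_mkcond; apply: eq_integral => v _.
  by rewrite patchE /g/= indicE; case: (v \in I); rewrite ?mulr1 ?mulr0.
have fin s : (\int[mu]_(v in I) (f s v)%:E)%E \is a fin_num.
  by apply: integrable_fin_num => //; apply: integrableS (fs s).
have avgE : EFin \o (fun s => mesh_avg (f s) n k) =
    (fun s => n.+1%:R%:E * fubini_F mu g s)%E.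
  by apply/funext => s; rewrite /= /mesh_avg EFinM /fubini_F gs /Rintegral fineK.
have iF := integrable_fubini_F ig.
have iavg : mu.-integrable setT (EFin \o (fun s => mesh_avg (f s) n k)).
  by rewrite avgE; exact: integrableZl.
split => //.
rewrite /Rintegral -/(EFin \o _) avgE integralZl// fineM//; last first.
  exact: integrable_fin_num.
rewrite /mesh_avg /=; congr (_ * fine _).
rewrite [RHS]integral_mkcond; apply: (etrans (Fubini ig)).
apply: eq_integral => v _; rewrite patchE /g/=.
rewrite indicE; case: (v \in I).
  under eq_integral do rewrite mulr1.
  by rewrite fineK//; exact: (integrable_fin_num measurableT (fv v)).
rewrite (_ : (fun s => _) = cst 0%E); last by apply/funext => s; rewrite mulr0.
exact: integral0.
Qed.

End mesh_avg_fubini.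

Section L1_from_L2.
Context {R : realType} (disp : measure_display) (T : measurableType disp).
Variable P : probability T R.

Lemma integral_norm_le_eps_sqr (X : T -> R) (e : R) : measurable_fun setT X -> 0 < e ->
  (\int[P]_w `|X w|%:E <= e%:E + (e^-1)%:E * \int[P]_w (X w ^+ 2)%:E)%E.
Proof.
move=> mX e0.
have m2 : measurable_fun setT (fun w => (X w ^+ 2)%:E).
  by apply/measurable_EFinP; exact: measurable_funX.
have X20 w : setT w -> (0 <= (X w ^+ 2)%:E)%E by move=> _; rewrite lee_fin sqr_ge0.
have i0 : 0 <= e^-1 by rewrite invr_ge0 ltW.
rewrite -(ge0_integralZl_EFin P measurableT X20 m2 i0).
have -> : e%:E = (\int[P]_w e%:E)%E.
  transitivity (e%:E * P setT)%E; first by rewrite probability_setT mule1.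
  by rewrite -integral_cst.
rewrite -ge0_integralD//; last 3 first.
- by move=> w _; rewrite lee_fin ltW.
- by move=> w _; rewrite -EFinM lee_fin mulr_ge0// sqr_ge0.
- by apply: emeasurable_funM.
apply: ge0_le_integral => //.
- by apply/measurable_EFinP; exact: measurableT_comp.
- by apply: emeasurable_funD => //; apply: emeasurable_funM.
- by move=> w _; rewrite -EFinM -EFinD lee_fin ler_norm_eps_sqr.
Qed.

End L1_from_L2.

Section kernel_fubini.
Context {R : realType} (disp : measure_display) (T : measurableType disp).
Variables (P : probability T R) (d m : nat) (L : R -> T -> 'cV[R]_m).
Hypothesis hL : two_sided_levy_process P L.
Hypothesis L2 : finite_second_moments P L.
Local Notation mu := (@lebesgue_measure R).
Variables (a b C M : R) (F : R -> R -> 'M[R]_(d, m)).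
Let D : set R := `[a, b].
Hypothesis mF : mx_measurable_fun setT (fun z : R * R => F z.1 z.2).
Hypothesis FC : forall s u, `|F s u| <= C.
Hypothesis FM : forall s, (\int[mu]_u `|F s u|%:E <= M%:E)%E.
Hypothesis F0 : forall s, ~ D s -> forall u, F s u = 0.

Definition integrated_kernel (u : R) : 'M[R]_(d, m) :=
  \matrix_(i, j) \int[mu]_s F s u i j.
Local Notation G := integrated_kernel.

Let mD : measurable D.
Proof. exact: measurable_itv. Qed.

Let iD : mu.-integrable setT (EFin \o \1_D).
Proof. exact: integrable_indic_itv. Qed.

Let lam : R := \int[mu]_s \1_D s.

Let lamE : (\int[mu]_s (\1_D s)%:E = lam%:E)%E.
Proof. by rewrite /lam /Rintegral fineK//; exact: (integrable_fin_num measurableT iD). Qed.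

Let lam0 : 0 <= lam.
Proof. by apply: Rintegral_ge0. Qed.

Let C0 : 0 <= C.
Proof. by rewrite (le_trans (normr_ge0 (F 0 0))). Qed.

Let M0 : 0 <= M.
Proof.
by rewrite -lee_fin (le_trans _ (FM 0))//; apply: integral_ge0 => u _; rewrite lee_fin.
Qed.

Let integral_le_indic (f : R -> \bar R) (c : R) : 0 <= c -> measurable_fun setT f ->
  (forall s, 0 <= f s <= (c * \1_D s)%:E)%E -> (\int[mu]_s f s <= (c * lam)%:E)%E.
Proof.
move=> c0 mf fc.
have m1 : measurable_fun setT (\1_D : R -> R) by exact: measurable_indic.
apply: (@le_trans _ _ (\int[mu]_s (c%:E * (\1_D s)%:E))%E).
  apply: ge0_le_integral => //.
  - by move=> s _; case/andP: (fc s).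
  - by apply: emeasurable_funM => //; apply/measurable_EFinP; exact: m1.
  - by move=> s _; rewrite -EFinM; case/andP: (fc s).
rewrite ge0_integralZl_EFin; [by rewrite lamE|by []|by []| |by []].
by apply/measurable_EFinP; exact: m1.
Qed.

Let F_indic s u : `|F s u| <= C * \1_D s.
Proof.
rewrite indicE; have [sD|/negP sD] := boolP (s \in D); first by rewrite mulr1.
by rewrite F0 ?normr0 ?mulr0// => Ds; apply: sD; rewrite inE.
Qed.

Let mFij i j : measurable_fun setT (fun z : R * R => F z.1 z.2 i j).
Proof. exact: mF. Qed.

Let mFs s : mx_measurable_fun setT (F s).
Proof. exact: mx_measurable_section. Qed.

Let mFv i j v : measurable_fun setT (fun s => F s v i j).
Proof. exact: (measurableT_comp (mFij i j) (pair2_measurable v)). Qed.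

Let iFv i j v : mu.-integrable setT (EFin \o (fun s => F s v i j)).
Proof.
have : mu.-integrable setT (fun s => C%:E * (\1_D s)%:E)%E by exact: integrableZl.
apply: le_integrable => //; first by apply/measurable_EFinP; exact: mFv.
move=> s _ /=; rewrite lee_fin [leRHS]ger0_norm ?mulr_ge0//.
by rewrite (le_trans (ler_entry_norm _ _ _)).
Qed.

Let iFs i j s : mu.-integrable setT (EFin \o (fun u => F s u i j)).
Proof. exact: (integrable_mx_entry (mFs s) (FM s)). Qed.

Let norm_section i j s : (\int[mu]_u `|F s u i j|%:E <= (M * \1_D s)%:E)%E.
Proof.
rewrite indicE; have [sD|/negP sD] := boolP (s \in D).
  rewrite mulr1; apply: le_trans (FM s).
  exact: (@integral_entry_le_norm_mx _ _ _ mu _ _ (F s) i j (mFs s)).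
rewrite mulr0 (_ : (fun u => _) = cst 0%E) ?integral0//.
by apply/funext => u; rewrite F0 ?mxE ?normr0// => Ds; apply: sD; rewrite inE.
Qed.

Let iterated_bound i j : (\int[mu]_s \int[mu]_u `|F s u i j|%:E <= (M * lam)%:E)%E.
Proof.
apply: integral_le_indic => //.
  apply: (@measurable_section_integral _ _ _ (fun z => `|F z.1 z.2 i j|%:E) setT) => //.
  by apply/measurable_EFinP; exact: measurableT_comp.
by move=> s; rewrite norm_section andbT; apply: integral_ge0 => u _; rewrite lee_fin.
Qed.

Lemma measurable_integrated_kernel : mx_measurable_fun setT G.
Proof.
move=> i j; under eq_fun do rewrite mxE.
apply: measurableT_comp => //.
apply: (@measurable_section_integral _ _ _ (fun z => (F z.2 z.1 i j)%:E) setT) => //.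
apply/measurable_EFinP.
exact: (measurableT_comp (mFij i j) (measurable_fun_pair measurable_snd measurable_fst)).
Qed.

Lemma integrated_kernel_bound u : `|G u| <= C * lam.
Proof.
apply: mx_norm_le => [|i j]; first by rewrite mulr_ge0.
rewrite mxE (le_trans (le_normr_Rintegral _ (iFv i j u)))//.
have iN := integrable_norm (iFv i j u).
rewrite -lee_fin /Rintegral fineK; last exact: (integrable_fin_num measurableT iN).
apply: integral_le_indic => //.
  by apply/measurable_EFinP; apply: measurableT_comp => //; exact: mFv.
move=> s; rewrite !lee_fin normr_ge0/=.
by rewrite (le_trans (ler_entry_norm _ _ _)).
Qed.

(** By Tonelli, each entry of G has L^1 norm at most M times the length of [a, b]. Together with the
    uniform bound this admits G to all the estimates made for bounded integrable kernels. *)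
Lemma integrated_kernel_L1 : (\int[mu]_u `|G u|%:E <= (\sum_(i < d) \sum_(j < m) (M * lam))%:E)%E.
Proof.
apply: (le_trans (@integral_norm_mx_le_entries _ _ _ mu _ _ _ measurable_integrated_kernel)).
rewrite -sumEFin; apply: lee_sum => i _; rewrite -sumEFin; apply: lee_sum => j _.
apply: le_trans (iterated_bound i j).
have mn : measurable_fun setT (fun z : R * R => `|F z.1 z.2 i j|%:E).
  by apply/measurable_EFinP; exact: measurableT_comp.
rewrite (@fubini_tonelli _ _ _ _ _ mu mu _ mn) => [|z]; last by rewrite lee_fin.
apply: ge0_le_integral => //.
- by apply/measurable_EFinP; apply: measurableT_comp => //; exact: measurable_integrated_kernel.
- apply: (@measurable_section_integral _ _ _ (fun z => `|F z.2 z.1 i j|%:E) setT) => //.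
  exact: (measurableT_comp mn (measurable_fun_pair measurable_snd measurable_fst)).
- move=> u _; rewrite mxE.
  have iN := integrable_norm (iFv i j u).
  rewrite -(fineK (integrable_fin_num measurableT iN)) lee_fin.
  exact: le_normr_Rintegral.
Qed.

Let Yn n s w i := step_integral L (mesh_step (F s) n) w i ord0.

(** The exact exchange, valid for every w: the mesh integral is a finite combination of averages of
    F(s, .) whose coefficients, increments of L at w, do not depend on s. *)
Let YnE n w i :
  mu.-integrable setT (EFin \o (fun s => Yn n s w i)) /\
  \int[mu]_s Yn n s w i = step_integral L (mesh_step G n) w i ord0.
Proof.
have H j k := @Rintegral_mesh_avg R (fun s u => F s u i j) n k (mFij i j) (iFs i j)
  (iFv i j) (le_lt_trans (iterated_bound i j) (ltry _)).
have iT (k : 'I_(mesh_size n)) j : mu.-integrable setT (EFin \o (fun s =>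
    mesh_avg (fun u => F s u i j) n k *
    (L (mesh_pt n k.+1) w j ord0 - L (mesh_pt n k) w j ord0))).
  have := integrableZr measurableT
    (L (mesh_pt n k.+1) w j ord0 - L (mesh_pt n k) w j ord0) (H j k).1.
  by apply: eq_integrable.
rewrite /Yn; under [fun s => step_integral _ _ _ _ _]eq_fun do rewrite mesh_step_integralE.
split; first by do 2 apply: integrable_EFin_sum => ?; exact: iT.
rewrite Rintegral_sum => [|k]; last by apply: integrable_EFin_sum => j; exact: iT.
rewrite mesh_step_integralE; apply: eq_bigr => k _.
rewrite Rintegral_sum => [|j]; last exact: iT.
apply: eq_bigr => j _; rewrite RintegralZr//; last exact: (H j k).1.
rewrite (H j k).2; congr (mesh_avg _ _ _ * _).
by apply/funext => u; rewrite mxE.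
Qed.

Let e n s := (\int[mu]_u `|step_fun (mesh_step (F s) n) u - F s u|%:E)%E.

Let mesh_step0 n s : ~ D s -> forall k i j, step_coef (mesh_step (F s) n) k i j = 0.
Proof.
move=> Ds k i j; rewrite /= mxE /mesh_avg (_ : (fun u => F s u i j) = cst 0).
  by rewrite /Rintegral integral0 mulr0.
by apply/funext => u; rewrite F0// mxE.
Qed.

Let e0 n s : ~ D s -> e n s = 0%E.
Proof.
move=> Ds; rewrite /e (_ : (fun u => _) = cst 0%E) ?integral0//.
apply/funext => u; rewrite F0// subr0 /step_fun big1 ?normr0// => k _.
by apply/matrixP => i j; rewrite mxE mesh_step0// mulr0 mxE.
Qed.

Let Yn0 n s w i : ~ D s -> Yn n s w i = 0.
Proof.
move=> Ds; rewrite /Yn /step_integral summxE big1// => k _.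
by rewrite mxE big1// => j _; rewrite mesh_step0// mul0r.
Qed.

Let e_ge0 n s : (0 <= e n s)%E.
Proof. by apply: integral_ge0 => u _; rewrite lee_fin. Qed.

Let me n : measurable_fun setT (e n).
Proof. exact: measurable_mesh_step_error. Qed.

(** Convergence for each s becomes convergence of the integral: the error is at most a constant on
    [a, b] and vanishes elsewhere. *)
Let cvg_e : (\int[mu]_s e n s)%E @[n --> \oo] --> 0%E.
Proof.
pose B := (d * m)%:R * (2 * M).
have iB : mu.-integrable setT (fun s => B%:E * (\1_D s)%:E)%E by exact: integrableZl.
have eB n s : (`|e n s| <= B%:E * (\1_D s)%:E)%E.
  rewrite gee0_abs// indicE; have [sD|/negP sD] := boolP (s \in D).
    by rewrite mule1; exact: (mesh_step_L1_le (mFs s) (FM s) n).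
  by rewrite e0 ?mule0// => Ds; apply: sD; rewrite inE.
have ce : {ae mu, forall s, setT s -> e n s @[n --> \oo] --> cst 0%E s}.
  by apply: aeW => s _; exact: (mesh_step_cvg_L1 (mFs s) (FM s)).
have ae_eB : {ae mu, forall s, forall n, setT s -> (`|e n s| <= B%:E * (\1_D s)%:E)%E}.
  by apply: aeW => s n _; exact: eB.
have [_ _] := @dominated_convergence _ _ _ mu setT measurableT e (cst 0%E)
  (fun s => B%:E * (\1_D s)%:E)%E me (@measurable_cst _ _ _ _ setT 0%E) ce iB ae_eB.
by rewrite integral0.
Qed.

Variables (Y : R -> T -> 'cV[R]_d) (Z : T -> 'cV[R]_d).
Hypothesis mY : mx_measurable_fun setT (fun z : R * T => Y z.1 z.2).
Hypothesis FY : forall s, D s -> is_stoch_integral P L (F s) (Y s).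
Hypothesis Y0 : forall s, ~ D s -> forall w, Y s w = 0.
Hypothesis GZ : is_stoch_integral P L G Z.

Let mYn n i : measurable_fun setT (fun z : R * T => Yn n z.1 z.2 i).
Proof.
exact: (@measurable_mesh_step_integral _ _ _ _ _ _ _ hL _ mF n i).
Qed.

Let mdelta n i : measurable_fun setT (fun z : R * T => `|Yn n z.1 z.2 i - Y z.1 z.2 i ord0|%:E).
Proof.
apply/measurable_EFinP; apply: measurableT_comp => //; apply: measurable_funB.
  exact: mYn.
exact: mY.
Qed.

(** Tonelli puts P inside. For s fixed the expectation is at most eps plus K / eps times the mesh
    error, a bound that integrates over [a, b] because K does not depend on s. *)
Let cvg_delta i (eta : R) : 0 < eta -> \forall n \near \oo,
  (\int[P]_w \int[mu]_s `|Yn n s w i - Y s w i ord0|%:E <= eta%:E)%E.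
Proof.
move=> eta0.
have [K K0 hK] := mesh_step_integral_bound d hL L2 C M.
(* Each of the two terms receives eta / 2. The added 1, here and in [h2], keeps the denominators
   positive when [a, b] has length 0 or K is 0. *)
pose eps := eta / (2 * (lam + 1)).
have l1 : 0 < lam + 1 by rewrite ltr_wpDl.
have eps0 : 0 < eps by rewrite divr_gt0// mulr_gt0.
have i0 : 0 <= eps^-1 * K by rewrite mulr_ge0// invr_ge0 ltW.
have section s n : (\int[P]_w `|Yn n s w i - Y s w i ord0|%:E <=
    eps%:E * (\1_D s)%:E + (eps^-1 * K)%:E * e n s)%E.
  have [Ds|Ds] := pselect (D s); last first.
    rewrite (_ : (fun w => _) = cst 0%E); last first.
      by apply/funext => w; rewrite Yn0// Y0// mxE subr0 normr0.
    by rewrite integral0 adde_ge0// mule_ge0// ?lee_fin// ltW.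
  have mSI := measurable_step_integral hL (mesh_step (F s) n).
  have mYs : mx_measurable_fun setT (Y s).
    by move=> k l; exact: (measurableT_comp (mY k l) (pair1_measurable s)).
  have mX : measurable_fun setT (fun w => Yn n s w i - Y s w i ord0).
    by apply: measurable_funB; [exact: mSI|exact: mYs].
  rewrite (le_trans (integral_norm_le_eps_sqr P mX eps0))//.
  rewrite indicE mem_set//= mule1; apply: leeD => //.
  rewrite EFinM -muleA; apply: lee_wpmul2l; first by rewrite lee_fin invr_ge0 ltW.
  apply: le_trans ((hK _ (mFs s) (FC s) (FM s)).1 _ n (FY Ds)).
  apply: ge0_le_integral => //.
  - by move=> w _; rewrite lee_fin sqr_ge0.
  - by apply/measurable_EFinP; exact: measurable_funX.
  - by apply: measurable_sqr_norm_mx; apply: mx_measurable_funB; [exact: mSI|exact: mYs].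
  - move=> w _; rewrite lee_fin -[leLHS]real_normK ?num_real// lerXn2r// ?nnegrE//.
    have := ler_entry_norm (step_integral L (mesh_step (F s) n) w - Y s w) i ord0.
    by rewrite mxBE.
have K1 : 0 < eps^-1 * K + 1 by rewrite ltr_wpDl.
have h2 : 0 < eta / (2 * (eps^-1 * K + 1)) by rewrite divr_gt0// mulr_gt0.
have := cvge0_near_le cvg_e h2; apply: filterS => n en.
have := @fubini_tonelli _ _ _ _ _ mu P _ (mdelta n i).
move=> /(_ (fun z => normr_ge0 _)) /= <-.
have m1 : measurable_fun setT (fun s => eps%:E * (\1_D s)%:E)%E.
  apply: emeasurable_funM => //.
  by apply/measurable_EFinP; apply: measurable_indic; exact: mD.
have m2 : measurable_fun setT (fun s => (eps^-1 * K)%:E * e n s)%E.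
  by apply: emeasurable_funM => //; exact: me.
apply: (@le_trans _ _ (\int[mu]_s (eps%:E * (\1_D s)%:E + (eps^-1 * K)%:E * e n s))%E).
  apply: ge0_le_integral => //.
  - by move=> s _; apply: integral_ge0 => w _; rewrite lee_fin.
  - exact: (@measurable_fun_fubini_tonelli_F _ _ _ _ _ P _ (mdelta n i)
      (fun z => normr_ge0 _)).
  - by apply: emeasurable_funD; [exact: m1|exact: m2].
rewrite ge0_integralD; [|by []| |exact: m1| |exact: m2]; last 2 first.
- by move=> s _; rewrite mule_ge0// lee_fin// ltW.
- by move=> s _; rewrite mule_ge0.
have -> : (\int[mu]_s (eps%:E * (\1_D s)%:E) = (eps * lam)%:E)%E.
  rewrite ge0_integralZl_EFin; [by rewrite lamE|by []|by []| |exact: ltW].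
  by apply/measurable_EFinP; apply: measurable_indic; exact: mD.
rewrite ge0_integralZl_EFin//; last exact: me.
apply: (@le_trans _ _ ((eps * lam)%:E + (eps^-1 * K)%:E * (eta / (2 * (eps^-1 * K + 1)))%:E)%E).
  by apply: leeD => //; apply: lee_wpmul2l.
rewrite -EFinM -EFinD lee_fin.
rewrite [leRHS](_ : _ = eta / 2 + eta / 2); last by lra.
apply: lerD.
  rewrite /eps invfM mulrA -[leRHS]mulr1 -mulrA; apply: ler_wpM2l; first by rewrite divr_ge0// ltW.
  by rewrite mulrC ler_pdivrMr// mul1r lerDl.
set k := eps^-1 * K.
rewrite [leLHS](_ : _ = eta / 2 * (k / (k + 1))); last by rewrite invfM; ring.
rewrite -[leRHS]mulr1; apply: ler_wpM2l; first by rewrite divr_ge0// ltW.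
by rewrite ler_pdivrMr// mul1r lerDl.
Qed.

Let cvg_Z i (eta : R) : 0 < eta -> \forall n \near \oo,
  (\int[P]_w `|step_integral L (mesh_step G n) w i ord0 - Z w i ord0|%:E <= eta%:E)%E.
Proof.
move=> eta0.
have [K K0 hK] := mesh_step_integral_bound d hL L2 (C * lam) (\sum_(i < d) \sum_(j < m) (M * lam)).
pose eps := eta / 2.
have eps0 : 0 < eps by rewrite divr_gt0.
have K1 : 0 < eps^-1 * K + 1 by rewrite ltr_wpDl// mulr_ge0// invr_ge0 ltW.
have h2 : 0 < eps / (eps^-1 * K + 1) by rewrite divr_gt0.
have [_ mZ _] := GZ.
have := cvge0_near_le (mesh_step_cvg_L1 measurable_integrated_kernel integrated_kernel_L1) h2; apply: filterS => n en.
have mSI := measurable_step_integral hL (mesh_step G n).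
have mX : measurable_fun setT (fun w => step_integral L (mesh_step G n) w i ord0 - Z w i ord0).
  by apply: measurable_funB; [exact: mSI|exact: mZ].
rewrite (le_trans (integral_norm_le_eps_sqr P mX eps0))//.
have -> : eta%:E = (eps%:E + eps%:E)%E by rewrite -EFinD; congr EFin; rewrite /eps; lra.
apply: leeD => //.
apply: (@le_trans _ _ ((eps^-1)%:E * (K%:E * (eps / (eps^-1 * K + 1))%:E))%E).
  apply: lee_wpmul2l; first by rewrite lee_fin invr_ge0 ltW.
  apply: (@le_trans _ _ (\int[P]_w (`|step_integral L (mesh_step G n) w - Z w| ^+ 2)%:E)%E).
    apply: ge0_le_integral => //.
    - by move=> w _; rewrite lee_fin sqr_ge0.
    - by apply/measurable_EFinP; exact: measurable_funX.
    - by apply: measurable_sqr_norm_mx; apply: mx_measurable_funB; [exact: mSI|exact: mZ].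
    - move=> w _; rewrite lee_fin -[leLHS]real_normK ?num_real// lerXn2r// ?nnegrE//.
      by have := ler_entry_norm (step_integral L (mesh_step G n) w - Z w) i ord0; rewrite mxBE.
  apply: le_trans ((hK _ measurable_integrated_kernel integrated_kernel_bound integrated_kernel_L1).1 _ n GZ) _.
  exact: lee_wpmul2l.
rewrite -!EFinM lee_fin mulrA mulrCA -[leRHS]mulr1; apply: ler_wpM2l; first exact: ltW.
by rewrite ler_pdivrMr// mul1r lerDl.
Qed.

(** Let W be the difference of the two sides. By the exact exchange at mesh n, W is the mesh error
    of Z minus the integral over s of the mesh error of Y. Both tend to 0 in L^1(P) while W does not
    depend on n, so W = 0 almost surely. *)
Lemma kernel_fubini : {ae P, forall w, forall i,
  mu.-integrable setT (EFin \o (fun s => Y s w i ord0)) /\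
  \int[mu]_s Y s w i ord0 = Z w i ord0}.
Proof.
suff H i : {ae P, forall w,
    mu.-integrable setT (EFin \o (fun s => Y s w i ord0)) /\
    \int[mu]_s Y s w i ord0 = Z w i ord0}.
  have : {ae P, forall w, forall i, i \in enum 'I_d ->
      mu.-integrable setT (EFin \o (fun s => Y s w i ord0)) /\
      \int[mu]_s Y s w i ord0 = Z w i ord0}.
    elim: (enum _) => [|j r ih]; first by apply: aeW.
    apply: filterS2 (H j) ih => w Hj ih k; rewrite inE => /predU1P[->//|].
    exact: ih.
  by apply: filterS => w h i; apply: h; rewrite mem_enum.
have mYw w : measurable_fun setT (fun s => Y s w i ord0).
  exact: (measurableT_comp (mY i ord0) (pair2_measurable w)).
(* A path of Y is a path of the mesh integral, integrable in s for every w, minus the difference,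
   integrable in s for almost every w as its norm has finite expectation. A single good n is
   enough. *)
have aeI n : (\int[P]_w \int[mu]_s `|Yn n s w i - Y s w i ord0|%:E < +oo)%E ->
    {ae P, forall w, mu.-integrable setT (EFin \o (fun s => Y s w i ord0)) /\
      mu.-integrable setT (EFin \o (fun s => Yn n s w i - Y s w i ord0))}.
  move=> foo.
  have mh : measurable_fun setT (fun w => \int[mu]_s `|Yn n s w i - Y s w i ord0|%:E)%E.
    apply: (@measurable_section_integral _ _ _
      (fun z : T * R => `|Yn n z.2 z.1 i - Y z.2 z.1 i ord0|%:E) setT) => //.
    exact: (measurableT_comp (mdelta n i) (measurable_fun_pair measurable_snd measurable_fst)).
  have h0 w : (0 <= \int[mu]_s `|Yn n s w i - Y s w i ord0|%:E)%E.
    by apply: integral_ge0 => s _; rewrite lee_fin.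
  have : P.-integrable setT (fun w => \int[mu]_s `|Yn n s w i - Y s w i ord0|%:E)%E.
    apply/integrableP; split; first exact: mh.
    by under eq_integral do rewrite gee0_abs//.
  move/(integrable_ae measurableT); apply: filterS => w /(_ I).
  rewrite ge0_fin_numE// => hw.
  have iD' : mu.-integrable setT (EFin \o (fun s => Yn n s w i - Y s w i ord0)).
    apply/integrableP; split; last by [].
    apply/measurable_EFinP; apply: measurable_funB; last exact: mYw.
    exact: (measurableT_comp (mYn n i) (pair2_measurable w)).
  split; last exact: iD'.
  have := integrableB measurableT (YnE n w i).1 iD'.
  by apply: eq_integrable => // s _; rewrite /= -EFinB; congr EFin; ring.
pose W w := \int[mu]_s Y s w i ord0 - Z w i ord0.
have [_ mZ _] := GZ.
have mW : measurable_fun setT W.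
  apply: measurable_funB; last exact: mZ.
  apply: measurableT_comp => //.
  apply: (@measurable_section_integral _ _ _ (fun z : T * R => (Y z.2 z.1 i ord0)%:E) setT) => //.
  apply/measurable_EFinP.
  exact: (measurableT_comp (mY i ord0) (measurable_fun_pair measurable_snd measurable_fst)).
have aeJ : {ae P, forall w, mu.-integrable setT (EFin \o (fun s => Y s w i ord0))}.
  near \oo => n.
  have /aeI : (\int[P]_w \int[mu]_s `|Yn n s w i - Y s w i ord0|%:E < +oo)%E.
    apply: (@le_lt_trans _ _ 1%:E); last exact: ltry.
    by near: n; exact: cvg_delta.
  by apply: filterS => w [].
have W0 : (\int[P]_w `|(W w)%:E| = 0)%E.
  apply/eqP; rewrite eq_le integral_ge0// andbT.
  apply/lee_addgt0Pr => eta eta0; rewrite add0e.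
  have h2 : 0 < eta / 2 by rewrite divr_gt0.
  near \oo => n.
  have n1 : (\int[P]_w \int[mu]_s `|Yn n s w i - Y s w i ord0|%:E <= (eta / 2)%:E)%E.
    by near: n; exact: cvg_delta.
  have n2 : (\int[P]_w `|step_integral L (mesh_step G n) w i ord0 - Z w i ord0|%:E <=
      (eta / 2)%:E)%E.
    by near: n; exact: cvg_Z.
  have mh : measurable_fun setT (fun w => \int[mu]_s `|Yn n s w i - Y s w i ord0|%:E)%E.
    apply: (@measurable_section_integral _ _ _
      (fun z : T * R => `|Yn n z.2 z.1 i - Y z.2 z.1 i ord0|%:E) setT) => //.
    exact: (measurableT_comp (mdelta n i) (measurable_fun_pair measurable_snd measurable_fst)).
  have h0 w : setT w -> (0 <= \int[mu]_s `|Yn n s w i - Y s w i ord0|%:E)%E.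
    by move=> _; apply: integral_ge0 => s _; rewrite lee_fin.
  have mz : measurable_fun setT
      (fun w => `|step_integral L (mesh_step G n) w i ord0 - Z w i ord0|%:E).
    apply/measurable_EFinP; apply: measurableT_comp => //; apply: measurable_funB.
      exact: (measurable_step_integral hL (mesh_step G n)).
    exact: mZ.
  have -> : eta%:E = ((eta / 2)%:E + (eta / 2)%:E)%E by rewrite -EFinD; congr EFin; lra.
  apply: le_trans (leeD n1 n2); rewrite -ge0_integralD//.
  apply: ae_ge0_le_integral => //.
  - by apply: measurableT_comp => //; exact/measurable_EFinP.
  - by move=> w _; rewrite adde_ge0// h0.
  - exact: emeasurable_funD.
  have /aeI : (\int[P]_w \int[mu]_s `|Yn n s w i - Y s w i ord0|%:E < +oo)%E.
    exact: le_lt_trans n1 (ltry _).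
  apply: filterS => w [iY iYn] _.
  have iN := integrable_norm iYn.
  rewrite -(fineK (integrable_fin_num measurableT iN)) -EFinD lee_fin.
  have [iYn' YnI] := YnE n w i.
  have -> : W w = (step_integral L (mesh_step G n) w i ord0 - Z w i ord0) -
      \int[mu]_s (Yn n s w i - Y s w i ord0).
    by rewrite RintegralB// YnI /W; ring.
  rewrite (le_trans (ler_normB _ _))// addrC lerD2r.
  exact: le_normr_Rintegral.
have mWE : measurable_fun setT (EFin \o W) by exact/measurable_EFinP.
have /(ae_eq_integral_abs P measurableT mWE) := W0.
apply: filterS2 aeJ => w iY /(_ I) /= [Ww]; split => //.
by apply/eqP; rewrite -subr_eq0; apply/eqP.
Unshelve. all: by end_near.
Qed.

End kernel_fubini.

(** * Extension by zero outside [a, b], and the theorem *)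

Section cutoff.
Context {R : realType} (dU : measure_display) (U : measurableType dU) (d m : nat).
Variable D : set R.

(** F and Y are controlled only for s in [a, b]. Extension by 0 makes measurability and bounds
    global and turns integrals over [a, b] into integrals over the line; a general second space U
    lets it serve both F and Y. *)
Definition cutoff (f : R -> U -> 'M[R]_(d, m)) (s : R) (u : U) :=
  if s \in D then f s u else 0.

Lemma cutoff_in f s : D s -> cutoff f s = f s.
Proof. by move=> Ds; apply/funext => u; rewrite /cutoff mem_set. Qed.

Lemma cutoff_out f s : ~ D s -> forall u, cutoff f s u = 0.
Proof. by move=> Ds u; rewrite /cutoff memNset. Qed.

Lemma measurable_cutoff f : measurable D ->
  mx_measurable_fun (D `*` setT) (fun z : R * U => f z.1 z.2) ->
  mx_measurable_fun setT (fun z : R * U => cutoff f z.1 z.2).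
Proof.
move=> mD mf i j.
have mDU : measurable (D `*` setT : set (R * U)) by exact: measurableX.
have /(@measurable_restrictT _ _ _ _ _ _ mDU) := mf i j.
rewrite (_ : _ \_ _ = fun z : R * U => cutoff f z.1 z.2 i j)//.
apply/funext => -[s u]; rewrite patchE /cutoff /= in_setX in_setT andbT.
by case: (s \in D); rewrite ?mxE.
Qed.

End cutoff.

Lemma Rintegral_cutoff {R : realType} (dU : measure_display) (U : measurableType dU)
    (d m : nat) (D : set R) (f : R -> U -> 'M[R]_(d, m)) u i j :
  \int[lebesgue_measure]_(s in D) f s u i j =
  \int[lebesgue_measure]_s cutoff D f s u i j.
Proof.
rewrite Rintegral_mkcond; congr (Rintegral _ _ _); apply/funext => s.
by rewrite patchE /cutoff; case: (s \in D); rewrite ?mxE.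
Qed.

Theorem theorem2p4 (R : realType) (disp : measure_display)
    (T : measurableType disp) (P : probability T R) (d m : nat) (a b : R)
    (L : R -> T -> 'cV[R]_m) (F : R -> R -> 'M[R]_(d, m)) :
  a <= b ->
  two_sided_levy_process P L ->
  finite_second_moments P L ->
  mx_measurable_fun (`[a, b]%classic `*` setT) (fun z : R * R => F z.1 z.2) ->
  (exists C : R, forall s u, s \in `[a, b] -> `|F s u| <= C) ->
  uniformly_absolutely_integrable a b F ->
  vanishes_uniformly_at_infinity a b F ->
  let G := fun u => mx_Rintegral lebesgue_measure `[a, b]%classic (F ^~ u) in
  [/\ exists Y, measurable_integral_version P L a b F Y,
      exists Z, is_stoch_integral P L G Z &
      forall (Y : R -> T -> 'cV[R]_d) (Z : T -> 'cV[R]_d),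
        measurable_integral_version P L a b F Y ->
        is_stoch_integral P L G Z ->
        {ae P, forall w,
          (forall i j, lebesgue_measure.-integrable `[a, b]
                         (fun s => (Y s w i j)%:E)) /\
          mx_Rintegral lebesgue_measure `[a, b]%classic (Y ^~ w) = Z w}].
Proof.
move=> ab hL L2 mF [C FC] [+ _] _ G.
set S := ereal_sup _ => Soo.
pose D : set R := `[a, b]%classic; pose F' := cutoff D F.
have mD : measurable D by exact: measurable_itv.
(* A point of [a, b] is what makes C and the supremum S nonnegative; S, being below +oo, is then a
   real number. *)
have aD : D a by rewrite /D /= in_itv /= lexx.
have mF' : mx_measurable_fun setT (fun z : R * R => F' z.1 z.2).
  exact: measurable_cutoff.
have FC' s u : `|F' s u| <= C.
  have [Ds|Ds] := pselect (D s); first by rewrite /F' cutoff_in//; exact: FC.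
  by rewrite /F' cutoff_out// normr0 (le_trans _ (FC a 0 aD)).
have SF s : D s -> (\int[lebesgue_measure]_u `|F s u|%:E <= S)%E.
  by move=> Ds; apply: ereal_sup_ubound; exists s.
have S0 : (0 <= S)%E.
  by apply: le_trans (SF _ aD); apply: integral_ge0 => u _; rewrite lee_fin.
have SE : S = (fine S)%:E by rewrite fineK// ge0_fin_numE.
have FM s : (\int[lebesgue_measure]_u `|F' s u|%:E <= (fine S)%:E)%E.
  rewrite -SE; have [Ds|Ds] := pselect (D s); first by rewrite /F' cutoff_in//; exact: SF.
  rewrite (_ : (fun u => _) = cst 0%E) ?integral0//.
  by apply/funext => u; rewrite /F' cutoff_out// normr0.
have F0 := @cutoff_out _ _ _ _ _ D F.
have GE : G = integrated_kernel F'.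
  by apply/funext => u; apply/matrixP => i j; rewrite !mxE Rintegral_cutoff.
split.
- have [Y [mY FY]] := exists_joint_version hL L2 mF' FC' FM.
  exists Y; split.
    by move=> i j; apply: measurable_funTS; exact: mY.
  by move=> s Ds; have := FY s; rewrite /F' cutoff_in.
- have mG := measurable_integrated_kernel mF'.
  (* G is regarded as a kernel constant in s, so that the existence of versions yields its integral,
     taken at s = 0. *)
  have mG' : mx_measurable_fun setT (fun z : R * R => integrated_kernel F' z.2).
    by move=> i j; exact: (measurableT_comp (mG i j) measurable_snd).
  have [Z [_ GZ]] := exists_joint_version hL L2 mG'
    (fun=> integrated_kernel_bound mF' FC' F0)
    (fun=> integrated_kernel_L1 mF' FC' FM F0).
  by exists (Z 0); rewrite GE; exact: GZ.
- move=> Y Z [mY FY] GZ; rewrite GE in GZ.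
  have mY' := measurable_cutoff mD mY.
  have FY' s : D s -> is_stoch_integral P L (F' s) (cutoff D Y s).
    by move=> Ds; rewrite /F' !cutoff_in//; exact: FY.
  have Y0' := @cutoff_out _ _ _ _ _ D Y.
  have := kernel_fubini hL L2 mF' FC' FM F0 mY' FY' Y0' GZ.
  apply: filterS => w H; split => [i j|].
    apply: (@integrable_mkcond _ _ _ lebesgue_measure D (fun s => (Y s w i j)%:E) mD).2.
    apply: eq_integrable (H i).1 => // s _; rewrite patchE /cutoff /= (ord1 j).
    by case: (s \in D); rewrite ?mxE.
  apply/matrixP => i j; rewrite mxE (ord1 j) -(H i).2.
  exact: Rintegral_cutoff.
Qed.
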